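(* Let $(\mathscr{B},\mathscr{B}')$ be a compatible pair of collections of integer bases $\mathscr{B},\mathscr{B}'\subseteq\mathbb N\setminus\{1\}$. Then the set of partly normal numbers $\mathscr N(\mathscr{B},\mathscr{B}')$ is a set of multiplicity. This includes $\mathscr N(\emptyset,\mathbb N\setminus\{1\})$, the set of real numbers that are non-normal in every base.
   Context: $\mathbb N=\{1,2,3,\dots\}$. Normality: for an integer $b\ge 2$ and $x\in[0,1)$ write $x=\sum_{j\ge1}x_jb^{-j}$ with digits $x_j\in\{0,\dots,b-1\}$. The number $x$ is $b$-normal if for every $k\ge1$ and every $(d_1,\dots,d_k)\in\{0,\dots,b-1\}^k$, $\lim_{N\to\infty}\frac1N\#\{1\le n\le N:(x_n,\dots,x_{n+k-1})=(d_1,\dots,d_k)\}=b^{-k}$. A real number is $b$-normal if its fractional part is. Throughout $\mathscr B\cup\mathscr B'\neq\emptyset$. For non-empty collections, $\mathscr N(\mathscr B,\cdot)$ is the set of real $x$ that are $b$-normal for all $b\in\mathscr B$, $\mathscr N(\cdot,\mathscr B')$ is the set of real $x$ that are not $b'$-normal for any $b'\in\mathscr B'$. Conventions: $\mathscr N(\cdot,\emptyset):=\mathscr N(\mathbb N\setminus\{1\},\cdot)$ and $\mathscr N(\emptyset,\cdot):=\mathscr N(\cdot,\mathbb N\setminus\{1\})$. In all cases $\mathscr N(\mathscr B,\mathscr B'):=\mathscr N(\mathscr B,\cdot)\cap\mathscr N(\cdot,\mathscr B')$. For $r,s\in\mathbb N\setminus\{1\}$ write $r\sim s$ if $r^m=s^n$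 for some $m,n\in\mathbb N$, and $r\not\sim s$ otherwise. The pair $(\mathscr B,\mathscr B')$ is compatible if $b\not\sim b'$ for all $(b,b')\in\mathscr B\times\mathscr B'$; this is taken to be vacuously true if exactly one of $\mathscr B,\mathscr B'$ is empty. A set $E\subseteq[0,1)$ is a set of uniqueness if any trigonometric series $\sum_{n\in\mathbb Z}a_ne^{-2\pi inx}$ with complex coefficients (convergence being that of the symmetric partial sums) that converges to zero for every $x\in[0,1)\setminus E$ has $a_n=0$ for all $n\in\mathbb Z$. Otherwise $E$ is a set of multiplicity. Membership in $\mathscr N(\mathscr B,\mathscr B')$ depends only on the fractional part, and the statement concerns $\mathscr N(\mathscr B,\mathscr B')\cap[0,1)$. *)

(* Defs.v *)
From HB Require Import structures.
From mathcomp Require Import all_boot all_order all_algebra.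
From mathcomp Require Import complex.
From mathcomp Require Import all_classical all_reals all_analysis.

Set Implicit Arguments.
Unset Strict Implicit.
Unset Printing Implicit Defensive.

Import Order.TTheory GRing.Theory Num.Theory.
Import numFieldNormedType.Exports.

Local Open Scope classical_set_scope.
Local Open Scope ring_scope.
Local Open Scope complex_scope.

Definition bases : set nat := [set b | (2 <= b)%N].

(* For x in [0, 1[ and j >= 1, the j-th digit after the radix point of the
   greedy expansion of x in base b; see digit_expansion below. *)
Definition digit (R : realType) (b : nat) (x : R) (j : nat) : nat :=
  (Num.truncn (b%:R ^+ j * x) %% b)%N.

Definition frac (R : realType) (x : R) : R := x - (Num.floor x)%:~R.

(* The number of 1 <= n <= N such that (x_n, ..., x_{n+k-1}) = d. *)
Definition block_count (R : realType) (b : nat) (x : R) (k : nat)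
    (d : k.-tuple 'I_b) (N : nat) : nat :=
  #|[set n : 'I_N | [forall i : 'I_k, digit b x (n.+1 + i) == tnth d i]]|%SET.

Definition normal (R : realType) (b : nat) (x : R) : Prop :=
  forall (k : nat) (d : k.-tuple 'I_b), (1 <= k)%N ->
    (block_count (frac x) d N)%:R / N%:R @[N --> \oo] --> (b%:R ^- k : R).

Definition normal_all (R : realType) (B : set nat) : set R :=
  [set x | forall b, B b -> normal b x].

Definition nonnormal_all (R : realType) (B' : set nat) : set R :=
  [set x | forall b', B' b' -> ~ normal b' x].

(* An empty collection on one side of N(B, B') does not impose a vacuous
   condition: N(set0, .) := N(., bases) and N(., set0) := N(bases, .). *)
Definition normal_part (R : realType) (B : set nat) : set R :=
  if B == set0 then nonnormal_all bases else normal_all B.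

Definition nonnormal_part (R : realType) (B' : set nat) : set R :=
  if B' == set0 then normal_all bases else nonnormal_all B'.

Definition partly_normal (R : realType) (B B' : set nat) : set R :=
  normal_part B `&` nonnormal_part B'.

Arguments partly_normal R B B' : clear implicits.

Definition mult_dependent (r s : nat) : Prop :=
  exists m n : nat, [/\ (1 <= m)%N, (1 <= n)%N & (r ^ m = s ^ n)%N].

Definition compatible (B B' : set nat) : Prop :=
  forall b b', B b -> B' b' -> ~ mult_dependent b b'.

(* e^{it} *)
Definition expi (R : realType) (t : R) : R[i] := cos t +i* sin t.

(* The sum over -N <= n <= N of a_n e^{-2 pi i n x}. *)
Definition trig_sum (R : realType) (a : int -> R[i]) (x : R) (N : nat) : R[i] :=
  \sum_(j < N.*2.+1) let n := j%:Z - N%:Z in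
    a n * expi (- (2 * pi * n%:~R * x)).

Definition uniqueness_set (R : realType) (E : set R) : Prop :=
  forall a : int -> R[i],
    (forall x : R, x \in `[0, 1[ -> ~ E x ->
      (trig_sum a x : nat -> R[i]^o) @ \oo --> (0 : R[i]^o)) ->
    forall n, a n = 0.

Definition multiplicity_set (R : realType) (E : set R) : Prop :=
  (E `<=` `[0, 1[) /\ ~ uniqueness_set E.

Lemma digit_lt (R : realType) (b : nat) (x : R) (j : nat) :
  (2 <= b)%N -> (digit b x j < b)%N.
Proof. by move=> b2; rewrite /digit ltn_mod (leq_trans _ b2). Qed.

Lemma digit_sum (R : realType) (b : nat) (x : R) (N : nat) :
  (2 <= b)%N -> 0 <= x < 1 ->
  \sum_(1 <= j < N.+1) (digit b x j)%:R * b%:R ^- j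
    = (Num.truncn (b%:R ^+ N * x))%:R * b%:R ^- N :> R.
Proof.
move=> b2 /andP[x0 x1].
have b0 : (0 < b)%N by rewrite (leq_trans _ b2).
have bR0 : 0 < b%:R :> R by rewrite ltr0n.
elim: N => [|N IH].
  rewrite big_geq// expr0 mul1r invr1 mulr1.
  by have -> : Num.truncn x = 0%N by apply/truncn_def; rewrite ?x0 //= x0 x1.
rewrite big_nat_recr//= IH /digit.
set t := Num.truncn (b%:R ^+ N.+1 * x).
have -> : Num.truncn (b%:R ^+ N * x) = (t %/ b)%N.
  apply/truncn_def; have /andP[t1 t2] : t%:R <= b%:R ^+ N.+1 * x < t.+1%:R.
    by apply: truncn_itv; rewrite mulr_ge0// exprn_ge0// ltW.
  apply/andP; split.
    rewrite -(ler_pM2l bR0) mulrA -exprS (le_trans _ t1)// -natrM ler_nat.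
    by rewrite mulnC leq_divM.
  rewrite -(ltr_pM2l bR0) mulrA -exprS (lt_le_trans t2)// -natrM ler_nat.
  by rewrite mulnC ltn_ceil.
rewrite [in RHS](divn_eq t b) natrD natrM mulrDl; congr (_ + _).
by rewrite exprS invfM -!mulrA (mulrA b%:R) divff ?mul1r// gt_eqF.
Qed.

Lemma digit_expansion (R : realType) (b : nat) (x : R) :
  (2 <= b)%N -> 0 <= x < 1 ->
  \sum_(1 <= j < N.+1) ((digit b x j)%:R * b%:R ^- j : R) @[N --> \oo] --> x.
Proof.
move=> b2 x01; have /andP[x0 _] := x01.
have bR0 : 0 < b%:R :> R by rewrite ltr0n (leq_trans _ b2).
rewrite (_ : (fun _ => _) =
    (fun N => (Num.truncn (b%:R ^+ N * x))%:R * b%:R ^- N)); last first.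
  by apply/funext => N; rewrite digit_sum.
have H : x - b%:R^-1 ^+ N @[N --> \oo] --> x.
  rewrite -[X in _ --> X]subr0; apply: cvgB; first exact: cvg_cst.
  by apply: cvg_expr; rewrite ger0_norm ?invr_ge0 ?(ltW bR0)// invf_lt1// ltr1n.
apply: (squeeze_cvgr _ H (cvg_cst x)); apply: nearW => N.
have bN : 0 < b%:R ^+ N :> R by rewrite exprn_gt0.
have /andP[t1 t2] : (Num.truncn (b%:R ^+ N * x))%:R <= b%:R ^+ N * x <
    (Num.truncn (b%:R ^+ N * x)).+1%:R.
  by apply: truncn_itv; rewrite mulr_ge0// ltW.
apply/andP; split.
  rewrite ler_pdivlMr// mulrBl exprVn mulVf ?gt_eqF// lerBlDr natr1 mulrC.
  exact: ltW.
by rewrite ler_pdivrMr// [leRHS]mulrC.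
Qed.

(* Main.v *)
Require Import Defs.
From mathcomp Require Import all_boot all_order all_algebra.
From mathcomp Require Import complex.
From mathcomp Require Import all_classical all_reals all_analysis.
From mathcomp Require Import zify ring lra.

(** Fix a set B' of bases.  It is enough to find trigonometric polynomials f_k
    whose Fourier coefficients are uniformly small at high frequencies and
    converge to some c with c(0) <> 0, such that f_k tends to 0 off a closed set
    K of numbers that are non-normal in the bases of B' and normal in those
    independent of B': by Riemann localization the series with coefficients c
    converges to 0 off K.

    The density at stage k is multiplied by the average of k+1 Riesz products
    prod_(n <= t < 2n) (1 + cos(2 pi s^(2t) x)) at far apart scales n, where s
    runs through B' and takes each value infinitely often.  Their spectra lie in
    disjoint windows, so each coefficient moves by at most 4/(k+1), while under
    each product the mean of cos(2 pi s^m x) over 2n <= m < 4n is close to 1/4,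
    which excludes s-normality.  For b independent of s the pairs i, j with
    h(b^i - b^j) in the spectrum of the product at scale n are o(n^2) in number,
    so the series of the squared averages of e(h b^i x), divided by their length,
    has small mean; where it is finite, the averages tend to 0 and x is b-normal.

    K is the set where a sum T of such nonnegative test functions is at most 1.
    Only finitely many terms T_k are present at stage k, and f_k is the density
    times a polynomial in T_k approximating max(0, 1 - T_k).  All functions are
    trigonometric polynomials, so their integrals are finite averages. *)

Set Implicit Arguments.
Unset Strict Implicit.
Unset Printing Implicit Defensive.

Import Order.TTheory GRing.Theory Num.Theory.
Import numFieldNormedType.Exports.

Local Open Scope ring_scope.

(** * Multiplicative independence *)

(** A single Riesz product has Fourier coefficients of size 1/2 at arbitrarily high frequencies, so
    a construction with one product per stage would not give coefficients that are small at
    infinity, as localization requires. Averaging over k+1 scales makes each change small, but then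
    the bias is guaranteed at only one of the scales, and which one depends on the point. The test
    of a stage is therefore a product over the scales: it has small mean under every summand, and
    where it is at most 1 some factor is at most 1. The products use the base s^2 although the bias
    concerns the base s. Since s^2 >= 4, digits up to 2 and up to s + 1 stay below the base, so a
    digit sum vanishes only if all its digits do, even for s = 2. Even powers of s have mean 1/2 and
    odd ones mean 0, whence 1/4. The tolerances decrease geometrically and start so small that the
    coefficient at 0, equal to 1 at the beginning, moves by at most 1/2. *)

Lemma Posz_exp (n k : nat) : n%:Z ^+ k = (n ^ k)%N.
Proof. by elim: k => // k IH; rewrite exprS IH -PoszM -expnS. Qed.

Lemma dvdzDl (d m n : int) : (d %| m)%Z -> (d %| m + n)%Z = (d %| n)%Z.
Proof. by move=> dm; apply: rpredDl. Qed.

Lemma prime_coprimeX (p K : nat) (u : int) : prime p -> ~~ (p%:Z %| u)%Z ->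
  coprimez (p%:Z ^+ K) u.
Proof.
move=> pp pu; rewrite coprimezE abszX; apply: coprimeXl.
by rewrite prime_coprime// absz_nat; move: pu; rewrite dvdzE absz_nat.
Qed.

(** The sum is the cofactor of X - Y in X^n - Y^n. Modulo q each of its n terms equals Y^(n-1). *)
Lemma dvdz_sum_pow (q X Y : int) n : (q %| X - Y)%Z ->
  (q %| \sum_(i < n) X ^+ (n.-1 - i) * Y ^+ i - n%:Z * Y ^+ n.-1)%Z.
Proof.
move=> qXY.
have -> : n%:Z * Y ^+ n.-1 = \sum_(i < n) Y ^+ (n.-1 - i) * Y ^+ i.
  rewrite (eq_bigr (fun=> Y ^+ n.-1)); last first.
    by move=> i _; rewrite -exprD subnK//; case: i => i /=; lia.
  by rewrite sumr_const card_ord -mulr_natl natz.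
rewrite -sumrB; apply: rpred_sum => i _; rewrite -mulrBl subrXX -mulrA.
exact: dvdz_mulr.
Qed.

(** Lifting the exponent, by strong induction on m. A factor p of m contributes exactly one factor p
    to the cofactor; assuming p^2 | X - Y makes this true for p = 2 as well. If p does not divide m,
    the cofactor is prime to p. *)
Lemma lte_aux (p : nat) (X Y : int) (a : nat) : prime p -> ~~ (p%:Z %| Y)%Z ->
  (p%:Z ^+ 2 %| X - Y)%Z -> ~~ (p%:Z ^+ a.+1 %| X - Y)%Z ->
  forall m K, (0 < m)%N -> (p%:Z ^+ K %| X ^+ m - Y ^+ m)%Z -> (p ^ K <= p ^ a * m)%N.
Proof.
move=> pp pY p2 pa m; have p1 := prime_gt1 pp.
have pXY : (p%:Z %| X - Y)%Z by apply: dvdz_trans p2; rewrite expr2 dvdz_mulr.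
have pYX j : ~~ (p%:Z %| Y ^+ j)%Z.
  apply: contra pY; rewrite !dvdzE abszX absz_nat.
  by case: j => [|j]; rewrite ?expn0 ?Euclid_dvdX ?andbT// dvdn1 => /eqP p1'; rewrite p1' in p1.
elim/ltn_ind: m => m IH K m0 HK.
have [pm|pm] := boolP (p %| m)%N.
  case: K HK => [|K HK]; first by rewrite expn0 muln_gt0 expn_gt0 prime_gt0.
  have [m' Em] := dvdnP pm.
  have m'0 : (0 < m')%N by move: m0; rewrite Em muln_gt0 => /andP[].
  have m'm : (m' < m)%N by rewrite Em ltn_Pmulr.
  have p2' : (p%:Z ^+ 2 %| X ^+ m' - Y ^+ m')%Z by rewrite subrXX dvdz_mulr.
  have := dvdz_sum_pow p p2'.
  move: HK; rewrite Em !exprM subrXX; set Q := \sum_(i < p) _ => HK.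
  move=> /dvdzP[z Hz].
  have EQ : Q = p%:Z * (z * p%:Z + (Y ^+ m') ^+ p.-1).
    by rewrite -[LHS](subrK (p%:Z * (Y ^+ m') ^+ p.-1)) Hz; ring.
  move: HK; rewrite EQ mulrCA exprS dvdz_mul2l ?intr_eq0 -?lt0n ?prime_gt0//.
  rewrite mulrC Gauss_dvdzr; last first.
    apply: prime_coprimeX => //.
    by rewrite (dvdzDl _ (dvdz_mull z (dvdzz p%:Z))) -exprM; exact: pYX.
  by move/(IH _ m'm _ m'0); rewrite expnS mulnA [(_ * p)%N]mulnC leq_pmul2l ?prime_gt0.
move: HK; rewrite subrXX mulrC Gauss_dvdzr; last first.
  apply: prime_coprimeX => //.
  have := dvdz_sum_pow m pXY; set Q := \sum_(i < m) _ => /dvdzP[z Hz].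
  have -> : Q = z * p%:Z + m%:Z * Y ^+ m.-1 by rewrite -Hz; ring.
  rewrite (dvdzDl _ (dvdz_mull z (dvdzz p%:Z))).
  apply/negP; rewrite dvdzE abszM Euclid_dvdM// => /orP[|].
    by rewrite !absz_nat; apply/negP.
  by rewrite -dvdzE; apply/negP/pYX.
move=> HK; have Ka : (K <= a)%N.
  rewrite leqNgt; apply: contra pa => aK.
  by apply: dvdz_trans HK; exact: dvdz_exp2l.
by apply: leq_trans (leq_pmulr _ m0); rewrite leq_exp2l.
Qed.

(** Lifting the exponent applies to X^f and Y^f once p^2 divides their difference, and X^m - Y^m
    divides X^(f m) - Y^(f m). If no such f exists, K is at most 1. *)
Lemma lte_bound (p X Y : nat) : prime p -> ~~ (p %| Y)%N -> (0 < X)%N -> X != Y ->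
  exists2 c, (0 < c)%N & forall m K, (0 < m)%N ->
    (p%:Z ^+ K %| X%:Z ^+ m - Y%:Z ^+ m)%Z -> (p ^ K <= c * m)%N.
Proof.
move=> pp pY X0 XY; have p1 := prime_gt1 pp.
have Y0 : (0 < Y)%N by case: Y pY {XY} => //; rewrite dvdn0.
have [[f f0 Hf]|Hf] := pselect (exists2 f, (0 < f)%N &
    (p%:Z ^+ 2 %| X%:Z ^+ f - Y%:Z ^+ f)%Z); last first.
  exists p => [|m K m0 HK]; first exact: prime_gt0.
  have K2 : (K < 2)%N.
    rewrite ltnNge; apply/negP => K2; apply: Hf; exists m => //.
    by apply: dvdz_trans HK; exact: dvdz_exp2l.
  case: K K2 HK => [_ _|[_ _|//]].
    by rewrite expn0 muln_gt0 m0 prime_gt0.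
  by rewrite expn1 leq_pmulr.
(* A crude bound on the exponent of p suffices: p^(a+1) > a, so p^(a+1) cannot divide the nonzero
   difference. *)
pose a := `|X%:Z ^+ f - Y%:Z ^+ f|%N.
have a0 : (0 < a)%N.
  by rewrite absz_gt0 subr_eq0 !Posz_exp eqz_nat eqn_exp2r.
exists (p ^ a)%N => [|m K m0 HK]; first by rewrite expn_gt0 prime_gt0.
apply: (@lte_aux p (X%:Z ^+ f) (Y%:Z ^+ f)) => //.
- rewrite dvdzE abszX !absz_nat; apply: contra pY.
  by rewrite Euclid_dvdX// => /andP[].
- rewrite dvdzE abszX -/a absz_nat; apply/negP => /(dvdn_leq a0).
  by have := ltn_expl a.+1 p1; lia.
- by rewrite -!exprM ![(f * m)%N]mulnC !exprM subrXX dvdz_mulr.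
Qed.

(** * Signed digit sums and the frequencies of a block *)

Definition digit_sum (w : int) (n m : nat) (d : nat -> int) : int :=
  \sum_(n <= t < m) d t * w ^+ t.

Lemma dvdz_digit_sum w n m d : (w ^+ n %| digit_sum w n m d)%Z.
Proof.
rewrite /digit_sum big_nat; apply: rpred_sum => t /andP[nt _].
by apply: dvdz_mull; exact: dvdz_exp2l.
Qed.

Lemma dvdz_small (w d : int) : (w %| d)%Z -> `|d| < `|w| -> d = 0.
Proof.
rewrite dvdzE => wd dw; apply/eqP; rewrite -absz_eq0; apply/negP => d0.
by have := dvdn_leq _ wd; lia.
Qed.

(** The lowest digit is divisible by w, hence zero, and the argument repeats with the remaining
    ones. *)
Lemma digit_sum_eq0 (w : int) n m d : 1 < w ->
  (forall t, (n <= t < m)%N -> `|d t| < w) -> digit_sum w n m d = 0 ->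
  forall t, (n <= t < m)%N -> d t = 0.
Proof.
move=> w1; move Ek : (m - n)%N => k.
elim: k n Ek => [n mn _ _ t /andP[nt tm]|k IH n mn Hd H0]; first lia.
have nm : (n < m)%N by lia.
have dn : d n = 0.
  apply: (@dvdz_small w); last by rewrite (gtr0_norm (_ : 0 < w)) ?Hd; lia.
  have w0 : w ^+ n != 0 by rewrite expf_neq0//; lia.
  rewrite -(@dvdz_mul2r (w ^+ n) w (d n) w0) -exprS.
  move: H0; rewrite /digit_sum big_ltn// => /eqP; rewrite addr_eq0 => /eqP ->.
  by rewrite rpredN; exact: dvdz_digit_sum.
move=> t /andP[]; rewrite leq_eqVlt => /orP[/eqP <- //|nt tm].
apply: (IH n.+1) => //; rewrite ?nt//; first lia.
  by move=> u /andP[nu um]; apply: Hd; lia.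
by move: H0; rewrite /digit_sum big_ltn// dn mul0r add0r.
Qed.

Lemma digit_sum_le (w : int) n m d : 1 < w ->
  (forall t, `|d t| <= 1) -> `|digit_sum w n m d| <= w ^+ m.
Proof.
move=> w1 Hd; have w0 k : 0 < w ^+ k by rewrite exprn_gt0//; lia.
have [mn|nm] := leqP m n; first by rewrite /digit_sum big_geq// normr0 ltW.
elim: m nm => // m IH nm.
rewrite /digit_sum big_nat_recr//=.
have {}IH : `|digit_sum w n m d| <= w ^+ m.
  move: nm; rewrite ltnS leq_eqVlt => /orP[/eqP <-|]; last exact: IH.
  by rewrite /digit_sum big_geq// normr0 ltW.
rewrite (le_trans (ler_normD _ _))// normrM.
have H1 : `|d m| * `|w ^+ m| <= w ^+ m.
  by rewrite (gtr0_norm (w0 m)) ler_piMl// ltW.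
rewrite (le_trans (lerD IH H1))// exprS -mulr2n -mulr_natl ler_pM2r//; lia.
Qed.

(** The frequencies of a Riesz product with the constant 1 removed, see [rtrig_rieszB1]. *)
Definition block_sum (w n : nat) (z : int) : Prop :=
  exists d : nat -> int, [/\ forall t, `|d t| <= 1,
    (exists2 t, (n <= t < n.*2)%N & d t != 0) & z = digit_sum w n n.*2 d].

Lemma block_sum_dvd w n z : block_sum w n z -> (w%:Z ^+ n %| z)%Z.
Proof. by move=> [d [_ _ ->]]; exact: dvdz_digit_sum. Qed.

Lemma block_sum_le w n z : (1 < w)%N -> block_sum w n z -> `|z| <= w%:Z ^+ n.*2.
Proof. by move=> w1 [d [Hd _ ->]]; exact: digit_sum_le. Qed.

Lemma block_sum_neq0 w n z : (2 <= w)%N -> block_sum w n z -> z != 0.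
Proof.
move=> w1 [d [Hd [t tn dt] ->]]; apply/negP => /eqP H.
move/negP: dt; apply; apply/eqP; apply: digit_sum_eq0 H _ tn => //.
by move=> u _; apply: le_lt_trans (Hd u) _.
Qed.

Lemma block_sum_ge w n z : (2 <= w)%N -> block_sum w n z -> w%:Z ^+ n <= `|z|.
Proof.
move=> w1 Hz; have z0 := block_sum_neq0 w1 Hz.
have := block_sum_dvd Hz; rewrite dvdzE => /dvdn_leq; rewrite absz_gt0 => /(_ z0).
by rewrite Posz_exp absz_nat; lia.
Qed.

Lemma block_sumN w n z : block_sum w n z -> block_sum w n (- z).
Proof.
move=> [d [Hd [t tn dt] ->]]; exists (fun t => - d t); split.
- by move=> u; rewrite normrN.
- by exists t => //; rewrite oppr_eq0.
- by rewrite /digit_sum -sumrN; apply: eq_bigr => u _; rewrite mulNr.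
Qed.

(** The frequencies that arise when a Riesz product minus 1 is multiplied by a trigonometric
    polynomial of degree at most D, see [trig_blockB1]. *)
Definition near_block (w n D : nat) (z : int) : Prop :=
  exists2 e : int, (`|e| <= D)%N & block_sum w n (z - e).

Lemma near_blockN w n D z : near_block w n D z -> near_block w n D (- z).
Proof.
move=> [e eD /block_sumN Hz]; exists (- e); first by rewrite abszN.
by move: Hz; rewrite opprB opprK addrC.
Qed.

(** Divide by the lowest power of w that occurs: the quotient starts with the digit 1 or -1, hence
    is prime to p, and modulo w^K it is given by K digits. The function v stores digits plus 1, so
    there are only 3^K classes. *)
Lemma block_sum_class (p w n : nat) z K : prime p -> (p %| w)%N -> (1 < w)%N ->
  block_sum w n z ->
  exists (t : nat) (U : int) (v : {ffun 'I_K -> 'I_3}),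
    [/\ z = w%:Z ^+ t * U, ~~ (p%:Z %| U)%Z &
        (w%:Z ^+ K %| U - \sum_(j < K) ((v j)%:Z - 1) * w%:Z ^+ j)%Z].
Proof.
move=> pp pw w1 [d [Hd ex_d ->]].
have /ex_minnP[t1 /andP[/andP[nt1 t1n] dt1] t1min] :
    exists t, (n <= t < n.*2)%N && (d t != 0).
  by case: ex_d => t Ht dt; exists t; rewrite Ht dt.
pose M := (n.*2 - t1)%N.
pose dd j := if (j < M)%N then d (t1 + j)%N else 0.
pose U := \sum_(0 <= j < M) dd j * w%:Z ^+ j.
have EU L : (M <= L)%N -> U = \sum_(0 <= j < L) dd j * w%:Z ^+ j.
  move=> ML; rewrite (big_cat_nat (leq0n _) ML)/=.
  rewrite (_ : \sum_(M <= j < L) _ = 0) ?addr0// big_nat big1// => j /andP[Mj _].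
  by rewrite /dd ltnNge Mj mul0r.
have Hdd j : `|dd j| <= 1 by rewrite /dd; case: ifP.
have code j : (absz (dd j + 1)%R < 3)%N by have := Hdd j; lia.
exists t1, U, [ffun j : 'I_K => Ordinal (code j)]; split.
- rewrite /digit_sum (big_cat_nat nt1 (ltnW t1n))/= big_nat big1 ?add0r; last first.
    move=> t /andP[nt tt1]; apply/eqP; rewrite mulf_eq0; apply/orP; left.
    apply/negPn/negP => dt; have := t1min t.
    by rewrite nt dt (ltn_trans tt1 t1n) leqNgt tt1 => /(_ isT).
  rewrite /U mulr_sumr -{1}[t1]add0n big_addn big_nat [RHS]big_nat.
  apply: eq_bigr => j /andP[_ jM]; rewrite /dd jM [(j + _)%N]addnC exprD; ring.
- have M0 : (0 < M)%N by rewrite subn_gt0.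
  rewrite /U big_ltn// expr0 mulr1 addrC dvdzDl; last first.
    rewrite big_nat; apply: rpred_sum => j /andP[j0 _]; apply: dvdz_mull.
    by rewrite -(prednK j0) exprS; apply: dvdz_mulr; rewrite dvdzE.
  rewrite /dd M0 addn0 dvdzE; have := Hd t1; have := prime_gt1 pp.
  move=> p1 d1; have -> : `|d t1|%N = 1%N by lia.
  by rewrite absz_nat dvdn1; lia.
- rewrite (EU (K + M)%N) ?leq_addl// (big_cat_nat (leq0n _) (leq_addr M K))/=.
  rewrite big_mkord addrAC -sumrB big1 ?add0r; last first.
    move=> j _; rewrite ffunE /= (_ : (absz (dd j + 1))%:Z = dd j + 1); first by ring.
    by have := Hdd j; lia.
  by rewrite big_nat; apply: rpred_sum => j /andP[Kj _]; apply: dvdz_mull; exact: dvdz_exp2l.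
Qed.

Lemma pfactor_inj (p a b : nat) (A B : int) : prime p ->
  ~~ (p%:Z %| A)%Z -> ~~ (p%:Z %| B)%Z ->
  A * p%:Z ^+ a = B * p%:Z ^+ b -> a = b /\ A = B.
Proof.
move=> pp; wlog ab : a b A B / (a <= b)%N => [H|] pA pB E.
  by case: (leqP a b) => [|/ltnW] ab; [exact: H|have [] := H _ _ _ _ ab pB pA (esym E)].
have p0 k : p%:Z ^+ k != 0 by rewrite expf_neq0//; have := prime_gt0 pp; lia.
have E' : A = B * p%:Z ^+ (b - a).
  by apply: (mulIf (p0 a)); rewrite E -mulrA -exprD subnK.
move: ab; rewrite leq_eqVlt => /orP[/eqP ab|ab].
  by split=> //; rewrite E' ab subnn mulr1.
case/negP: pA; rewrite E'; apply: dvdz_mull.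
by rewrite -(prednK (_ : 0 < b - a)%N) ?subn_gt0// exprS; exact: dvdz_mulr (dvdzz _).
Qed.

Lemma dvdz_primeX (p k : nat) (u : int) : prime p -> (p%:Z %| u ^+ k)%Z -> (p%:Z %| u)%Z.
Proof.
by move=> pp; rewrite !dvdzE abszX !absz_nat Euclid_dvdX// => /andP[].
Qed.

Lemma dvdz_primeM (p : nat) (u v : int) : prime p ->
  ~~ (p%:Z %| u)%Z -> ~~ (p%:Z %| v)%Z -> ~~ (p%:Z %| u * v)%Z.
Proof.
move=> pp; rewrite !dvdzE abszM !absz_nat Euclid_dvdM// negb_or => -> ->//.
Qed.

(** With w = s^2 the two equations give r^d w^t U = w^t' U'. The powers of p on both sides match. In
    the parts prime to p, U and U' agree modulo p^(2K) and can be cancelled, so r0^d is congruent to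
    s0^(2(t'-t)). Raised to the power [be], this compares (r0^be)^d with (s0^al)^d; independence
    makes the two bases distinct, and [lte_bound] applies. *)
Lemma gap_bound (p r s : nat) : prime p -> (p %| r)%N -> (p %| s)%N ->
  (1 < r)%N -> (1 < s)%N ->
  (forall m n, (0 < m)%N -> (0 < n)%N -> (r ^ m)%N <> (s ^ n)%N) ->
  exists2 c, (0 < c)%N & forall (K i d t t' : nat) (N U U' : int), (0 < d)%N ->
    N * r%:Z ^+ i = (s ^ 2)%N%:Z ^+ t * U ->
    N * r%:Z ^+ (i + d) = (s ^ 2)%N%:Z ^+ t' * U' ->
    ~~ (p%:Z %| U)%Z -> ~~ (p%:Z %| U')%Z ->
    (((s ^ 2)%N%:Z ^+ K) %| U - U')%Z -> (p ^ K.*2 <= c * d)%N.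
Proof.
move=> pp pr ps r1 s1 indep; have p1 := prime_gt1 pp.
have r0' : (0 < r)%N by lia.
have s0' : (0 < s)%N by lia.
have [r0 pr0 Er] := pfactor_coprime pp r0'.
have [s0 ps0 Es] := pfactor_coprime pp s0'.
set al := logn p r in Er; set be := logn p s in Es.
have al0 : (0 < al)%N by rewrite logn_gt0 mem_primes pp r0'.
have be0 : (0 < be)%N by rewrite logn_gt0 mem_primes pp s0'.
have r00 : (0 < r0)%N by case: (r0) Er; lia.
have s00 : (0 < s0)%N by case: (s0) Es; lia.
rewrite prime_coprime// in pr0; rewrite prime_coprime// in ps0.
have XY : (r0 ^ be)%N != (s0 ^ al)%N.
  apply/negP => /eqP E; apply: (indep be al be0 al0).
  by rewrite Er Es !expnMn E -!expnM [(al * be)%N]mulnC.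
have pY : ~~ (p %| s0 ^ al)%N by rewrite Euclid_dvdX// (negbTE ps0).
have X0 : (0 < r0 ^ be)%N by rewrite expn_gt0 r00.
have [c c0 Hc] := lte_bound pp pY X0 XY; exists c; first exact: c0.
move=> K i d t t' N U U' d0 H1 H2 pU pU' HK.
apply: Hc => //.
have pr0z : ~~ (p%:Z %| r0%:Z)%Z by rewrite dvdzE !absz_nat.
have ps0z : ~~ (p%:Z %| s0%:Z)%Z by rewrite dvdzE !absz_nat.
have rz : r%:Z = r0%:Z * p%:Z ^+ al by rewrite Posz_exp -PoszM -Er.
have wz : (s ^ 2)%N%:Z = s0%:Z ^+ 2 * p%:Z ^+ (be * 2).
  by rewrite !Posz_exp -PoszM {1}Es expnMn -expnM.
have E : (s0%:Z ^+ (2 * t) * (r0%:Z ^+ d * U)) * p%:Z ^+ (be * 2 * t + al * d) =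
         (s0%:Z ^+ (2 * t') * U') * p%:Z ^+ (be * 2 * t').
  have : (s ^ 2)%N%:Z ^+ t * U * r%:Z ^+ d = (s ^ 2)%N%:Z ^+ t' * U'.
    by rewrite -H1 -H2 exprD mulrA.
  have wzX k : (s ^ 2)%N%:Z ^+ k = s0%:Z ^+ (2 * k) * p%:Z ^+ (be * 2 * k).
    by rewrite wz exprMn -!exprM.
  have rzX k : r%:Z ^+ k = r0%:Z ^+ k * p%:Z ^+ (al * k) by rewrite rz exprMn -exprM.
  rewrite !wzX rzX exprD => E.
  transitivity (s0%:Z ^+ (2 * t) * p%:Z ^+ (be * 2 * t) * U * (r0%:Z ^+ d * p%:Z ^+ (al * d))); first by ring.
  by rewrite E; ring.
have pX (u : int) k : ~~ (p%:Z %| u)%Z -> ~~ (p%:Z %| u ^+ k)%Z.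
  by apply: contra; exact: dvdz_primeX.
have [] := pfactor_inj pp _ _ E.
- by rewrite !dvdz_primeM ?pX.
- by rewrite !dvdz_primeM ?pX.
move=> Ee EU.
have tt' : (t <= t')%N by rewrite -(@leq_pmul2l (be * 2)) ?muln_gt0 ?be0// -Ee leq_addr.
have Edel : (al * d = be * 2 * (t' - t))%N by rewrite mulnBr -Ee addKn.
have {}EU : r0%:Z ^+ d * U = s0%:Z ^+ (2 * (t' - t)) * U'.
  apply: (mulfI (_ : s0%:Z ^+ (2 * t) != 0)).
    by rewrite expf_neq0//; lia.
  by rewrite EU mulrA -exprD -mulnDr subnKC.
have pK : (p%:Z ^+ K.*2 %| U - U')%Z.
  apply: dvdz_trans HK; rewrite -muln2 mulnC exprM; apply: dvdz_exp2r.
  by rewrite !Posz_exp dvdzE !absz_nat dvdn_exp2r.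
have : (p%:Z ^+ K.*2 %| (r0%:Z ^+ d - s0%:Z ^+ (2 * (t' - t))) * U)%Z.
  rewrite mulrBl EU -mulrBr; apply: dvdz_mull.
  by rewrite -opprB rpredN.
rewrite mulrC Gauss_dvdzr; last exact: prime_coprimeX.
move=> H; have : (p%:Z ^+ K.*2 %| (r0%:Z ^+ d) ^+ be - (s0%:Z ^+ (2 * (t' - t))) ^+ be)%Z.
  by rewrite subrXX dvdz_mulr.
rewrite -!Posz_exp -!exprM Edel [(be * d)%N]mulnC.
by rewrite (_ : be * 2 * (t' - t) = 2 * (t' - t) * be)%N//; lia.
Qed.

(** * Counting pairs of powers whose difference lies near a block *)

Lemma card_coding (T U : finType) (A : {set T}) (Rel : T -> U -> Prop) :
  (forall a, a \in A -> exists u, Rel a u) ->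
  (forall a b u, a \in A -> b \in A -> Rel a u -> Rel b u -> a = b) ->
  (#|A| <= #|U|)%N.
Proof.
move=> ex_code code_inj; pose f a := [pick u | `[< Rel a u >]].
have fP a : a \in A -> exists2 u, f a = Some u & Rel a u.
  move=> /ex_code[u au]; rewrite /f; case: pickP => [v /asboolP av|/(_ u) /asboolP//].
  by exists v.
have f_inj : {in A &, injective f}.
  move=> a b aA bA; have [u -> au] := fP a aA; have [v -> bv] := fP b bA.
  by move=> [uv]; apply: code_inj aA bA au _; rewrite uv.
have SomeI : injective (@Some U) by move=> u v [].
rewrite -(card_in_imset f_inj) -[#|U|](card_imset _ SomeI).
apply/subset_leq_card/fintype.subsetP => _ /imsetP[a /fP[u -> _] ->].
exact: imset_f.
Qed.

Lemma expn4_gt (C : nat) : exists n0 : nat, forall n, (n0 <= n)%N -> (C * n ^ 2 < 4 ^ n)%N.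
Proof.
have H n : (n ^ 3 <= 4 ^ n)%N.
  elim: n => // -[//|[//|n]] IH; rewrite (@leq_trans (4 * n.+2 ^ 3))//; first by lia.
  by rewrite [X in (_ <= X)%N]expnS leq_pmul2l.
exists C.+1 => n Cn; apply: leq_trans (H n).
by rewrite [(n ^ 3)%N]expnS ltn_pmul2r// expn_gt0 (leq_trans _ Cn).
Qed.

Lemma leq_expn2r (m n k : nat) : (m <= n)%N -> (m ^ k <= n ^ k)%N.
Proof. by case: k => [|k] mn; rewrite ?expn0// leq_exp2r. Qed.

Lemma expn_lt_expn2 (s m : nat) : (s ^ m <= 2 ^ (s * m))%N.
Proof. by rewrite expnM; apply: leq_expn2r; apply: ltnW; exact: ltn_expl. Qed.

Definition diff_pow (h r i j : nat) : int := h%:Z * (r%:Z ^+ i - r%:Z ^+ j).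

Lemma diff_powN h r i j : diff_pow h r j i = - diff_pow h r i j.
Proof. by rewrite /diff_pow -mulrN opprB. Qed.

Lemma abs_diff_pow h r i j : (0 < r)%N -> (i <= j)%N ->
  `|diff_pow h r i j|%N = (h * (r ^ i * (r ^ (j - i) - 1)))%N.
Proof.
move=> r0 ij; rewrite -{1}(subnK ij) addnC /diff_pow exprD.
have rj0 : (0 < r ^ (j - i))%N by rewrite expn_gt0 r0.
rewrite (_ : r%:Z ^+ i - r%:Z ^+ i * r%:Z ^+ (j - i) =
   - (r%:Z ^+ i * (r%:Z ^+ (j - i) - 1))); last by ring.
rewrite mulrN abszN !abszM absz_nat !Posz_exp absz_nat.
by congr (_ * (_ * _))%N; lia.
Qed.

(** Comparison of sizes: elements of the block at scale n lie between s^(2n) and s^(4n) in absolute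
    value, while the difference grows like a power of r with exponent max(i, j). The constants are
    crude because all powers are compared with powers of 2. *)
Lemma near_block_range (r s h D n i j : nat) : (1 < r)%N -> (1 < s)%N -> (0 < h)%N ->
  (0 < n)%N -> (D <= n)%N -> (2 * h <= n)%N ->
  near_block (s ^ 2) n D (diff_pow h r i j) ->
  [/\ i != j, (n <= 2 * r * maxn i j)%N & (maxn i j < 6 * s * n)%N].
Proof.
move=> r1 s1 h0 n0 Dn hn; wlog ij : i j / (i <= j)%N => [H|] nb.
  have /orP[ij|ij] := leq_total i j; first exact: (H i j ij nb).
  rewrite eq_sym maxnC; apply: (H j i ij).
  by rewrite diff_powN; exact: near_blockN.
have w1 : (2 <= s ^ 2)%N by rewrite (@leq_trans (2 ^ 2))// leq_exp2r.
move: nb => [e eD He].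
have := block_sum_ge w1 He; have := block_sum_le w1 He.
rewrite !Posz_exp -!expnM; set z := diff_pow h r i j in He * => zle zge.
have lo : (s ^ (2 * n) <= `|z| + D)%N by lia.
have hi : (`|z| <= s ^ (2 * n.*2) + D)%N by lia.
have D2 : (D < 2 ^ n)%N by apply: leq_ltn_trans Dn (ltn_expl _ _).
have s4 : (4 ^ n <= s ^ (2 * n))%N by rewrite expnM leq_exp2r// -[4%N]/(2 ^ 2)%N leq_exp2r.
have zlo : (2 ^ n <= `|z|)%N.
  have := leq_trans s4 lo; rewrite -[4%N]/(2 * 2)%N expnMn.
  have : (2 <= 2 ^ n)%N by rewrite -[X in (X <= _)%N]expn1 leq_exp2l.
  by move: D2; set a := (2 ^ n)%N; set b := `|z|%N; clear; nia.
have Ez := abs_diff_pow h (ltnW r1) ij.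
have ij' : (i < j)%N.
  rewrite ltn_neqAle ij andbT; apply/negP => /eqP E.
  by move: zlo; rewrite Ez E subnn expn0 subnn !muln0 leqn0 expn_eq0.
have Erj : (r ^ i * r ^ (j - i) = r ^ j)%N by rewrite -expnD subnKC.
rewrite (maxn_idPr ij); split; first by lia.
- have z2 : (`|z| <= 2 ^ (h + r * j))%N.
    rewrite Ez expnD; apply: leq_mul; first by apply: ltnW; exact: ltn_expl.
    by apply: leq_trans (expn_lt_expn2 r j); rewrite -Erj leq_mul2l leq_subr orbT.
  by have := leq_trans zlo z2; rewrite leq_exp2l// => ?; lia.
- have z3 : (2 ^ j.-1 <= `|z|)%N.
    apply: (@leq_trans (r ^ j.-1)); first by apply: leq_expn2r.
    rewrite Ez; apply: (@leq_trans (r ^ i * (r ^ (j - i) - 1))); last exact: leq_pmull.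
    have -> : (j.-1 = i + (j - i).-1)%N by lia.
    rewrite expnD leq_mul2l; apply/orP; right.
    have -> : (j - i = (j - i).-1.+1)%N by lia.
    rewrite expnS; have : (0 < r ^ (j - i).-1)%N by rewrite expn_gt0; lia.
    by move: r1; set a := (r ^ _)%N; clear; nia.
  have z4 : (`|z| <= 2 ^ (s * (4 * n + 1)))%N.
    apply: leq_trans (expn_lt_expn2 s _); apply: leq_trans hi _.
    rewrite expnD expn1 (_ : 2 * n.*2 = 4 * n)%N; last by lia.
    have : (D <= s ^ (4 * n))%N.
      apply: ltnW; apply: leq_trans D2 _.
      apply: leq_trans (leq_expn2r _ _) (_ : s ^ n <= _)%N => //.
      by rewrite leq_exp2l//; lia.
    by move: s1; set a := (s ^ _)%N; clear; nia.
  have := leq_trans z3 z4; rewrite leq_exp2l// => ?; nia.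
Qed.

Lemma dvdz_prime_case (p n : nat) (A B H : nat) : prime p -> (0 < H)%N -> (0 < A)%N ->
  (0 < B)%N -> (p ^ n %| H * (A * B))%N ->
  (p ^ n <= H * (p ^ logn p A * p ^ logn p B))%N.
Proof.
move=> pp H0 A0 B0 pn; have HAB : (0 < H * (A * B))%N by rewrite !muln_gt0 H0 A0.
apply: (@leq_trans (p ^ (logn p H + (logn p A + logn p B)))%N).
  rewrite leq_exp2l ?prime_gt1// -!lognM ?muln_gt0 ?A0//.
  by rewrite -(pfactor_dvdn _ pp HAB).
by rewrite !expnD leq_mul2r; apply/orP; right; apply: dvdn_leq => //; exact: pfactor_dvdnn.
Qed.

Definition pair_low (N : nat) (q : 'I_N * 'I_N) : nat := minn q.1 q.2.
Definition pair_gap (N : nat) (q : 'I_N * 'I_N) : nat := (maxn q.1 q.2 - minn q.1 q.2)%N.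

Lemma pair_eq (N : nat) (q q' : 'I_N * 'I_N) : (q.1 < q.2)%N = (q'.1 < q'.2)%N ->
  pair_gap q = pair_gap q' -> pair_low q = pair_low q' -> q = q'.
Proof.
case: q q' => [a b] [c d]; rewrite /pair_low /pair_gap /= => H1 H2 H3.
by congr (_, _); apply: val_inj => /=; lia.
Qed.

Lemma pair_gap_gt0 (N : nat) (q : 'I_N * 'I_N) :
  (q.1 != q.2 :> nat) -> (0 < pair_gap q)%N.
Proof.
rewrite /pair_gap; case: q => a b /=; move: (val a) (val b) => {}a {}b.
by case: (ltngtP a b) => // ? _; rewrite subn_gt0.
Qed.

Lemma absz_shift (e : int) (D : nat) : (`|e| <= D)%N ->
  (absz (e + D%:Z)%R < D.*2.+1)%N /\ (absz (e + D%:Z))%:Z - D%:Z = e.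
Proof. by move=> eD; split; lia. Qed.

Lemma ltn_sub_divn (i i' W : nat) : (0 < W)%N -> (i %/ W = i' %/ W)%N ->
  (i' - i < W)%N.
Proof.
move=> W0 E; have := divn_eq i W; have := divn_eq i' W; rewrite E.
by have := ltn_pmod i' W0; have := ltn_pmod i W0; lia.
Qed.

(** Up to sign, [diff_pow] in terms of the smaller index i and the gap l; for a fixed gap it is a
    constant times r^i. *)
Definition gap_pow (h r i l : nat) : int := h%:Z * r%:Z ^+ i * (r%:Z ^+ l - 1).

Lemma near_block_gap (w h r D n N : nat) (q : 'I_N * 'I_N) :
  near_block w n D (diff_pow h r q.1 q.2) ->
  near_block w n D (gap_pow h r (pair_low q) (pair_gap q)).
Proof.
case: q => a b; rewrite /pair_low /pair_gap /=.
wlog ab : a b / (a <= b)%N => [H nb|].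
  have /orP[ab|ba] := leq_total a b; first exact: (H a b ab nb).
  by rewrite minnC maxnC; apply: (H b a ba); rewrite diff_powN; exact: near_blockN.
rewrite (minn_idPl ab) (maxn_idPr ab) diff_powN => /near_blockN.
rewrite opprK /diff_pow /gap_pow -{1}(subnK ab) exprD.
by congr near_block; ring.
Qed.

(** With k arbitrary and n large this expresses a count o(n^2), uniformly in N. *)
Definition sparse (r s h D k n : nat) : Prop := forall N (A : {set 'I_N * 'I_N}),
  (forall q, q \in A -> near_block (s ^ 2) n D (diff_pow h r q.1 q.2)) ->
  (k * #|A| <= n ^ 2)%N.

Lemma sparse_coprime (r s h D k p : nat) : (1 < r)%N -> (1 < s)%N -> (0 < h)%N ->
  prime p -> (p %| s)%N -> ~~ (p %| r)%N ->
  exists n0, forall n, (n0 <= n)%N -> sparse r s h D k n.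
Proof.
move=> r1 s1 h0 pp ps pr; have p1 := prime_gt1 pp.
have p_1 : ~~ (p %| 1)%N by rewrite dvdn1 neq_ltn p1 orbT.
have [c c0 Hc] := lte_bound pp p_1 (ltnW r1) (negbT (gtn_eqF r1)).
have [n1 Hn1] := expn4_gt (h * (c * c * (6 * s * (6 * s)))).
exists (maxn n1 (maxn (maxn D (2 * h)) (12 * s * k * D.*2.+1).+1)) => n.
rewrite !geq_max => /andP[/Hn1 n4 /andP[/andP[Dn hn] kn]] N A HA.
have n0 : (0 < n)%N by lia.
pose M := (6 * s * n)%N.
have Arange q (qA : q \in A) := near_block_range r1 s1 h0 n0 Dn hn (HA q qA).
have gapM q : q \in A -> (pair_gap q < M)%N.
  by move=> /Arange[_ _]; apply: leq_ltn_trans; exact: leq_subr.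
(* The order, the gap and the offset from the block will determine the pair, which leaves a number
   of codes linear in n. *)
pose Rel (q : 'I_N * 'I_N) (u : bool * 'I_M * 'I_(D.*2.+1)) :=
  [/\ u.1.1 = (q.1 < q.2)%N, val u.1.2 = pair_gap q &
    ((s ^ 2)%N%:Z ^+ n %| gap_pow h r (pair_low q) (pair_gap q) - ((val u.2)%:Z - D%:Z))%Z].
have HU : (#|A| <= #|{: bool * 'I_M * 'I_(D.*2.+1)}|)%N.
  apply: (card_coding (Rel := Rel)) => [q qA|q q' [[b l] e] qA q'A].
    have [e eD /block_sum_dvd He] := near_block_gap (HA q qA).
    have [e2 Ee] := absz_shift eD.
    exists ((q.1 < q.2)%N, Ordinal (gapM q qA), Ordinal e2); split=> //=.
    by rewrite Ee.
  move=> [/= bq lq eq] [/= bq' lq' eq']; apply: pair_eq; rewrite -?bq -?lq//.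
  rewrite -lq in eq; rewrite -lq' in eq'.
  have l0 : (0 < l)%N by have [H _ _] := Arange q qA; rewrite lq; exact: pair_gap_gt0 H.
  have lM := ltn_ord l.
  have low i : i \in A -> (pair_low i < M)%N.
    by move=> /Arange[_ _]; apply: leq_ltn_trans; rewrite geq_min leq_max leqnn.
  move: (low q qA) (low q' q'A) eq eq'.
  move: (pair_low q) (pair_low q') => i i' iM i'M.
  wlog ii' : i i' iM i'M / (i < i')%N => [H Hi Hi'|Hi Hi'].
    have [ii'|ii'|//] := ltngtP i i'; first exact: (H i i' iM i'M ii' Hi Hi').
    exact/esym/(H i' i i'M iM ii' Hi' Hi).
  exfalso; pose d := (i' - i)%N; have d0 : (0 < d)%N by rewrite subn_gt0.
  (* The common offset cancels. As p does not divide r, the power p^(2n) must come from h and from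
     two numbers of the form r^j - 1, whose p-parts are at most c j: this is O(n^2) against 4^n. *)
  have : ((s ^ 2)%N%:Z ^+ n %| gap_pow h r i' l - gap_pow h r i l)%Z.
    have := rpredB Hi' Hi; congr (_ %| _)%Z; ring.
  rewrite (_ : _ - _ = r%:Z ^+ i * (h%:Z * ((r%:Z ^+ d - 1) * (r%:Z ^+ l - 1)))); last first.
    by rewrite /gap_pow -{1}(subnK (ltnW ii')) -/d exprD; ring.
  rewrite [(s ^ 2)%N%:Z ^+ n]Posz_exp -expnM => Hw.
  have : (p%:Z ^+ (2 * n) %| r%:Z ^+ i * (h%:Z * ((r%:Z ^+ d - 1) * (r%:Z ^+ l - 1))))%Z.
    by apply: dvdz_trans Hw; rewrite Posz_exp dvdzE !absz_nat dvdn_exp2r.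
  rewrite Gauss_dvdzr; last first.
    apply: prime_coprimeX => //; apply: contra pr => /(dvdz_primeX pp).
    by rewrite dvdzE !absz_nat.
  have Er j : (0 < j)%N -> r%:Z ^+ j - 1 = (r ^ j - 1)%N.
    by move=> j0; rewrite Posz_exp subzn ?expn_gt0 ?(ltnW r1).
  have rj j : (0 < j)%N -> (0 < r ^ j - 1)%N.
    by move=> j0; rewrite subn_gt0 -[1%N](expn0 r) ltn_exp2l.
  rewrite !Er// dvdzE abszX !abszM !absz_nat.
  move=> /(dvdz_prime_case pp h0 (rj _ d0) (rj _ l0)).
  have Hlog j : (0 < j)%N -> (p ^ logn p (r ^ j - 1) <= c * j)%N.
    move=> j0; apply: Hc => //; rewrite expr1n Er// dvdzE abszX !absz_nat.
    exact: pfactor_dvdnn.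
  apply/negP; rewrite -ltnNge.
  apply: leq_ltn_trans (_ : h * (c * d * (c * l)) < _)%N.
    by rewrite leq_mul2l; apply/orP; right; apply: leq_mul; exact: Hlog.
  apply: (@leq_trans (4 ^ n)); last by rewrite expnM; apply: leq_expn2r; rewrite -[4%N]/(2 ^ 2)%N leq_expn2r.
  apply: leq_ltn_trans n4; rewrite (_ : c * d * (c * l) = c * c * (d * l))%N; last by ring.
  have -> : (h * (c * c * (6 * s * (6 * s))) * n ^ 2 = h * (c * c * (M * M)))%N.
    by rewrite /M -mulnn; ring.
  rewrite !leq_mul2l; apply/orP; right; apply/orP; right.
  by apply: leq_mul; [exact: leq_trans (leq_subr _ _) (ltnW i'M)|exact: ltnW].
apply: (@leq_trans (k * (2 * M * D.*2.+1))%N).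
  by rewrite leq_mul2l; apply/orP; right; rewrite !card_prod card_bool !card_ord in HU.
move: kn; rewrite /M -mulnn => kn.
rewrite (_ : k * _ = (12 * s * k * D.*2.+1) * n)%N; last by ring.
by rewrite leq_mul2r; apply/orP; right; exact: ltnW.
Qed.

Lemma sparse_dvd (r s h D k p : nat) : (1 < r)%N -> (1 < s)%N -> (0 < h)%N ->
  (0 < k)%N -> prime p -> (p %| s)%N -> (p %| r)%N ->
  (forall m n, (0 < m)%N -> (0 < n)%N -> (r ^ m)%N <> (s ^ n)%N) ->
  exists n0, forall n, (n0 <= n)%N -> sparse r s h D k n.
Proof.
move=> r1 s1 h0 k0 pp ps pr indep; have p1 := prime_gt1 pp.
have [c c0 Hgap] := gap_bound pp pr ps r1 s1 indep.
(* With this K the cell length [Wd], of order 4^K, exceeds the number 3^K of digit classes by the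
   factor 144 s^2 k, which the final count consumes. *)
pose K := (3 * (c * (144 * s * s * k)))%N.
pose Wd := (4 ^ K %/ c)%N.
have W_ge : (144 * s * s * k * 3 ^ K <= Wd)%N.
  have H K' : (K' * 3 ^ K' <= 3 * 4 ^ K')%N.
    have H3 j : (3 ^ j <= 4 ^ j)%N by exact: leq_expn2r.
    elim: K' => // j IH; rewrite !expnS; have := H3 j.
    by move: IH; set a := (3 ^ j)%N; set b := (4 ^ j)%N; clear; nia.
  rewrite /Wd leq_divRL//; have := H K; rewrite {1}/K.
  set a := (3 ^ K)%N; set b := (4 ^ K)%N; clear; nia.
have W0 : (0 < Wd)%N.
  by apply: leq_trans W_ge; rewrite !muln_gt0 expn_gt0 k0 (ltnW s1).
pose C1 := (D + 3 ^ K)%N.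
exists (maxn (maxn D.+1 (2 * h)) (24 * s * k * C1)) => n.
rewrite !geq_max => /andP[/andP[Dn hn] kn] N A HA.
have n0 : (0 < n)%N by lia.
pose M := (6 * s * n)%N.
have Arange q (qA : q \in A) := near_block_range r1 s1 h0 n0 (ltnW Dn) hn (HA q qA).
have gapM q : q \in A -> (pair_gap q < M)%N.
  by move=> /Arange[_ _]; apply: leq_ltn_trans; exact: leq_subr.
have lowM q : q \in A -> (pair_low q < M)%N.
  by move=> /Arange[_ _]; apply: leq_ltn_trans; rewrite geq_min leq_max leqnn.
have lowW q : q \in A -> (pair_low q %/ Wd < (M %/ Wd).+1)%N.
  by move=> /lowM/ltnW qM; rewrite ltnS leq_div2r.
(* A nonzero offset forces a low index below D, which is recorded itself. For offset 0 the code
   keeps the digit class and the cell of length [Wd] that contains the low index. *)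
pose X := ('I_D + {ffun 'I_K -> 'I_3} * 'I_((M %/ Wd).+1))%type.
pose Rel (q : 'I_N * 'I_N) (u : bool * 'I_M * X) :=
  [/\ u.1.1 = (q.1 < q.2)%N, val u.1.2 = pair_gap q &
    match u.2 with
    | inl i => val i = pair_low q
    | inr vc => val vc.2 = (pair_low q %/ Wd)%N /\ exists t U,
       [/\ gap_pow h r (pair_low q) (pair_gap q) = (s ^ 2)%N%:Z ^+ t * U,
          ~~ (p%:Z %| U)%Z &
          ((s ^ 2)%N%:Z ^+ K %| U - \sum_(j < K) ((vc.1 j)%:Z - 1) * (s ^ 2)%N%:Z ^+ j)%Z]
    end].
have ps2 : (p %| s ^ 2)%N by rewrite Euclid_dvdX// ps.
have HU : (#|A| <= #|{: bool * 'I_M * X}|)%N.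
  apply: (card_coding (Rel := Rel)) => [q qA|q q' [[b l] x] qA q'A].
    have [e eD He] := near_block_gap (HA q qA).
    have [e0|e0] := eqVneq e 0.
      rewrite e0 subr0 in He.
      have w1 : (1 < s ^ 2)%N by rewrite -[1%N](exp1n 2) ltn_exp2r.
      have [t [U [v [H1 H2 H3]]]] := block_sum_class K pp ps2 w1 He.
      exists ((q.1 < q.2)%N, Ordinal (gapM q qA), inr (v, Ordinal (lowW q qA))).
      by split=> //=; split=> //; exists t, U.
    have lowD : (pair_low q < D)%N.
      rewrite ltnNge; apply/negP => Dq.
      (* Since p divides both r and s, p^D divides the gap power and the block sum, hence their
         difference e, although |e| <= D < p^D. *)
      have pD : (p%:Z ^+ D %| e)%Z.
        have -> : e = gap_pow h r (pair_low q) (pair_gap q) -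
                     (gap_pow h r (pair_low q) (pair_gap q) - e) by ring.
        apply: rpredB.
          rewrite /gap_pow -mulrA; apply: dvdz_mull; apply: dvdz_mulr.
          apply: dvdz_trans (dvdz_exp2l p%:Z Dq) _; apply: dvdz_exp2r.
          by rewrite dvdzE !absz_nat.
        have nD : (D <= n)%N by lia.
        apply: dvdz_trans (block_sum_dvd He); apply: dvdz_trans (dvdz_exp2l p%:Z nD) _.
        by apply: dvdz_exp2r; rewrite dvdzE !absz_nat.
      move: pD; rewrite dvdzE abszX absz_nat => /dvdn_leq; rewrite absz_gt0 => /(_ e0).
      by apply/negP; rewrite -ltnNge; apply: leq_ltn_trans eD (ltn_expl _ p1).
    by exists ((q.1 < q.2)%N, Ordinal (gapM q qA), inl (Ordinal lowD)).
  move=> [/= bq lq xq] [/= bq' lq' xq']; apply: pair_eq; rewrite -?bq -?lq//.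
  case: x xq xq' => [i -> //|[v z]] /= [zq [t [U [H1 H2 H3]]]] [zq' [t' [U' [H1' H2' H3']]]].
  have Ez : (pair_low q %/ Wd = pair_low q' %/ Wd)%N by rewrite -zq -zq'.
  rewrite -lq in H1; rewrite -lq' in H1'.
  have UU' : ((s ^ 2)%N%:Z ^+ K %| U - U')%Z.
    by have := rpredB H3 H3'; congr (_ %| _)%Z; ring.
  move: H1 H1' H2 H2' UU' Ez; clear H3 H3' zq zq'.
  move: (pair_low q) (pair_low q') => i i'.
  wlog ii' : i i' t t' U U' / (i < i')%N => [H H1 H1' H2 H2' UU' Ez|].
    have [ii'|ii'|//] := ltngtP i i'; first exact: (H i i' t t' U U' ii' H1 H1' H2 H2' UU' Ez).
    apply/esym/(H i' i t' t U' U ii' H1' H1 H2' H2) => //.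
    by rewrite -opprB rpredN.
  move=> H1 H1' H2 H2' UU' Ez; exfalso.
  (* Two low indices with the same code lie in one cell, but [gap_bound] puts them at least p^(2K) /
     c >= [Wd] apart. *)
  pose d := (i' - i)%N; have d0 : (0 < d)%N by rewrite subn_gt0.
  have dW : (d < Wd)%N by exact: ltn_sub_divn.
  have := Hgap K i d t t' (h%:Z * (r%:Z ^+ l - 1)) U U' d0.
  rewrite subnKC ?(ltnW ii')// (_ : h%:Z * _ * _ = gap_pow h r i l); last first.
    by rewrite /gap_pow; ring.
  rewrite (_ : h%:Z * _ * _ = gap_pow h r i' l); last by rewrite /gap_pow; ring.
  move=> /(_ H1 H1' H2 H2' UU'); apply/negP; rewrite -ltnNge.
  have cd : (c * d < c * Wd)%N by rewrite ltn_pmul2l.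
  apply: leq_trans cd _; rewrite mulnC /Wd; apply: leq_trans (leq_divM _ _) _.
  by rewrite -mul2n expnM; apply: leq_expn2r; rewrite -[4%N]/(2 ^ 2)%N leq_expn2r.
apply: (@leq_trans (k * (2 * M * (D + 3 ^ K * (M %/ Wd).+1)))%N).
  rewrite leq_mul2l; apply/orP; right.
  by move: HU; rewrite !card_prod card_bool card_sum card_prod card_ffun !card_ord.
have HM : ((M %/ Wd) * (144 * s * s * k * 3 ^ K) <= 6 * s * n)%N.
  apply: leq_trans (leq_divM M Wd).
  by rewrite leq_mul2l W_ge orbT.
move: HM kn; rewrite /M /C1; set a := (3 ^ K)%N; set x := (_ %/ Wd)%N => HM kn.
have HM' : (x * (24 * s * k * a) <= n)%N.
  rewrite -(@leq_pmul2l (6 * s)) ?muln_gt0 ?(ltnW s1)//.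
  by apply: leq_trans HM; rewrite eq_leq//; clear; ring.
have : (24 * s * k * (D + a * x.+1) <= n + n)%N.
  by apply: leq_trans (leq_add kn HM'); rewrite eq_leq//; clear; ring.
clear; move=> H.
rewrite (_ : k * (2 * (6 * s * n) * (D + a * x.+1)) = 12 * s * k * (D + a * x.+1) * n)%N; last by ring.
by rewrite -mulnn leq_mul2r; apply/orP; right; lia.
Qed.

(* Fix j - i.  If a prime p divides s but not r, the p-part of r^d - 1 is at
   most linear in d, so a given offset from the block occurs for one i.  If p
   divides both, the lowest K digits of a sum of signed powers of s^2 take 3^K
   values, while two indices i with the same ones differ by at least c 4^K. *)
Lemma sparse_block (r s h D k : nat) : (1 < r)%N -> (1 < s)%N -> (0 < h)%N ->
  (0 < k)%N ->
  (forall m n, (0 < m)%N -> (0 < n)%N -> (r ^ m)%N <> (s ^ n)%N) ->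
  exists n0, forall n, (n0 <= n)%N -> sparse r s h D k n.
Proof.
move=> r1 s1 h0 k0 indep; have pp : prime (pdiv s) by rewrite pdiv_prime.
have [pr|pr] := boolP (pdiv s %| r)%N.
  exact: (sparse_dvd D r1 s1 h0 k0 pp (pdiv_dvd s)).
exact: (sparse_coprime D k r1 s1 h0 pp (pdiv_dvd s)).
Qed.

(** * Trigonometric polynomials *)

Local Open Scope classical_set_scope.
Local Open Scope ring_scope.
Local Open Scope complex_scope.

(** The norm of [R[i]] takes its values in [R[i]]; this is the modulus as a real number. *)
Definition cabs (R : realType) (z : R[i]) : R := Normc.normc z.

Lemma cabsE (R : realType) (z : R[i]) : `|z| = (cabs z)%:C.
Proof. by []. Qed.

Lemma cabs_ge0 (R : realType) (z : R[i]) : 0 <= cabs z.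
Proof. by rewrite -lecR -cabsE normr_ge0. Qed.

Lemma cabsM (R : realType) (z w : R[i]) : cabs (z * w) = cabs z * cabs w.
Proof. exact: Normc.normcM. Qed.

Lemma cabsD (R : realType) (z w : R[i]) : cabs (z + w) <= cabs z + cabs w.
Proof. exact: le_normcD. Qed.

Lemma cabsN (R : realType) (z : R[i]) : cabs (- z) = cabs z.
Proof. exact: normcN. Qed.

Lemma cabsR (R : realType) (x : R) : cabs x%:C = `|x|.
Proof. by rewrite /cabs /= expr0n /= addr0 sqrtr_sqr. Qed.

Lemma cabs_nat (R : realType) n : cabs (n%:R : R[i]) = n%:R.
Proof. by rewrite -(rmorph_nat (real_complex R)) cabsR ger0_norm. Qed.

Lemma cabs0 (R : realType) : cabs (0 : R[i]) = 0.
Proof. exact: (cabs_nat R 0). Qed.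

Lemma cabs1 (R : realType) : cabs (1 : R[i]) = 1.
Proof. exact: (cabs_nat R 1). Qed.

Lemma cabsV (R : realType) (z : R[i]) : cabs z^-1 = (cabs z)^-1.
Proof. exact: Normc.normcV. Qed.

Lemma cabsB (R : realType) (z w : R[i]) : cabs (z - w) <= cabs z + cabs w.
Proof. by rewrite (le_trans (cabsD _ _))// cabsN. Qed.

Lemma cabs_sum (R : realType) (I : Type) (r : seq I) (P : pred I) (F : I -> R[i]) :
  cabs (\sum_(i <- r | P i) F i) <= \sum_(i <- r | P i) cabs (F i).
Proof.
elim/big_ind2 : _ => [|x1 x2 y1 y2 h1 h2|//]; first by rewrite cabs0.
by rewrite (le_trans (cabsD _ _))// lerD.
Qed.

Lemma cabs_eq0 (R : realType) (z : R[i]) : (cabs z == 0) = (z == 0).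
Proof.
apply/eqP/eqP => [|->]; last exact: cabs0.
exact: Normc.eq0_normc.
Qed.

Lemma cabs_conj (R : realType) (z : R[i]) : cabs (z^*)%C = cabs z.
Proof. by apply: (@complexI R); rewrite -!cabsE normcJ. Qed.

Lemma mulcJ (R : realType) (z : R[i]) : z * (z^*)%C = (cabs z ^+ 2)%:C.
Proof. by rewrite -sqr_normc cabsE rmorphXn. Qed.

Lemma cabs_Re (R : realType) (z : R[i]) : `|complex.Re z| <= cabs z.
Proof. by rewrite -lecR -cabsE normc_ge_Re. Qed.

Lemma cabs_Im (R : realType) (z : R[i]) : `|complex.Im z| <= cabs z.
Proof.
case: z => a b; rewrite /cabs /= -sqrtr_sqr ler_wsqrtr//.
by rewrite lerDr sqr_ge0.
Qed.

Lemma cabs_ReIm (R : realType) (z : R[i]) : cabs z <= `|complex.Re z| + `|complex.Im z|.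
Proof.
rewrite {1}(complexE z) (le_trans (cabsD _ _))// cabsM !cabsR.
by rewrite [X in X * _](_ : _ = 1) ?mul1r// /cabs /= expr0n /= add0r expr1n sqrtr1.
Qed.

Lemma conjc_sum (R : realType) (I : Type) (r : seq I) (P : pred I) (F : I -> R[i]) :
  ((\sum_(i <- r | P i) F i)^*)%C = \sum_(i <- r | P i) ((F i)^*)%C.
Proof. exact: (rmorph_sum (@conjc R)). Qed.

Lemma expiD (R : realType) (s t : R) : expi (s + t) = expi s * expi t.
Proof.
apply/eqP; rewrite eq_complex /= cosD sinD; apply/andP; split=> //.
by apply/eqP; ring.
Qed.

Lemma expi0 (R : realType) : expi (0 : R) = 1.
Proof. by rewrite /expi cos0 sin0. Qed.

Lemma cabs_expi (R : realType) (t : R) : cabs (expi t) = 1.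
Proof. by rewrite /cabs /= cos2Dsin2 sqrtr1. Qed.

Lemma conj_expi (R : realType) (t : R) : ((expi t)^*)%C = expi (- t).
Proof. by rewrite /expi /= cosN sinN. Qed.

Definition ex (R : realType) (k : int) (x : R) : R[i] := expi (2 * pi * k%:~R * x).

Lemma exD (R : realType) (k l : int) (x : R) : ex (k + l) x = ex k x * ex l x.
Proof. by rewrite /ex -expiD intrD; congr expi; ring. Qed.

Lemma ex0 (R : realType) (x : R) : ex 0 x = 1.
Proof. by rewrite /ex !(mulr0, mul0r) expi0. Qed.

Lemma exx0 (R : realType) k : ex k (0 : R) = 1.
Proof. by rewrite /ex !(mulr0, mul0r) expi0. Qed.

Lemma cabs_ex (R : realType) k (x : R) : cabs (ex k x) = 1.
Proof. exact: cabs_expi. Qed.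

Lemma conj_ex (R : realType) k (x : R) : ((ex k x)^*)%C = ex (- k) x.
Proof. by rewrite /ex conj_expi; congr expi; rewrite mulrNz; ring. Qed.

Lemma exDx (R : realType) k (x y : R) : ex k (x + y) = ex k x * ex k y.
Proof. by rewrite /ex -expiD; congr expi; ring. Qed.

Lemma exN (R : realType) k (x : R) : ex k (- x) = ex (- k) x.
Proof. by rewrite /ex; congr expi; rewrite mulrNz; ring. Qed.

Lemma exBx (R : realType) k (x y : R) : ex k (x - y) = ex k x * ex (- k) y.
Proof. by rewrite exDx exN. Qed.

Lemma exM (R : realType) (k l : int) (x : R) : ex (k * l) x = ex k (l%:~R * x).
Proof. by rewrite /ex intrM; congr expi; ring. Qed.

Lemma exXn (R : realType) k (x : R) n : ex k x ^+ n = ex (k * n%:Z) x.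
Proof.
elim: n => [|n IH]; first by rewrite expr0 mulr0 ex0.
by rewrite exprS IH -exD; congr ex; rewrite intS mulrDr mulr1.
Qed.

Lemma ex_nat (R : realType) (k : nat) (x : R) : ex k%:Z x = ex 1 x ^+ k.
Proof. by rewrite exXn mul1r. Qed.

Lemma ex1_nat (R : realType) (n : nat) : ex 1 (n%:R : R) = 1.
Proof.
elim: n => [|n IH]; first exact: exx0.
rewrite -addn1 natrD exDx IH mul1r /ex /expi.
by rewrite mulr1 mulr1 mulrC mulr_natr cos2pi sin2pi.
Qed.

Lemma ex_int (R : realType) (k l : int) : ex k (l%:~R : R) = 1.
Proof.
have H : forall m : int, ex 1 (m%:~R : R) = 1.
  case=> m; first exact: ex1_nat.
  by rewrite NegzE mulrNz exN -conj_ex ex1_nat conjc1.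
by have := H (k * l); rewrite /ex => <-; congr expi; rewrite intrM; ring.
Qed.

Lemma ex_frac (R : realType) k (x : R) : ex k (Defs.frac x) = ex k x.
Proof. by rewrite /Defs.frac exBx -conj_ex ex_int conjc1 mulr1. Qed.

Lemma cosMN_lt1 (R : realType) (u : R) : 0 < u < 1 -> cos (2 * pi * u) < 1.
Proof.
move=> /andP[u0 u1]; have pi0 := pi_gt0 R.
have H (v : R) : 0 < v -> v <= 2^-1 -> cos (2 * pi * v) < 1.
  move=> v0 v1; have a0 : 0 < 2 * pi * v by rewrite !mulr_gt0.
  have a1 : 2 * pi * v <= pi :> R by nra.
  by rewrite -[ltRHS]cos0 ltr_cos// in_itv/= ?lexx ?(ltW a0) ?(ltW pi0) ?a1.
have [?|?] := leP u 2^-1; first exact: H.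
have -> : cos (2 * pi * u) = cos (2 * pi * (1 - u)).
  rewrite -[LHS]cosN -[LHS]cosD2pi; congr cos.
  by rewrite -mulr_natl; ring.
by apply: H; lra.
Qed.

Lemma cabs_ex1B1 (R : realType) (u : R) :
  cabs (ex 1 u - 1) ^+ 2 = 2 - 2 * cos (2 * pi * u).
Proof.
rewrite /ex mulr1 /expi /cabs /=.
rewrite sqr_sqrtr ?addr_ge0 ?sqr_ge0//.
have := cos2Dsin2 (2 * pi * u); set c := cos _; set s := sin _ => H.
move: H; rewrite ?subr0; lra.
Qed.

Lemma ex1_neq1 (R : realType) (u : R) : 0 < u < 1 -> ex 1 u != 1.
Proof.
move=> /cosMN_lt1 u1; apply/negP => /eqP e; have := cabs_ex1B1 u.
by rewrite e subrr cabs0; lra.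
Qed.

(** The chord |e(x - y) - 1| serves as distance on the circle. Raising the frequency by one costs
    one chord, so no derivative enters. *)
Lemma ex_lip (R : realType) (k : int) (x y : R) :
  cabs (ex k x - ex k y) <= `|k|%N%:R * cabs (ex 1 (x - y) - 1).
Proof.
have -> : cabs (ex k x - ex k y) = cabs (ex k (x - y) - 1).
  rewrite -[LHS]mulr1 -(cabs_ex (- k) y) -cabsM mulrBl -exD addrN ex0.
  by rewrite -[X in cabs (_ * X - _)]exN -exDx.
have H (n : nat) u : cabs (ex n%:Z u - 1 : R[i]) <= n%:R * cabs (ex 1 u - 1).
  elim: n => [|n IH]; first by rewrite ex0 subrr cabs0 mul0r.
  have -> : ex n.+1%:Z u - 1 = ex n%:Z u * (ex 1 u - 1) + (ex n%:Z u - 1).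
    by rewrite intS exD; ring.
  rewrite (le_trans (cabsD _ _))// cabsM cabs_ex mul1r -natr1 mulrDl mul1r addrC.
  by rewrite lerD2r.
case: k => n; first exact: H.
rewrite NegzE abszN absz_nat -conj_ex.
have -> : ((ex n.+1%:Z (x - y))^* - 1 = (ex n.+1%:Z (x - y) - 1)^*)%C.
  by rewrite rmorphB rmorph1.
by rewrite cabs_conj; exact: H.
Qed.

(** * Means over division points *)

Definition avgn (R : realType) (K : numFieldType) (n : nat) (g : R -> K) : K :=
  (\sum_(j < n) g (j%:R / n%:R)) / n%:R.

Definition hasmean (R : realType) (K : numFieldType) (g : R -> K) (v : K) : Prop :=
  \forall n \near \oo, avgn n g = v.

(* The averages of a trigonometric polynomial over the n-th division points
   are eventually constant, so this is its integral over a period. *)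
Definition mean (R : realType) (K : numFieldType) (g : R -> K) : K :=
  xget 0 [set v | hasmean g v].

(** Frequencies may be repeated and S may exceed the spectrum: only an upper bound for the spectrum
    is tracked, and such bounds add under products. *)
Definition trig (R : realType) (S : set int) (g : R -> R[i]) : Prop :=
  exists l : seq (R[i] * int), (forall q, q \in l -> S q.2) /\
    g = fun x => \sum_(q <- l) q.1 * ex q.2 x.

Definition rtrig (R : realType) (S : set int) (F : R -> R) : Prop :=
  trig S (fun x => (F x)%:C).

Lemma near_ex2 (P Q : nat -> Prop) :
  (\forall n \near \oo, P n) -> (\forall n \near \oo, Q n) -> exists n, P n /\ Q n.
Proof.
move=> [M _ HM] [N _ HN]; exists (maxn M N); split.
  by apply: HM; rewrite /= leq_maxl.
by apply: HN; rewrite /= leq_maxr.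
Qed.

Lemma hasmean_inj (R : realType) (K : numFieldType) (g : R -> K) v w :
  hasmean g v -> hasmean g w -> v = w.
Proof. by move=> gv gw; have [n [<- <-]] := near_ex2 gv gw. Qed.

Lemma hasmeanE (R : realType) (K : numFieldType) (g : R -> K) v :
  hasmean g v -> mean g = v.
Proof.
move=> gv; rewrite /mean; case: xgetP => [w _ gw|]; first exact: hasmean_inj gw gv.
by move/(_ v).
Qed.

Lemma hasmeanP (R : realType) (K : numFieldType) (g : R -> K) v :
  hasmean g v -> hasmean g (mean g).
Proof. by move=> gv; rewrite (hasmeanE gv). Qed.

Lemma hasmeanD (R : realType) (K : numFieldType) (f g : R -> K) v w :
  hasmean f v -> hasmean g w -> hasmean (fun x => f x + g x) (v + w).
Proof.
by apply: filterS2 => n <- <-; rewrite /avgn big_split/= mulrDl.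
Qed.

Lemma hasmeanZ (R : realType) (K : numFieldType) (f : R -> K) c v :
  hasmean f v -> hasmean (fun x => c * f x) (c * v).
Proof. by apply: filterS => n <-; rewrite /avgn -mulr_sumr mulrA. Qed.

Lemma hasmean0 (R : realType) (K : numFieldType) : hasmean (fun _ : R => 0 : K) 0.
Proof. by apply: nearW => n; rewrite /avgn big1 ?mul0r. Qed.

(** A geometric sum over n-th roots of unity; the bound on k excludes the nonzero multiples of n. *)
Lemma avgn_ex (R : realType) (k : int) n : (`|k|%N < n)%N ->
  avgn n (@ex R k) = (k == 0)%:R.
Proof.
move=> kn; have n0 : (0 < n)%N by rewrite (leq_ltn_trans _ kn).
have nR : n%:R != 0 :> R by rewrite pnatr_eq0 -lt0n.
have nC : n%:R != 0 :> R[i] by rewrite pnatr_eq0 -lt0n.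
have [->|k0] := eqVneq k 0.
  rewrite /avgn (eq_bigr (fun=> 1)); last by move=> j _; rewrite ex0.
  by rewrite sumr_const card_ord divff.
rewrite /avgn; apply/eqP; rewrite mulf_eq0; apply/orP; left.
set z := ex k (n%:R^-1 : R).
rewrite (eq_bigr (fun j : 'I_n => z ^+ j)); last first.
  move=> j _; rewrite /z exXn exM; congr ex; exact: mulrC.
have zn : z ^+ n = 1.
  rewrite /z exXn exM (_ : n%:Z%:~R / n%:R = 1%:~R) ?ex_int//.
  exact: divff.
have z1 : z - 1 != 0.
  have H (m : nat) : (0 < m < n)%N -> ex m%:Z (n%:R^-1 : R) != 1.
    move=> /andP[m0 mn]; rewrite -[m%:Z]mul1r exM; apply: ex1_neq1.
    rewrite divr_gt0 ?ltr0n//= ltr_pdivrMr ?ltr0n// mul1r.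
    by rewrite -[m%:~R]/(m%:R) ltr_nat.
  rewrite subr_eq0 /z; case: k kn k0 {zn z} => m kn k0.
    by apply: H; rewrite kn lt0n andbT.
  rewrite NegzE -conj_ex; apply/negP => /eqP e.
  have /negP[] := H m.+1 kn; apply/eqP.
  by rewrite -[LHS](conjcK) e conjc1.
have := subrX1 z n; rewrite zn subrr => /esym/eqP.
by rewrite mulf_eq0 (negbTE z1).
Qed.

Lemma hasmean_ex (R : realType) (k : int) : hasmean (@ex R k) (k == 0)%:R.
Proof.
exists (`|k|%N.+1) => // n /= kn; exact: avgn_ex.
Qed.

Lemma trigS (R : realType) (S U : set int) (g : R -> R[i]) :
  S `<=` U -> trig S g -> trig U g.
Proof. by move=> SU [l [lS ->]]; exists l; split=> // q /lS /SU. Qed.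

Lemma trigT (R : realType) (S : set int) (g : R -> R[i]) : trig S g -> trig setT g.
Proof. exact: trigS. Qed.

Lemma trig0 (R : realType) (S : set int) : trig S (fun _ : R => 0).
Proof. by exists [::]; split=> //; apply/funext => x; rewrite big_nil. Qed.

Lemma trig_exp (R : realType) (S : set int) k : S k -> trig S (@ex R k).
Proof.
move=> Sk; exists [:: (1, k)]; split=> [q|]; first by rewrite inE => /eqP ->.
by apply/funext => x; rewrite big_seq1 mul1r.
Qed.

Lemma trigD (R : realType) (S : set int) (f g : R -> R[i]) :
  trig S f -> trig S g -> trig S (fun x => f x + g x).
Proof.
move=> [l [lS ->]] [m [mS ->]]; exists (l ++ m); split=> [q|].
  by rewrite mem_cat => /orP[/lS|/mS].
by apply/funext => x; rewrite big_cat.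
Qed.

Lemma trigM (R : realType) (S U V : set int) (f g : R -> R[i]) :
  (forall a b, S a -> U b -> V (a + b)) ->
  trig S f -> trig U g -> trig V (fun x => f x * g x).
Proof.
move=> SUV [l [lS ->]] [m [mS ->]].
exists [seq (p.1 * q.1, p.2 + q.2) | p <- l, q <- m]; split=> [q|].
  by case/allpairsP => -[p1 p2] [/= /lS ? /mS ? ->]; exact: SUV.
apply/funext => x; rewrite big_allpairs_dep mulr_suml; apply: eq_bigr => p _.
by rewrite mulr_sumr; apply: eq_bigr => q _ /=; rewrite exD; ring.
Qed.

Lemma trigZ (R : realType) (S : set int) c (g : R -> R[i]) :
  trig S g -> trig S (fun x => c * g x).
Proof.
move=> [l [lS ->]]; exists [seq (c * p.1, p.2) | p <- l]; split=> [q|].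
  by case/mapP => p /lS ? ->.
by apply/funext => x; rewrite big_map mulr_sumr; apply: eq_bigr => p _; rewrite mulrA.
Qed.

Lemma trigN (R : realType) (S : set int) (g : R -> R[i]) :
  trig S g -> trig S (fun x => - g x).
Proof.
move=> /(trigZ (-1)); congr trig; apply/funext => x; exact: mulN1r.
Qed.

Lemma trigB (R : realType) (S : set int) (f g : R -> R[i]) :
  trig S f -> trig S g -> trig S (fun x => f x - g x).
Proof. by move=> Sf Sg; apply: trigD => //; apply: trigN. Qed.

Lemma trig_cst (R : realType) (S : set int) c : S 0 -> trig S (fun _ : R => c).
Proof.
move=> /(@trig_exp R) /(trigZ c); congr trig.
by apply/funext => x; rewrite ex0 mulr1.
Qed.

Lemma trig_bigsum (R : realType) (S : set int) (I : eqType) (r : seq I) (P : pred I)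
    (f : I -> R -> R[i]) :
  (forall i, i \in r -> P i -> trig S (f i)) ->
  trig S (fun x => \sum_(i <- r | P i) f i x).
Proof.
elim: r => [_|i r IH H].
  by rewrite (_ : (fun=> _) = (fun=> 0)); [exact: trig0|apply/funext => x; rewrite big_nil].
have Hr : trig S (fun x => \sum_(i <- r | P i) f i x).
  by apply: IH => j jr; apply: H; rewrite inE jr orbT.
have [Pi|Pi] := boolP (P i).
  rewrite (_ : (fun=> _) = (fun x => f i x + \sum_(i <- r | P i) f i x)).
    by apply: trigD => //; apply: H => //; rewrite inE eqxx.
  by apply/funext => x; rewrite big_cons Pi.
rewrite (_ : (fun=> _) = (fun x => \sum_(i <- r | P i) f i x))//.
by apply/funext => x; rewrite big_cons (negbTE Pi).
Qed.

Lemma trig_conj (R : realType) (S : set int) (g : R -> R[i]) :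
  trig S g -> trig [set k | S (- k)] (fun x => ((g x)^*)%C).
Proof.
move=> [l [lS ->]]; exists [seq ((p.1^*)%C, - p.2) | p <- l]; split=> [q|].
  by case/mapP => p /lS ? -> /=; rewrite opprK.
apply/funext => x; rewrite big_map conjc_sum; apply: eq_bigr => p _.
by rewrite /= -conj_ex; exact: (rmorphM (@conjc R)).
Qed.

Lemma trig_deg (R : realType) (S : set int) (g : R -> R[i]) : trig S g ->
  exists D : nat, trig [set k | `|k|%N <= D]%N g.
Proof.
move=> [l [lS ->]]; exists (\max_(q <- l) `|q.2|%N)%N, l; split=> // q ql /=.
by rewrite (big_rem q)//= leq_maxl.
Qed.

Lemma hasmean_trig_coef (R : realType) (l : seq (R[i] * int)) :
  hasmean (fun x : R => \sum_(q <- l) q.1 * ex q.2 x) (\sum_(q <- l) q.1 * (q.2 == 0)%:R).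
Proof.
elim: l => [|p l IH].
  rewrite (_ : (fun=> _) = (fun=> 0)) ?big_nil; first exact: hasmean0.
  by apply/funext => x; rewrite big_nil.
rewrite (_ : (fun=> _) = (fun x : R => p.1 * ex p.2 x + \sum_(q <- l) q.1 * ex q.2 x)).
  rewrite big_cons; apply: hasmeanD => //; apply: hasmeanZ; exact: hasmean_ex.
by apply/funext => x; rewrite big_cons.
Qed.

Lemma trig_hasmean (R : realType) (S : set int) (g : R -> R[i]) :
  trig S g -> hasmean g (mean g).
Proof. by move=> [l [_ ->]]; apply: hasmeanP (hasmean_trig_coef l). Qed.

Lemma mean_trig0 (R : realType) (S : set int) (g : R -> R[i]) :
  trig S g -> ~ S 0 -> mean g = 0.
Proof.
move=> [l [lS ->]] S0; rewrite (hasmeanE (hasmean_trig_coef l)).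
rewrite big_seq big1// => q /lS Sq; rewrite (_ : _ == _ = false) ?mulr0//.
by apply/negP => /eqP q0; apply: S0; rewrite -q0.
Qed.

Lemma meanD (R : realType) (S U : set int) (f g : R -> R[i]) :
  trig S f -> trig U g -> mean (fun x => f x + g x) = mean f + mean g.
Proof.
by move=> /trig_hasmean hf /trig_hasmean hg; apply: hasmeanE; apply: hasmeanD.
Qed.

Lemma meanZ (R : realType) (S : set int) c (g : R -> R[i]) :
  trig S g -> mean (fun x => c * g x) = c * mean g.
Proof. by move=> /trig_hasmean hg; apply: hasmeanE; apply: hasmeanZ. Qed.

Lemma meanN (R : realType) (S : set int) (g : R -> R[i]) :
  trig S g -> mean (fun x => - g x) = - mean g.
Proof.
move=> /(meanZ (-1)); rewrite mulN1r => <-; congr mean.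
by apply/funext => x; rewrite mulN1r.
Qed.

Lemma meanB (R : realType) (S U : set int) (f g : R -> R[i]) :
  trig S f -> trig U g -> mean (fun x => f x - g x) = mean f - mean g.
Proof. by move=> hf hg; rewrite (meanD hf (trigN hg)) (meanN hg). Qed.

Lemma mean_sum (R : realType) (S : set int) (I : eqType) (r : seq I)
    (f : I -> R -> R[i]) :
  (forall i, i \in r -> trig S (f i)) ->
  mean (fun x => \sum_(i <- r) f i x) = \sum_(i <- r) mean (f i).
Proof.
elim: r => [_|i r IH H].
  rewrite big_nil; apply: hasmeanE.
  rewrite (_ : (fun=> _) = (fun=> 0)); first exact: hasmean0.
  by apply/funext => x; rewrite big_nil.
have H' j : j \in r -> trig S (f j) by move=> jr; apply: H; rewrite inE jr orbT.
rewrite big_cons -IH// -(@meanD _ S S); first last.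
- by apply: (@trig_bigsum _ _ _ r xpredT) => j jr _; exact: H'.
- by apply: H; rewrite inE eqxx.
by congr mean; apply/funext => x; rewrite big_cons.
Qed.

Lemma mean_ex (R : realType) k : mean (@ex R k) = (k == 0)%:R.
Proof. exact: hasmeanE (hasmean_ex R k). Qed.

Lemma rtrigT (R : realType) (S : set int) (F : R -> R) : rtrig S F -> rtrig setT F.
Proof. exact: trigS. Qed.

Lemma rtrigD (R : realType) (S : set int) (f g : R -> R) :
  rtrig S f -> rtrig S g -> rtrig S (fun x => f x + g x).
Proof.
move=> Sf Sg; have := trigD Sf Sg; congr trig.
by apply/funext => x; rewrite rmorphD.
Qed.

Lemma rtrigM (R : realType) (S U V : set int) (f g : R -> R) :
  (forall a b, S a -> U b -> V (a + b)) ->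
  rtrig S f -> rtrig U g -> rtrig V (fun x => f x * g x).
Proof.
move=> SUV Sf Sg; have := trigM SUV Sf Sg; congr trig.
by apply/funext => x; rewrite rmorphM.
Qed.

Lemma rtrig_cst (R : realType) (S : set int) c : S 0 -> rtrig S (fun _ : R => c).
Proof. exact: trig_cst. Qed.

Lemma rtrigZ (R : realType) (S : set int) c (g : R -> R) :
  rtrig S g -> rtrig S (fun x => c * g x).
Proof.
move=> Sg; have := trigZ c%:C Sg; congr trig.
by apply/funext => x; rewrite rmorphM.
Qed.

Lemma rtrigB (R : realType) (S : set int) (f g : R -> R) :
  rtrig S f -> rtrig S g -> rtrig S (fun x => f x - g x).
Proof.
move=> Sf Sg; have := trigB Sf Sg; congr trig.
by apply/funext => x; rewrite rmorphB.
Qed.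

Lemma rtrig_bigsum (R : realType) (S : set int) (I : eqType) (r : seq I) (P : pred I)
    (f : I -> R -> R) :
  (forall i, i \in r -> P i -> rtrig S (f i)) ->
  rtrig S (fun x => \sum_(i <- r | P i) f i x).
Proof.
move=> /trig_bigsum; congr trig.
by apply/funext => x; rewrite (rmorph_sum (real_complex R)).
Qed.

Lemma rtrig_cabs2 (R : realType) (S : set int) (g : R -> R[i]) :
  trig S g -> rtrig setT (fun x => cabs (g x) ^+ 2).
Proof.
move=> Sg; have := @trigM _ _ _ setT _ _ (fun _ _ _ _ => I) Sg (trig_conj Sg).
by congr trig; apply/funext => x; rewrite mulcJ.
Qed.

Lemma avgn_rc (R : realType) (F : R -> R) n :
  avgn n (fun x => (F x)%:C) = (avgn n F)%:C.
Proof.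
by rewrite /avgn rmorphM/= fmorphV (rmorph_sum (real_complex R)) rmorph_nat.
Qed.

Lemma rtrig_hasmean (R : realType) (S : set int) (F : R -> R) :
  rtrig S F -> hasmean F (mean F) /\ mean (fun x => (F x)%:C) = (mean F)%:C.
Proof.
move=> /trig_hasmean SF; set v := mean _ in SF.
have hF : hasmean F (complex.Re v).
  by apply: filterS SF => n; rewrite avgn_rc => <-.
rewrite (hasmeanE hF); split=> //; apply: hasmeanE.
by apply: filterS hF => n; rewrite avgn_rc => ->.
Qed.

Lemma rmeanE (R : realType) (S : set int) (F : R -> R) :
  rtrig S F -> mean (fun x => (F x)%:C) = (mean F)%:C.
Proof. by move=> /rtrig_hasmean[]. Qed.

Lemma ler_avgn (R : realType) (F G : R -> R) n :
  (forall x, F x <= G x) -> avgn n F <= avgn n G.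
Proof. by move=> FG; rewrite /avgn ler_wpM2r ?invr_ge0// ler_sum. Qed.

Lemma ler_mean (R : realType) (S U : set int) (F G : R -> R) :
  rtrig S F -> rtrig U G -> (forall x, F x <= G x) -> mean F <= mean G.
Proof.
move=> /rtrig_hasmean[hF _] /rtrig_hasmean[hG _] FG.
by have [n [<- <-]] := near_ex2 hF hG; exact: ler_avgn.
Qed.

Lemma cabs_mean (R : realType) (S U : set int) (g : R -> R[i]) (F : R -> R) :
  trig S g -> rtrig U F -> (forall x, cabs (g x) <= F x) -> cabs (mean g) <= mean F.
Proof.
move=> /trig_hasmean hg /rtrig_hasmean[hF _] gF.
have [n [<- <-]] := near_ex2 hg hF.
rewrite /avgn cabsM cabsV cabs_nat ler_wpM2r ?invr_ge0// (le_trans (cabs_sum _ _ _))//.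
exact: ler_sum.
Qed.

Lemma rmean_cst (R : realType) (c : R) : mean (fun _ : R => c) = c.
Proof.
apply: hasmeanE; exists 1%N => // n /= n0.
by rewrite /avgn sumr_const card_ord -[c *+ n]mulr_natr mulfK// pnatr_eq0 -lt0n.
Qed.

Lemma rmean_ge0 (R : realType) (S : set int) (F : R -> R) :
  rtrig S F -> (forall x, 0 <= F x) -> 0 <= mean F.
Proof.
by move=> SF F0; rewrite -(rmean_cst 0); apply: ler_mean SF F0; apply: (@rtrig_cst _ setT).
Qed.

Lemma rmeanD (R : realType) (S U : set int) (f g : R -> R) :
  rtrig S f -> rtrig U g -> mean (fun x => f x + g x) = mean f + mean g.
Proof.
by move=> /rtrig_hasmean[hf _] /rtrig_hasmean[hg _]; apply: hasmeanE; apply: hasmeanD.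
Qed.

Lemma rmeanZ (R : realType) (S : set int) c (g : R -> R) :
  rtrig S g -> mean (fun x => c * g x) = c * mean g.
Proof. by move=> /rtrig_hasmean[hg _]; apply: hasmeanE; apply: hasmeanZ. Qed.

Lemma rmean_sum (R : realType) (S : set int) (I : eqType) (r : seq I)
    (f : I -> R -> R) :
  (forall i, i \in r -> rtrig S (f i)) ->
  mean (fun x => \sum_(i <- r) f i x) = \sum_(i <- r) mean (f i).
Proof.
move=> H; apply: (@complexI R); rewrite -(@rmeanE _ S); last first.
  by apply: (@rtrig_bigsum _ _ _ r xpredT) => i ir _; exact: H.
rewrite (rmorph_sum (real_complex R)) /= big_seq.
under eq_bigr => i ir do rewrite -(rmeanE (H _ ir)).
rewrite -big_seq -(mean_sum H); congr mean.
by apply/funext => x; rewrite (rmorph_sum (real_complex R)).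
Qed.

Lemma trig_lip (R : realType) (S : set int) (g : R -> R[i]) : trig S g ->
  exists2 L : R, 0 <= L &
    forall x y, cabs (g x - g y) <= L * cabs (ex 1 (x - y) - 1).
Proof.
move=> [l [_ ->]]; exists (\sum_(q <- l) cabs q.1 * `|q.2|%N%:R).
  by apply: sumr_ge0 => q _; rewrite mulr_ge0 ?cabs_ge0.
move=> x y; rewrite -sumrB (le_trans (cabs_sum _ _ _))// mulr_suml ler_sum// => q _.
by rewrite -mulrBr cabsM -mulrA ler_wpM2l ?cabs_ge0//; exact: ex_lip.
Qed.

Lemma trig_bounded (R : realType) (S : set int) (g : R -> R[i]) : trig S g ->
  exists2 L : R, 0 <= L & forall x, cabs (g x) <= L.
Proof.
move=> [l [_ ->]]; exists (\sum_(q <- l) cabs q.1).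
  by apply: sumr_ge0 => q _; rewrite cabs_ge0.
move=> x; rewrite (le_trans (cabs_sum _ _ _))// ler_sum// => q _.
by rewrite cabsM cabs_ex mulr1.
Qed.

(* Newton-type iteration for the square root of v^2. *)
Fixpoint sqrt_iter (R : realType) (n : nat) (v : R) : R :=
  if n is n'.+1 then sqrt_iter n' v + (v ^+ 2 - sqrt_iter n' v ^+ 2) / 2 else 0.

(** With t = |v|, one step multiplies the error t - q by 1 - (t + q)/2, which lies between 0 and 1 -
    t/2 as long as 0 <= q <= t <= 1. *)
Lemma sqrt_iter_bound (R : realType) n (v : R) : `|v| <= 1 ->
  [/\ 0 <= sqrt_iter n v, sqrt_iter n v <= `|v| &
    `|v| - sqrt_iter n v <= `|v| * (1 - `|v| / 2) ^+ n].
Proof.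
move=> v1; have v0 := normr_ge0 v; have v2 := real_normK (num_real v).
elim: n => [|n [IH1 IH2 IH3]] /=; first by rewrite expr0 mulr1 subr0 lexx.
set q := sqrt_iter n v in IH1 IH2 IH3 *; set t := `|v| in v0 v1 v2 IH2 IH3 *.
rewrite -v2; have E : t - (q + (t ^+ 2 - q ^+ 2) / 2) = (t - q) * (1 - (t + q) / 2) by field.
split.
- by rewrite addr_ge0// divr_ge0// subr_ge0 lerXn2r// nnegrE.
- by rewrite -subr_ge0 E mulr_ge0; lra.
- rewrite E exprSr mulrA; apply: ler_pM; lra.
Qed.

Lemma exprn_bernoulli (R : realType) (s : R) n : 0 <= s <= 1 ->
  (1 - s) ^+ n * (1 + n%:R * s) <= 1.
Proof.
move=> /andP[s0 s1]; elim: n => [|n IH]; first by rewrite expr0 mul0r addr0 mulr1.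
apply: le_trans IH; rewrite exprS -natr1.
have P : 0 <= (1 - s) ^+ n by rewrite exprn_ge0; lra.
rewrite mulrAC [leRHS]mulrC ler_wpM2r// -subr_ge0.
have : 0 <= n%:R :> R by [].
set N := n%:R; nra.
Qed.

Lemma exprn_small (R : realType) (s e : R) : 0 < s <= 1 -> 0 < e ->
  exists n, (1 - s) ^+ n <= e.
Proof.
move=> /andP[s0 s1] e0; have P n : 0 <= (1 - s) ^+ n by rewrite exprn_ge0; lra.
have es : 0 <= (e * s)^-1 by rewrite invr_ge0 mulr_ge0// ltW.
have := archi_boundP es; set n := Num.bound _ => Hn; exists n.
have := @exprn_bernoulli R s n; rewrite (ltW s0) s1 => /(_ isT).
rewrite -[_^-1]mul1r ltr_pdivrMr ?mulr_gt0// in Hn.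
move: (P n) Hn; set X := _ ^+ n; set N := n%:R; nra.
Qed.

(** By the Bernoulli inequality the error t (1 - t/2)^n is at most t / (1 + n t/2) <= 2/n, uniformly
    down to t = 0. *)
Lemma sqrt_iter_lim (R : realType) (eps : R) : 0 < eps ->
  exists n, forall v : R, `|v| <= 1 -> `|sqrt_iter n v - `|v| | <= eps.
Proof.
move=> eps0; have [n Hn] : exists n : nat, 2 / eps < n%:R.
  exists (Num.bound (2 / eps)); by apply: archi_boundP; rewrite divr_ge0// ltW.
exists n => v v1; have [q0 qv H] := sqrt_iter_bound n v1.
rewrite ler0_norm ?subr_le0// opprB (le_trans H)//.
have v0 := normr_ge0 v; set t := `|v| in v0 v1 *.
have B : (1 - t / 2) ^+ n * (1 + n%:R * (t / 2)) <= 1.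
  by apply: exprn_bernoulli; apply/andP; split; lra.
have P : 0 <= (1 - t / 2) ^+ n by rewrite exprn_ge0; lra.
have n2 : 2 < n%:R * eps by rewrite -ltr_pdivrMr.
move: B P n2; set X := _ ^+ n; set N := n%:R => B P n2.
have X0 : t * X * N <= 2 by nra.
have N0 : 0 < N by nra.
rewrite -(ler_pM2r N0); nra.
Qed.

Lemma rtrig_sqrt_iter (R : realType) (g : R -> R) n : rtrig setT g ->
  rtrig setT (fun x => sqrt_iter n (g x)).
Proof.
move=> Hg; have mulT (a b : R -> R) : rtrig setT a -> rtrig setT b ->
    rtrig setT (fun x => a x * b x) by exact: rtrigM.
elim: n => [|n IH] /=; first exact: rtrig_cst.
apply: (rtrigD IH); rewrite (_ : (fun=> _) =
    fun x => 2^-1 * (g x * g x - sqrt_iter n (g x) * sqrt_iter n (g x))); last first.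
  by apply/funext => x; rewrite !expr2 mulrC.
exact: rtrigZ (rtrigB (mulT _ _ Hg Hg) (mulT _ _ IH IH)).
Qed.

(* max(0, 1 - u) *)
Definition cutoff (R : realType) (u : R) : R := (1 - u + `|1 - u|) / 2.

Lemma cutoff_ge0 (R : realType) (u : R) : 0 <= cutoff u.
Proof. by rewrite /cutoff; have := ler_norm (- (1 - u)); rewrite normrN; lra. Qed.

Lemma cutoff_le1 (R : realType) (u : R) : 0 <= u -> cutoff u <= 1.
Proof.
move=> u0; rewrite /cutoff; have [?|?] := leP 0 (1 - u).
  by rewrite ger0_norm//; lra.
by rewrite ltr0_norm//; lra.
Qed.

Lemma cutoff_eq0 (R : realType) (u : R) : 1 <= u -> cutoff u = 0.
Proof. by move=> u1; rewrite /cutoff ler0_norm; lra. Qed.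

Lemma cutoff0 (R : realType) : cutoff (0 : R) = 1.
Proof. by rewrite /cutoff subr0 normr1; lra. Qed.

Lemma cutoff_lip (R : realType) (u v : R) : `|cutoff u - cutoff v| <= `|u - v|.
Proof.
rewrite /cutoff (_ : _ - _ = ((v - u) + (`|1 - u| - `|1 - v|)) / 2); last by field.
rewrite normrM [X in _ * X]ger0_norm ?invr_ge0// ler_pdivrMr//.
rewrite (le_trans (ler_normD _ _))// mulr2n mulrDr mulr1 distrC lerD2l.
rewrite (le_trans (ler_dist_dist _ _))// (_ : 1 - u - (1 - v) = - (u - v)) ?normrN//.
by ring.
Qed.

(** The absolute value in the cutoff is replaced by [sqrt_iter], a polynomial, after scaling by a
    bound M that brings 1 - T into [-1, 1]. A polynomial in a trigonometric polynomial is again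
    one. *)
Lemma rtrig_cutoff_approx (R : realType) (T : R -> R) (eps : R) : rtrig setT T ->
  0 < eps -> exists2 p : R -> R, rtrig setT p & forall x, `|p x - cutoff (T x)| <= eps.
Proof.
move=> HT eps0; have H1 : rtrig setT (fun x => 1 - T x).
  by apply: rtrigB HT; exact: rtrig_cst.
have [L L0 HL] := trig_bounded H1.
pose M := L + 1; have M0 : 0 < M by rewrite /M; lra.
have e2 : 0 < eps / M by rewrite divr_gt0.
have [n Hn] := sqrt_iter_lim e2.
have H2 := rtrig_sqrt_iter n (rtrigZ M^-1 H1).
exists (fun x => 2^-1 * ((1 - T x) + M * sqrt_iter n (M^-1 * (1 - T x)))).
  by apply: rtrigZ; apply: rtrigD => //; apply: rtrigZ.
move=> x; set y := 1 - T x.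
have yM : `|y| <= M by have := HL x; rewrite cabsR /M /y; lra.
have E : `|y| = M * `|M^-1 * y|.
  by rewrite normrM gtr0_norm ?invr_gt0// mulrA mulfV ?gt_eqF// mul1r.
rewrite /cutoff -/y E /= (_ : _ - _ = 2^-1 * (M * (sqrt_iter n (M^-1 * y) - `|M^-1 * y|))).
  have v1 : `|M^-1 * y| <= 1.
    by rewrite normrM gtr0_norm ?invr_gt0// ler_pdivrMl// mulr1.
  have := Hn _ v1; rewrite !normrM (gtr0_norm M0) [`|2^-1|]gtr0_norm// ler_pdivlMr//.
  set A := `|_ - _|; lra.
by field.
Qed.

(** * Riesz products *)

Definition cosk (R : realType) (k : int) (x : R) : R := cos (2 * pi * k%:~R * x).

Lemma coskE (R : realType) (k : int) (x : R) :
  (cosk k x)%:C = 2^-1 * ex k x + 2^-1 * ex (- k) x.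
Proof.
by rewrite -mulrDr -conj_ex addcJ mulrA mulVf ?mul1r.
Qed.

Lemma cosk_le1 (R : realType) (k : int) (x : R) : `|cosk k x| <= 1.
Proof. exact: cos_max. Qed.

Lemma rtrig_cosk (R : realType) (S : set int) k : S k -> S (- k) -> rtrig S (@cosk R k).
Proof.
move=> Sk SNk; rewrite /rtrig (_ : (fun=> _) = fun x : R => 2^-1 * ex k x + 2^-1 * ex (- k) x).
  by apply: trigD; apply: trigZ; apply: trig_exp.
by apply/funext => x; rewrite coskE.
Qed.

Definition digit_spec (w : int) (n m : nat) (Delta : nat -> set int) : set int :=
  [set z | exists2 d, (forall t, (n <= t < m)%N -> Delta t (d t)) & z = digit_sum w n m d].

Lemma trig_prod_digits (R : realType) (w : int) (n m : nat) (Delta : nat -> set int)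
    (phi : nat -> R -> R[i]) :
  (forall t, (n <= t < m)%N ->
    trig [set z | exists2 e, Delta t e & z = e * w ^+ t] (phi t)) ->
  trig (digit_spec w n m Delta) (fun x => \prod_(n <= t < m) phi t x).
Proof.
have [mn _|nm] := leqP m n.
  rewrite (_ : (fun=> _) = fun=> 1); last by apply/funext => x; rewrite big_geq.
  by apply: trig_cst; exists (fun=> 0) => [t|]; [lia|rewrite /digit_sum big_geq].
elim: m {nm}(ltnW nm) => [|m IH] nm H.
  rewrite (_ : (fun=> _) = fun=> 1); last by apply/funext => x; rewrite big_geq.
  by apply: trig_cst; exists (fun=> 0) => [t|]; [lia|rewrite /digit_sum big_geq].
move: nm; rewrite leq_eqVlt => /orP[/eqP nm|]; last rewrite ltnS => nm.
  rewrite (_ : (fun=> _) = fun=> 1).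
    by apply: trig_cst; exists (fun=> 0) => [t|]; [lia|rewrite /digit_sum big_geq// nm].
  by apply/funext => x; rewrite big_geq// nm.
rewrite (_ : (fun=> _) = fun x => (\prod_(n <= t < m) phi t x) * phi m x); last first.
  by apply/funext => x; rewrite big_nat_recr.
have H' t : (n <= t < m)%N -> trig [set z | exists2 e, Delta t e & z = e * w ^+ t] (phi t).
  by move=> /andP[nt tm]; apply: H; rewrite nt ltnW.
have Hm : trig [set z | exists2 e, Delta m e & z = e * w ^+ m] (phi m).
  by apply: H; rewrite nm ltnSn.
apply: trigM (IH nm H') Hm => a b [d dD ->] [e De ->].
exists (fun t => if t == m then e else d t).
  move=> t /andP[nt]; rewrite ltnS leq_eqVlt; have [->//|tm /= tm'] := eqVneq t m.
  by apply: dD; rewrite nt.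
rewrite /digit_sum big_nat_recr//= eqxx; congr (_ + _).
rewrite big_nat [RHS]big_nat; apply: eq_bigr => t /andP[_ tm].
by rewrite (ltn_eqF tm).
Qed.

Definition riesz (R : realType) (w n m : nat) (x : R) : R :=
  \prod_(n <= t < m) (1 + cosk (w%:Z ^+ t) x).

Lemma riesz_ge0 (R : realType) (w n m : nat) (x : R) : 0 <= riesz w n m x.
Proof.
apply: prodr_ge0 => t _; rewrite -lerBlDl sub0r.
by have := cosk_le1 (w%:Z ^+ t) x; rewrite ler_norml => /andP[].
Qed.

Lemma rtrig_digit_cosk (R : realType) (w : int) (Delta : set int) (k : int) t :
  Delta k -> Delta (- k) ->
  rtrig [set z | exists2 e, Delta e & z = e * w ^+ t] (@cosk R (k * w ^+ t)).
Proof.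
move=> Dk DNk; apply: rtrig_cosk; first by exists k.
by exists (- k); rewrite ?mulNr.
Qed.

Lemma rtrig_riesz (R : realType) (w n m : nat) :
  rtrig (digit_spec w n m (fun=> [set e | `|e| <= 1])) (@riesz R w n m).
Proof.
rewrite /rtrig (_ : (fun=> _) =
    fun x => \prod_(n <= t < m) (1 + cosk (w%:Z ^+ t) x)%:C); last first.
  by apply/funext => x; rewrite /riesz (rmorph_prod (real_complex R)).
apply: trig_prod_digits => t _; apply: rtrigD.
  by apply: rtrig_cst; exists 0; rewrite ?mul0r.
by have := @rtrig_digit_cosk R w [set e | `|e| <= 1] 1 t; rewrite mul1r; apply.
Qed.

(** A new factor adds the old product times one cosine, whose frequencies have top digit 1 or -1.
    Hence every frequency collected in this way has a nonzero digit. *)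
Lemma rtrig_rieszB1 (R : realType) (w n m : nat) :
  rtrig [set z | exists d, [/\ forall t, `|d t| <= 1,
      (exists2 t, (n <= t < m)%N & d t != 0) & z = digit_sum w n m d]]
    (fun x : R => riesz w n m x - 1).
Proof.
have H0 k : (k <= n)%N -> (fun x : R => riesz w n k x - 1) = (fun=> 0).
  by move=> kn; apply/funext => x; rewrite /riesz big_geq// subrr.
elim: m => [|m IH]; first by rewrite H0//; exact: trig0.
have [mn|nm] := ltnP m n; first by rewrite H0//; exact: trig0.
have E d : digit_sum w n m.+1 d = digit_sum w n m d + d m * w%:Z ^+ m.
  by rewrite /digit_sum big_nat_recr.
have Ext (d : nat -> int) e : digit_sum w n m (fun t => if (t < m)%N then d t else e) =
                digit_sum w n m d.
  rewrite /digit_sum big_nat [RHS]big_nat; apply: eq_bigr => t /andP[_ tm].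
  by rewrite tm.
rewrite (_ : (fun=> _) = fun x : R => (riesz w n m x - 1) +
    riesz w n m x * cosk (w%:Z ^+ m) x); last first.
  by apply/funext => x; rewrite {1}/riesz big_nat_recr//= -/(riesz w n m x); ring.
apply: rtrigD.
  apply: trigS IH => z [d [Hd [t /andP[nt tm] dt] ->]].
  exists (fun t => if (t < m)%N then d t else 0); split.
  - by move=> u; case: ifP.
  - by exists t; rewrite ?tm// nt ltnW.
  - by rewrite E Ext ltnn mul0r addr0.
have Hm : rtrig [set z | exists2 e, `|e| = 1 & z = e * w%:Z ^+ m] (@cosk R (w%:Z ^+ m)).
  by have := @rtrig_digit_cosk R w [set e | `|e| = 1] 1 m; rewrite mul1r; apply.
apply: rtrigM (rtrig_riesz R w n m) Hm => a b [d Hd ->] [e e1 ->].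
exists (fun t => if (n <= t)%N then if (t < m)%N then d t else e else 0); split.
- move=> u; case: ifP => // nu; case: ifP => um; last by rewrite e1.
  by apply: Hd; rewrite nu.
- exists m; rewrite ?nm ?ltnSn// ltnn; apply/negP => /eqP e0.
  by move: e1; rewrite /= e0.
- rewrite E nm ltnn; congr (_ + _); rewrite -(Ext d e) /digit_sum.
  by rewrite big_nat [RHS]big_nat; apply: eq_bigr => t /andP[-> _].
Qed.

Definition block (R : realType) (s n : nat) (x : R) : R := riesz (s ^ 2) n n.*2 x.

Lemma block_ge0 (R : realType) (s n : nat) (x : R) : 0 <= block s n x.
Proof. exact: riesz_ge0. Qed.

Lemma rtrig_block (R : realType) (s n : nat) : rtrig setT (@block R s n).
Proof. exact: trigT (rtrig_riesz _ _ _ _). Qed.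

Definition deg_le (D : nat) : set int := [set k | `|k| <= D]%N.

Lemma trig_blockB1 (R : realType) (s n D : nat) (P : R -> R[i]) : trig (deg_le D) P ->
  trig (near_block (s ^ 2) n D) (fun x => P x * (block s n x - 1)%:C).
Proof.
move=> HP; apply: trigM HP (rtrig_rieszB1 R (s ^ 2) n n.*2) => a b aD [d [H1 H2 H3]].
by exists a => //; exists d; split=> //; rewrite -H3; ring.
Qed.

Lemma mean_blockB1 (R : realType) (s n D : nat) (P : R -> R[i]) (k : int) :
  trig (deg_le D) P -> ~ near_block (s ^ 2) n D k ->
  mean (fun x => P x * (block s n x - 1)%:C * ex k x) = 0.
Proof.
move=> HP nk; apply: (@mean_trig0 _ [set z | near_block (s ^ 2) n D (z - k)]).
  apply: (trigM _ (trig_blockB1 s n HP) (@trig_exp R [set k] k erefl)).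
  by move=> a b Ha ->; rewrite /= addrK.
by rewrite /= sub0r => /near_blockN; rewrite opprK.
Qed.

Lemma near_block_ge (w n D : nat) z : (2 <= w)%N -> near_block w n D z ->
  (w ^ n <= `|z| + D)%N.
Proof.
move=> w2 [e eD /(block_sum_ge w2)]; rewrite !Posz_exp.
by move: eD; move: (w ^ n)%N => W; lia.
Qed.

Lemma near_block_le (w n D : nat) z : (2 <= w)%N -> near_block w n D z ->
  (`|z| <= w ^ n.*2 + D)%N.
Proof.
move=> w2 [e eD /(block_sum_le w2)]; rewrite !Posz_exp.
by move: eD; move: (w ^ n.*2)%N => W; lia.
Qed.

(** The nonzero frequencies of the block are at least (s^2)^n > D in absolute value, so they cannot
    cancel a frequency of F. *)
Lemma mean_mul_block (R : realType) (s n D : nat) (F : R -> R) : (2 <= s)%N ->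
  (D < (s ^ 2) ^ n)%N -> rtrig (deg_le D) F -> mean (fun x => F x * block s n x) = mean F.
Proof.
move=> s2 Dn HF; have w2 : (2 <= s ^ 2)%N by rewrite (@leq_trans (2 ^ 2))// leq_exp2r.
have Hb : rtrig setT (fun x => F x * (block s n x - 1)).
  have := trig_blockB1 s n HF; move=> /(@trigT _ _ _); congr trig.
  by apply/funext => x; rewrite rmorphM.
rewrite (_ : (fun=> _) = fun x => F x * (block s n x - 1) + F x); last first.
  by apply/funext => x; ring.
rewrite (rmeanD Hb HF) (_ : mean (fun x => F x * _) = 0) ?add0r//.
apply: (@complexI R); rewrite -(rmeanE Hb).
have := @mean_blockB1 R s n D _ 0 HF; rewrite (_ : (fun x => _ * _ * _) =
  fun x => (F x * (block s n x - 1))%:C); last first.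
  by apply/funext => x; rewrite ex0 mulr1 rmorphM.
by apply => /(near_block_ge w2); rewrite absz0 add0n leqNgt Dn.
Qed.

(* Fluctuation of cos(2 pi s^(2t+a) x) around its mean under the density block s n. *)
Definition fluct (R : realType) (s a t : nat) (x : R) : R :=
  cosk ((s ^ a)%N%:Z * (s ^ 2)%N%:Z ^+ t) x - (a == 0)%N%:R / 2.

(** The multiples of (s^2)^t that occur when the t-th factor of the block is multiplied by the
    fluctuation. Zero is absent: for a = 0 subtracting 1/2 cancels the constant term, and for a = 1
    the multiples are s, s - 1 and s + 1 up to sign. *)
Definition fluct_digits (a s : nat) : set int :=
  if a == 0%N then [set e | e != 0 /\ `|e| <= 2]
  else [set e | e != 0 /\ `|e| <= s%:Z + 1].

Lemma cosk_mul (R : realType) k l (x : R) :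
  cosk k x * cosk l x = 2^-1 * cosk (k + l) x + 2^-1 * cosk (k - l) x.
Proof.
rewrite /cosk intrD intrB.
have -> : 2 * pi * (k%:~R + l%:~R) * x = 2 * pi * k%:~R * x + 2 * pi * l%:~R * x by ring.
have -> : 2 * pi * (k%:~R - l%:~R) * x = 2 * pi * k%:~R * x - 2 * pi * l%:~R * x by ring.
by rewrite cosD cosB; field.
Qed.

Lemma rtrig_fluct (R : realType) (s a t : nat) : (2 <= s)%N -> (a <= 1)%N ->
  rtrig [set z | exists2 e, fluct_digits a s e & z = e * (s ^ 2)%N%:Z ^+ t]
    (fun x : R => (1 + cosk ((s ^ 2)%N%:Z ^+ t) x) * fluct s a t x).
Proof.
move=> s2; set W := (s ^ 2)%N%:Z ^+ t; case: a => [|[|//]] _.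
  rewrite (_ : (fun=> _) = fun x : R => 2^-1 * cosk (1 * W) x + 2^-1 * cosk (2 * W) x).
    apply: rtrigD; apply: rtrigZ; apply: rtrig_digit_cosk; by rewrite /fluct_digits /=; lia.
  apply/funext => x; rewrite /fluct /= expn0 !mul1r mulrDl mul1r mulrBr cosk_mul.
  rewrite subrr (_ : W + W = 2 * W); last by ring.
  by rewrite {3}/cosk !(mulr0, mul0r) cos0; field.
rewrite (_ : (fun=> _) = fun x : R => cosk (s%:Z * W) x +
    (2^-1 * cosk ((1 + s%:Z) * W) x + 2^-1 * cosk ((1 - s%:Z) * W) x)).
  apply: rtrigD; [|apply: rtrigD; apply: rtrigZ]; apply: rtrig_digit_cosk;
    by rewrite /fluct_digits /=; lia.
apply/funext => x; rewrite /fluct /= mul0r subr0 expn1 mulrDl mul1r cosk_mul.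
by rewrite mulrDl mulrBl !mul1r.
Qed.

(** Orthogonality under the density: every frequency of the product has a nonzero digit at t, so
    none of them is 0. *)
Lemma mean_fluct_orth (R : realType) (s n D a t t' : nat) (F : R -> R) : (2 <= s)%N ->
  (a <= 1)%N -> (D < (s ^ 2) ^ n)%N -> rtrig (deg_le D) F ->
  (n <= t < n.*2)%N -> (n <= t' < n.*2)%N -> t != t' ->
  mean (fun x => F x * block s n x * (fluct s a t x * fluct s a t' x)) = 0.
Proof.
move=> s2 a1 Dn HF tn t'n tt'.
have w2 : (2 <= s ^ 2)%N by rewrite (@leq_trans (2 ^ 2))// leq_exp2r.
have sw : (s + 1 < s ^ 2)%N by rewrite -mulnn; nia.
pose c u (x : R) := 1 + cosk ((s ^ 2)%N%:Z ^+ u) x.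
pose phi u (x : R) := if (u == t) || (u == t') then c u x * fluct s a u x else c u x.
pose Delta u : set int :=
  if (u == t) || (u == t') then fluct_digits a s else [set e | `|e| <= 1].
have E x : block s n x * (fluct s a t x * fluct s a t' x) = \prod_(n <= u < n.*2) phi u x.
  have Hone v : (n <= v < n.*2)%N ->
      fluct s a v x = \prod_(n <= u < n.*2) (if u == v then fluct s a u x else 1).
    move=> vn; rewrite (bigD1_seq v) ?iota_uniq ?mem_index_iota//= eqxx big1 ?mulr1//.
    by move=> u /negbTE ->.
  rewrite (Hone t)// (Hone t')// /block /riesz -!big_split/=; apply: eq_bigr => u _.
  rewrite /phi /c; have [->|ut] := eqVneq u t; first by rewrite (negbTE tt') mulr1.
  by case: ifP; rewrite !mul1r ?mulr1.
have Hphi : rtrig (digit_spec (s ^ 2)%N n n.*2 Delta)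
    (fun x => \prod_(n <= u < n.*2) phi u x).
  rewrite /rtrig (_ : (fun=> _) = fun x => \prod_(n <= u < n.*2) (phi u x)%:C); last first.
    by apply/funext => x; rewrite (rmorph_prod (real_complex R)).
  apply: trig_prod_digits => u _; rewrite /phi /Delta; case: ifP => _.
    exact: rtrig_fluct.
  apply: rtrigD; first by apply: rtrig_cst; exists 0; rewrite ?mul0r.
  by have := @rtrig_digit_cosk R (s ^ 2)%N [set e | `|e| <= 1] 1 u; rewrite mul1r; apply.
pose S := [set z | exists2 e, deg_le D e & digit_spec (s ^ 2)%N n n.*2 Delta (z - e)].
have HS : rtrig S (fun x => F x * block s n x * (fluct s a t x * fluct s a t' x)).
  have : rtrig S (fun x => F x * \prod_(n <= u < n.*2) phi u x).
    apply: rtrigM HF Hphi => e b eD Hb.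
    by exists e => //; rewrite addrAC subrr add0r.
  by congr (rtrig S); apply/funext => x; rewrite -E mulrA.
apply: (@complexI R); rewrite -(rmeanE HS); apply: mean_trig0 HS _.
move=> [e eD [d Hd]]; rewrite sub0r => Ed.
(* Frequency 0 would require e to cancel a digit sum, which is divisible by (s^2)^n > |e|. *)
have e0 : e = 0.
  apply: (@dvdz_small ((s ^ 2)%N%:Z ^+ n)).
    by rewrite -[e]opprK rpredN Ed; exact: dvdz_digit_sum.
  move: eD Dn; rewrite Posz_exp /deg_le /=; move: ((s ^ 2) ^ n)%N => W; lia.
have Hd' u : (n <= u < n.*2)%N -> `|d u| < (s ^ 2)%N%:Z.
  move=> /Hd; rewrite /Delta /fluct_digits; move: sw w2; move: (s ^ 2)%N => W.
  by case: ifP => _; [case: ifP => _ /= sW W2 [_]|move=> /= sW W2]; lia.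
have w1 : 1 < (s ^ 2)%N%:Z by move: w2; move: (s ^ 2)%N => W; lia.
have := digit_sum_eq0 w1 Hd'; rewrite -Ed e0 oppr0 => /(_ erefl t tn) dt.
have := Hd t tn; rewrite /Delta eqxx /= /fluct_digits dt.
by case: ifP => _ [].
Qed.

Definition disc (R : realType) (s n a : nat) (x : R) : R :=
  (n%:R^-1 * \sum_(n <= t < n.*2) fluct s a t x) ^+ 2.

Lemma fluct_le (R : realType) (s a t : nat) (x : R) : `|fluct s a t x| <= 3 / 2.
Proof.
rewrite /fluct (le_trans (ler_normB _ _))//.
have := cosk_le1 ((s ^ a)%N%:Z * (s ^ 2)%N%:Z ^+ t) x.
rewrite [X in _ + X]ger0_norm ?divr_ge0//.
by case: (a == 0)%N => /=; lra.
Qed.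

Lemma rtrigT_fluct (R : realType) (s a t : nat) : rtrig setT (@fluct R s a t).
Proof. by apply: rtrigB; [exact: rtrig_cosk|exact: rtrig_cst]. Qed.

Lemma rtrigT_mul (R : realType) (S U : set int) (f g : R -> R) :
  rtrig S f -> rtrig U g -> rtrig setT (fun x => f x * g x).
Proof. by move=> Sf Ug; exact: rtrigM Sf Ug. Qed.

Lemma rtrigT_disc (R : realType) (s n a : nat) : rtrig setT (@disc R s n a).
Proof.
have H : rtrig setT (fun x : R => n%:R^-1 * \sum_(n <= t < n.*2) fluct s a t x).
  by apply: rtrigZ; apply: rtrig_bigsum => t _ _; exact: rtrigT_fluct.
exact: (rtrigT_mul H H).
Qed.

Lemma disc_ge0 (R : realType) (s n a : nat) (x : R) : 0 <= disc s n a x.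
Proof. exact: sqr_ge0. Qed.

Lemma disc_le (R : realType) (s n a : nat) (x : R) : disc s n a x <= 4.
Proof.
have Hs : `|\sum_(n <= t < n.*2) fluct s a t x| <= n%:R * (3 / 2).
  apply: le_trans (ler_norm_sum _ _ _) _.
  apply: le_trans (ler_sum _ (fun t _ => fluct_le s a t x)) _.
  by rewrite sumr_const_nat -[X in (X - _)%N]addnn addnK -[leLHS]mulr_natl.
have H2 : `|n%:R^-1 * \sum_(n <= t < n.*2) fluct s a t x| <= 2.
  have n0 : 0 <= n%:R^-1 :> R by rewrite invr_ge0.
  rewrite normrM (ger0_norm n0); apply: le_trans (ler_wpM2l n0 Hs) _.
  have [->|nR] := eqVneq (n%:R : R) 0; first by rewrite mul0r mulr0.
  by rewrite mulKf//; lra.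
rewrite /disc -real_normK ?num_real//.
by move: H2 (normr_ge0 (n%:R^-1 * \sum_(n <= t < n.*2) fluct s a t x)); nra.
Qed.

(** After expansion of the square only the n diagonal terms survive. Each is at most (3/2)^2 <= 3
    times the mean of F, and the prefactor is n^(-2). *)
Lemma mean_block_disc (R : realType) (s n D a : nat) (F : R -> R) : (2 <= s)%N ->
  (a <= 1)%N -> (0 < n)%N -> (D < (s ^ 2) ^ n)%N -> rtrig (deg_le D) F ->
  (forall x, 0 <= F x) ->
  mean (fun x => F x * block s n x * disc s n a x) <= 3 * mean F / n%:R.
Proof.
move=> s2 a1 n0 Dn HF F0.
have HFb := rtrigT_mul HF (rtrig_block R s n).
pose G t t' (x : R) := F x * block s n x * (fluct s a t x * fluct s a t' x).
have HG t t' : rtrig setT (G t t').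
  exact: rtrigT_mul HFb (rtrigT_mul (rtrigT_fluct R s a t) (rtrigT_fluct R s a t')).
rewrite (_ : (fun=> _) = fun x => n%:R ^- 2 *
    \sum_(t <- index_iota n n.*2) \sum_(t' <- index_iota n n.*2) G t t' x); last first.
  apply/funext => x; rewrite /disc exprMn [(\sum_(n <= t < n.*2) _) ^+ 2]expr2 big_distrlr/= exprVn mulrCA.
  congr (_ * _).
  by rewrite mulr_sumr; apply: eq_bigr => t _; rewrite mulr_sumr.
rewrite (@rmeanZ _ setT); last first.
  by apply: rtrig_bigsum => t _ _; apply: rtrig_bigsum => t' _ _; exact: HG.
rewrite (@rmean_sum _ setT); last by move=> t _; apply: rtrig_bigsum => t' _ _; exact: HG.
have nR : 0 < n%:R :> R by rewrite ltr0n.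
have meanF0 : 0 <= mean F by exact: rmean_ge0 HF F0.
have Hsum t : t \in index_iota n n.*2 ->
    mean (fun x => \sum_(t' <- index_iota n n.*2) G t t' x) <= 3 * mean F.
  move=> tn; rewrite (@rmean_sum _ setT); last by move=> t' _; exact: HG.
  rewrite (bigD1_seq t) ?iota_uniq//= big1_seq ?addr0; last first.
    move=> t' /andP[t't t'n]; apply: mean_fluct_orth HF _ _ _ => //.
    - by rewrite -mem_index_iota.
    - by rewrite -mem_index_iota.
    - by rewrite eq_sym.
  rewrite -(mean_mul_block s2 Dn HF) -(rmeanZ _ HFb).
  apply: ler_mean (HG t t) (rtrigZ _ HFb) _ => x.
  rewrite /G [leRHS]mulrC ler_wpM2l ?mulr_ge0 ?block_ge0//.
  have := fluct_le s a t x; rewrite ler_norml => /andP[]; nra.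
have Hs : \sum_(t <- index_iota n n.*2) mean (fun x => \sum_(t' <- index_iota n n.*2) G t t' x)
    <= n%:R * (3 * mean F).
  rewrite big_seq (le_trans (ler_sum _ Hsum))// -big_seq.
  by rewrite sumr_const_nat -[X in (X - _)%N]addnn addnK -[leLHS]mulr_natl.
rewrite (le_trans (ler_wpM2l _ Hs)) ?invr_ge0 ?exprn_ge0//.
by rewrite le_eqVlt; apply/orP; left; apply/eqP; field; rewrite lt0r_neq0.
Qed.

(** * Weyl averages and their weighted squares *)

Definition wavg (R : realType) (h b N : nat) (x : R) : R[i] :=
  N%:R^-1 * \sum_(i < N) ex (h%:Z * b%:Z ^+ i) x.

Definition wterm (R : realType) (h b N : nat) (x : R) : R :=
  N%:R^-1 * cabs (wavg h b N x) ^+ 2.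

Lemma wterm_ge0 (R : realType) (h b N : nat) (x : R) : 0 <= wterm h b N x.
Proof. by rewrite mulr_ge0 ?invr_ge0 ?sqr_ge0. Qed.

Lemma trig_wavg (R : realType) (h b N : nat) : trig setT (@wavg R h b N).
Proof. by apply: trigZ; apply: trig_bigsum => i _ _; exact: trig_exp. Qed.

Lemma rtrig_wterm (R : realType) (h b N : nat) : rtrig setT (@wterm R h b N).
Proof. by apply: rtrigZ; apply: rtrig_cabs2; exact: trig_wavg. Qed.

Lemma wtermE (R : realType) (h b N : nat) (x : R) :
  (wterm h b N x)%:C = (N%:R ^- 3)%:C *
    \sum_(q : 'I_N * 'I_N) ex (diff_pow h b q.1 q.2) x.
Proof.
rewrite /wterm rmorphM/= -mulcJ /wavg.
rewrite (rmorphM (@conjc R)) /= conjc_inv conjc_nat conjc_sum.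
rewrite (_ : (N%:R ^- 3)%:C = (N%:R^-1)%:C * (N%:R^-1 * N%:R^-1)); last first.
  by rewrite -exprVn !rmorphXn/= !fmorphV rmorph_nat/=; ring.
set A := \sum_(i < N) ex _ x; set A' := \sum_(i < N) _.
have <- : A * A' = \sum_(q : 'I_N * 'I_N) ex (diff_pow h b q.1 q.2) x.
  have -> : A' = \sum_(i < N) ex (- (h%:Z * b%:Z ^+ i)) x.
    by apply: eq_bigr => i _; rewrite conj_ex.
  rewrite /A big_distrlr/= pair_big/=; apply: eq_bigr => q _.
  by rewrite -exD /diff_pow; congr ex; ring.
by ring.
Qed.

(** Expanding the squared modulus reduces the mean to the Fourier coefficients of [Phi] at the
    differences h (b^i - b^j). In the exponent 3, the weight counts once and the square of the
    average twice. *)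
Lemma mean_wterm_le (R : realType) (Phi : R -> R) (h b N : nat) : rtrig setT Phi ->
  mean (fun x => Phi x * wterm h b N x) <= N%:R ^- 3 *
    \sum_(q : 'I_N * 'I_N) cabs (mean (fun x => (Phi x)%:C * ex (diff_pow h b q.1 q.2) x)).
Proof.
move=> HP; have HPe (q : 'I_N * 'I_N) :
    trig setT (fun x => (Phi x)%:C * ex (diff_pow h b q.1 q.2) x).
  by apply: (@trigM _ setT setT) => //; exact: trig_exp.
have Hw := rtrigT_mul HP (rtrig_wterm R h b N).
apply: le_trans (ler_norm _) _; rewrite -cabsR -(rmeanE Hw).
rewrite (_ : (fun=> _) = fun x => (N%:R ^- 3)%:C *
    \sum_(q <- index_enum ('I_N * 'I_N)%type)
       ((Phi x)%:C * ex (diff_pow h b q.1 q.2) x)); last first.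
  by apply/funext => x; rewrite rmorphM/= wtermE mulrCA mulr_sumr.
rewrite (@meanZ _ setT); last by apply: trig_bigsum => q _ _; exact: HPe.
rewrite (@mean_sum _ setT); last by move=> q _; exact: HPe.
rewrite cabsM cabsR ger0_norm ?invr_ge0 ?exprn_ge0//.
by rewrite ler_wpM2l ?invr_ge0 ?exprn_ge0//; exact: cabs_sum.
Qed.

Definition near_pairs (s n D h b N : nat) : {set 'I_N * 'I_N} :=
  [set q : 'I_N * 'I_N | `[< near_block (s ^ 2) n D (diff_pow h b q.1 q.2) >]]%SET.

(** Differences within reach of the spectrum of a density of degree D, where its coefficients need
    not be small. *)
Definition low_pairs (D h b N : nat) : {set 'I_N * 'I_N} :=
  [set q : 'I_N * 'I_N | (`|diff_pow h b q.1 q.2| <= D)%N]%SET.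

(** For i < j, h b^i (b^(j-i) - 1) is at least (i+1)(j-i) >= j. *)
Lemma low_pairs_range (D h b i j : nat) : (0 < h)%N -> (2 <= b)%N -> (i < j)%N ->
  (`|diff_pow h b i j|%N <= D)%N -> (j <= D)%N.
Proof.
move=> h0 b2 ij; rewrite abs_diff_pow ?(ltnW ij) ?(ltnW b2)// => HD.
apply: leq_trans HD; rewrite (@leq_trans (b ^ i * (b ^ (j - i) - 1)))//; last exact: leq_pmull.
have Ej : (j = (j - i).-1 + i.+1)%N by lia.
have bi : (i.+1 <= b ^ i)%N by exact: ltn_expl.
rewrite {1}Ej; have -> : (j - i = (j - i).-1.+1)%N by lia.
rewrite /= expnS; have : ((j - i).-1.+1 <= b ^ (j - i).-1)%N by exact: ltn_expl.
move: b2 bi; move: (b ^ i)%N (b ^ (j - i).-1)%N ((j - i).-1) => X Y d; clear; nia.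
Qed.

Lemma card_low_pairs (D h b N : nat) : (0 < h)%N -> (2 <= b)%N ->
  (#|low_pairs D h b N| <= N + D.+1 ^ 2)%N.
Proof.
move=> h0 b2; pose Rel (q : 'I_N * 'I_N) (u : 'I_N + 'I_D.+1 * 'I_D.+1) :=
  match u with inl i => q = (i, i) | inr v => (val q.1, val q.2) = (val v.1, val v.2) end.
have := @card_coding _ _ (low_pairs D h b N) Rel.
rewrite card_sum card_prod !card_ord mulnn; apply.
  move=> [i j]; rewrite inE /= => Hij; have [<-|ij] := eqVneq i j; first by exists (inl i).
  have [iD jD] : (i < D.+1)%N /\ (j < D.+1)%N.
    have {}ij : (i != j :> nat) by [].
    have [ij'|ji|E] := ltngtP i j; last by rewrite E eqxx in ij.
    - by have := low_pairs_range h0 b2 ij' Hij; lia.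
    - by have := @low_pairs_range D h b j i h0 b2 ji; rewrite diff_powN abszN => /(_ Hij); lia.
  by exists (inr (Ordinal iD, Ordinal jD)).
move=> [i j] [i' j'] [u|v] _ _ /=; first by move=> -> ->.
move=> [Hi Hj] [Hi' Hj']; congr (_, _); apply: val_inj => /=; congruence.
Qed.

(** Telescoping: 1/a^2 <= 2/a - 2/(a+1) for a >= 1. *)
Lemma sum_inv_sq (R : realType) (M M' : nat) :
  \sum_(M <= N < M') (N.+1%:R ^- 2 : R) <= 2 / M.+1%:R.
Proof.
have [M'M|MM'] := leqP M' M; first by rewrite big_geq.
suff : \sum_(M <= N < M') (N.+1%:R ^- 2 : R) <= 2 / M.+1%:R - 2 / M'.+1%:R.
  move=> H; apply: le_trans H _; rewrite lerBlDr lerDl; exact: divr_ge0.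
elim: M' MM' => // M' IH; rewrite ltnS leq_eqVlt => /orP[/eqP MM'|MM'].
  rewrite -MM' big_nat1 -[M.+2%:R]natr1; set a := M.+1%:R.
  have a0 : 1 <= a :> R by rewrite ler1n.
  rewrite -subr_ge0 (_ : _ - _ = (a - 1) / (a ^+ 2 * (a + 1))); last by field; lra.
  by rewrite divr_ge0 ?mulr_ge0 ?sqr_ge0; lra.
rewrite big_nat_recr ?(ltnW MM')//= (le_trans (lerD (IH MM') (lexx _)))//.
rewrite -[M'.+2%:R]natr1; set a := M'.+1%:R.
have a0 : 1 <= a :> R by rewrite ler1n.
have : 1 <= M.+1%:R :> R by rewrite ler1n.
move: (M.+1%:R : R) => c c0.
rewrite -subr_ge0 (_ : _ - _ = (a - 1) / (a ^+ 2 * (a + 1))).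
  by rewrite divr_ge0 ?mulr_ge0 ?sqr_ge0; lra.
by field; apply/and3P; split; lra.
Qed.

Lemma low_tail (R : realType) (D h b : nat) (eps : R) : (0 < h)%N -> (2 <= b)%N -> 0 < eps ->
  exists R0 : nat, forall r r', (R0 <= r)%N ->
    \sum_(r <= N < r') (N.+1%:R ^- 3 * #|low_pairs D h b N.+1|%:R) <= eps.
Proof.
move=> h0 b2 e0; pose C := (1 + D.+1 ^ 2)%N.
have [R0 HR0] : exists R0 : nat, 2 * C%:R / eps < R0%:R :> R.
  by exists (Num.bound (2 * C%:R / eps)); apply: archi_boundP; rewrite divr_ge0// ltW.
exists R0 => r r' rR0; apply: (@le_trans _ _ (C%:R * (2 / r.+1%:R))).
  apply: le_trans (ler_wpM2l _ (sum_inv_sq R r r')) => //; rewrite mulr_sumr.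
  apply: ler_sum => N _; have N0 : 0 < N.+1%:R :> R by rewrite ltr0n.
  rewrite (_ : C%:R * _ = N.+1%:R ^- 3 * (C%:R * N.+1%:R)); last by field; rewrite gt_eqF.
  rewrite ler_wpM2l ?invr_ge0 ?exprn_ge0// -natrM ler_nat.
  by apply: leq_trans (card_low_pairs _ _ h0 b2) _; rewrite /C; nia.
rewrite mulrA ler_pdivrMr ?ltr0n//; rewrite ltr_pdivrMr// in HR0.
rewrite mulrC (le_trans (ltW HR0))// mulrC ler_wpM2l ?(ltW e0)// ler_nat.
exact: leqW.
Qed.

(** Pairs near the block at scale n have an index of order n, so lengths below about n / (2b)
    contribute nothing. Beyond that there are at most n^2 / k pairs for each length, and the tail of
    the sum of N^(-3) is O(n^(-2)). The total is O(1/k), uniformly in n. *)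
Lemma near_tail (R : realType) (s D h b : nat) (eps : R) : (0 < h)%N -> (2 <= b)%N ->
  (2 <= s)%N -> (forall m n, (0 < m)%N -> (0 < n)%N -> (b ^ m)%N <> (s ^ n)%N) ->
  0 < eps ->
  exists n0 : nat, forall n, (n0 <= n)%N -> forall r r',
    \sum_(r <= N < r') (N.+1%:R ^- 3 * #|near_pairs s n D h b N.+1|%:R) <= eps.
Proof.
move=> h0 b2 s2 indep e0.
(* The total will be 8 b^2 / k: the square of 2 b from the range of the indices, and 2 from
   [sum_inv_sq]. *)
have [k Hk] : exists k : nat, 8 * b%:R ^+ 2 / eps < k%:R :> R.
  exists (Num.bound (8 * b%:R ^+ 2 / eps)); apply: archi_boundP.
  by rewrite divr_ge0 ?mulr_ge0 ?exprn_ge0// ltW.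
have k0 : (0 < k)%N.
  rewrite -(ltr0n R); apply: le_lt_trans Hk.
  by rewrite divr_ge0 ?mulr_ge0 ?exprn_ge0// ltW.
have [n0 Hn0] := sparse_block D b2 s2 h0 k0 indep.
exists (maxn n0 (maxn (maxn D (2 * h)) 1)) => n.
rewrite !geq_max => /andP[/Hn0 Hn /andP[/andP[Dn hn] n1]] r r'.
pose M := (n %/ (2 * b))%N.
have nR : 0 < n%:R :> R by rewrite ltr0n.
have kR : 0 < k%:R :> R by rewrite ltr0n.
have Hterm N : N.+1%:R ^- 3 * #|near_pairs s n D h b N.+1|%:R <=
    if (M <= N)%N then (n%:R ^+ 2 / k%:R / M.+1%:R) * N.+1%:R ^- 2 else 0 :> R.
  have N0 : 0 < N.+1%:R :> R by rewrite ltr0n.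
  have M0 : 0 < M.+1%:R :> R by rewrite ltr0n.
  case: leqP => MN.
    have Hc : #|near_pairs s n D h b N.+1|%:R <= n%:R ^+ 2 / k%:R :> R.
      rewrite ler_pdivlMr// mulrC -natrM -natrX ler_nat; apply: Hn => q.
      by rewrite inE => /asboolP.
    apply: le_trans (ler_wpM2l _ Hc) _; first by rewrite invr_ge0 exprn_ge0.
    rewrite (_ : N.+1%:R ^- 3 * _ = (n%:R ^+ 2 / k%:R * N.+1%:R ^- 2) * N.+1%:R^-1); last first.
      by field; rewrite !gt_eqF.
    rewrite (_ : _ / M.+1%:R * _ = (n%:R ^+ 2 / k%:R * N.+1%:R ^- 2) * M.+1%:R^-1); last first.
      by field; rewrite !gt_eqF.
    rewrite ler_wpM2l ?mulr_ge0 ?invr_ge0 ?exprn_ge0//.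
    by rewrite lef_pV2 ?posrE// ler_nat ltnS.
  rewrite (_ : #|_| = 0%N) ?mulr0//; apply/eqP; rewrite cards_eq0; apply/eqP/setP => q.
  rewrite !inE; apply/negP => /asboolP H.
  have [_ nmax _] := near_block_range b2 s2 h0 n1 Dn hn H.
  have qN : (maxn q.1 q.2 <= N)%N by rewrite geq_max; apply/andP; split; rewrite -ltnS ltn_ord.
  move: MN; rewrite ltnNge => /negP; apply.
  have nN : (n <= 2 * b * N)%N by apply: leq_trans nmax _; rewrite leq_mul2l qN orbT.
  by rewrite /M (leq_trans (leq_div2r (2 * b) nN))// mulKn// muln_gt0 (ltnW b2).
apply: le_trans (ler_sum _ (fun N _ => Hterm N)) _.
rewrite -big_mkcond/=.
have HS : \sum_(r <= N < r' | (M <= N)%N) (n%:R ^+ 2 / k%:R / M.+1%:R * N.+1%:R ^- 2) <=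
    n%:R ^+ 2 / k%:R / M.+1%:R * (2 / M.+1%:R) :> R.
  rewrite -mulr_sumr ler_wpM2l ?mulr_ge0 ?invr_ge0 ?exprn_ge0//.
  apply: le_trans (sum_inv_sq R M (maxn M r')).
  have pos N : 0 <= N.+1%:R ^- 2 :> R by rewrite invr_ge0 exprn_ge0.
  rewrite big_nat_cond [leRHS]big_nat_cond.
  have -> : \sum_(M <= i < maxn M r' | (M <= i < maxn M r')%N && true) (i.+1%:R ^- 2 : R) =
    \sum_(0 <= i < maxn M r' | (M <= i)%N) (i.+1%:R ^- 2 : R).
    rewrite [in RHS](big_cat_nat (leq0n M) (leq_maxl M r'))/= [X in X + _]big1_seq ?add0r.
      by rewrite big_nat_cond [RHS]big_nat_cond; apply: eq_bigl => i; rewrite andbT; lia.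
    by move=> i; rewrite mem_index_iota; lia.
  have -> : \sum_(r <= i < r' | (r <= i < r')%N && (M <= i)%N) (i.+1%:R ^- 2 : R) =
    \sum_(0 <= i < r' | (r <= i)%N && (M <= i)%N) (i.+1%:R ^- 2 : R).
    have [rr'|rr'] := leqP r r'; last first.
      rewrite big_geq 1?ltnW// big1_seq// => i; rewrite mem_index_iota; lia.
    rewrite [in RHS](big_cat_nat (leq0n r) rr')/= [X in X + _]big1_seq ?add0r.
      by rewrite big_nat_cond [RHS]big_nat_cond; apply: eq_bigl => i; lia.
    by move=> i; rewrite mem_index_iota; lia.
  rewrite (big_cat_nat (leq0n r') (leq_maxr M r'))/=.
  rewrite -[leLHS]addr0 lerD//; last by apply: sumr_ge0.
  rewrite [leLHS]big_mkcond [leRHS]big_mkcond; apply: ler_sum => i _.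
  by case: leqP => _ //=; case: ifP => // _.
apply: le_trans HS _.
have HM : n%:R <= 2 * b%:R * M.+1%:R :> R.
  have b0 : (0 < 2 * b)%N by rewrite muln_gt0 (ltnW b2).
  rewrite -!natrM ler_nat; apply: ltnW.
  by rewrite [X in (_ < X)%N]mulnC -(ltn_divLR _ _ b0) ltnS.
have M0 : 0 < M.+1%:R :> R by rewrite ltr0n.
rewrite ltr_pdivrMr// in Hk.
rewrite (_ : _ * _ = (n%:R ^+ 2 * 2) / (k%:R * M.+1%:R ^+ 2)); last by field; rewrite !gt_eqF.
rewrite ler_pdivrMr ?mulr_gt0 ?exprn_gt0//.
have HM2 : n%:R ^+ 2 <= (2 * b%:R * M.+1%:R) ^+ 2 :> R by rewrite lerXn2r// nnegrE ?mulr_ge0// ltW.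
have H3 : 8 * b%:R ^+ 2 * M.+1%:R ^+ 2 <= eps * (k%:R * M.+1%:R ^+ 2) :> R.
  by rewrite mulrA ler_wpM2r ?exprn_ge0// [leRHS]mulrC ltW.
rewrite !exprMn in HM2; move: HM2 H3; set a := M.+1%:R ^+ 2; set c := b%:R ^+ 2; lra.
Qed.

(** * Stages of the construction *)

(** The factor 40 serves the end of the proof: limit coefficients lie within 20 [tol] of those at a
    stage, and 20 / 40 < 1 keeps the coefficient at 0 nonzero. *)
Definition tol (R : realType) (k : nat) : R := (40 * 2 ^+ k)^-1.

Lemma tol_gt0 (R : realType) k : 0 < tol R k.
Proof. by rewrite invr_gt0 mulr_gt0// exprn_gt0. Qed.

Lemma tolS (R : realType) k : tol R k.+1 = tol R k / 2.
Proof. by rewrite /tol exprSr -invfM mulrA. Qed.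

Lemma tol_le (R : realType) k : tol R k <= 1 / 40.
Proof.
elim: k => [|k IH]; first by rewrite /tol expr0 mulr1 div1r.
by rewrite tolS; have := tol_gt0 R k; lra.
Qed.

(* The q-th pair (h, b): a frequency h and a base b in which the numbers of
   the limit set have to be normal. *)
Definition pair_of (q : nat) : nat * nat := odflt (0, 0)%N (unpickle q).

Definition tested (B : set nat) (q : nat) : bool :=
  (0 < (pair_of q).1)%N && `[< B (pair_of q).2 >].

Definition wsum (R : realType) (B : set nat) (k r r' : nat) (x : R) : R :=
  \sum_(0 <= q < k | tested B q) \sum_(r <= N < r') wterm (pair_of q).1 (pair_of q).2 N.+1 x.

(** Bounds the mean of [wsum] under a density of degree D and mean 1, whose coefficients are at most
    1 and vanish beyond D. *)
Definition low_sum (R : realType) (B : set nat) (k D r r' : nat) : R :=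
  \sum_(0 <= q < k | tested B q) \sum_(r <= N < r')
    (N.+1%:R ^- 3 * #|low_pairs D (pair_of q).1 (pair_of q).2 N.+1|%:R).

Lemma wsum_ge0 (R : realType) B k r r' (x : R) : 0 <= wsum B k r r' x.
Proof. by apply: sumr_ge0 => q _; apply: sumr_ge0 => N _; exact: wterm_ge0. Qed.

Lemma rtrig_wsum (R : realType) B k r r' : rtrig setT (@wsum R B k r r').
Proof.
apply: rtrig_bigsum => q _ _; apply: rtrig_bigsum => N _ _; exact: rtrig_wterm.
Qed.

Lemma low_sum_tail (R : realType) (B : set nat) k D (e : R) :
  (forall b, B b -> (2 <= b)%N) -> 0 < e ->
  exists R0 : nat, forall r r', (R0 <= r)%N -> low_sum R B k D r r' <= e.
Proof.
move=> B2; elim: k e => [|k IH] e e0.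
  by exists 0%N => r r' _; rewrite /low_sum big_geq// ltW.
have e2 : 0 < e / 2 by rewrite divr_gt0.
have [R1 HR1] := IH _ e2.
have [tk|tk] := boolP (tested B k); last first.
  exists R1 => r r' /HR1 H; rewrite /low_sum big_mkcond/= big_nat_recr//= (negbTE tk) addr0.
  by rewrite -big_mkcond; apply: le_trans (H r') _; lra.
have /andP[h0 /asboolP /B2 b2] := tk.
have [R2 HR2] := low_tail D h0 b2 e2.
exists (maxn R1 R2) => r r'; rewrite geq_max => /andP[/HR1 H1 /HR2 H2].
rewrite /low_sum big_mkcond/= big_nat_recr//= tk -big_mkcond/=.
by have := lerD (H1 r') (H2 r'); rewrite -splitr.
Qed.

(* test is the partial sum T_k, dens the density before the restriction to
   {T <= 1}, and cutdens a polynomial approximation of dens * max(0, 1 - T_k);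
   test accounts for the averages of length at most horizon. *)
Record state (R : realType) := State {
  dens : R -> R;
  test : R -> R;
  cutdens : R -> R;
  dens_deg : nat;
  degr : nat;
  horizon : nat
}.

(** The error in [cutdensP] is relative to [dens], so it integrates to at most [tol R k]. The field
    [low_sumP] looks ahead to the next transition, which tests k+1 pairs beyond the current
    horizon. *)
Record admissible (R : realType) (B : set nat) (k : nat) (st : state R) : Prop := Admissible {
  dens_ge0 : forall x, 0 <= dens st x;
  rtrig_dens : rtrig (deg_le (dens_deg st)) (dens st);
  mean_dens : mean (dens st) = 1;
  test_ge0 : forall x, 0 <= test st x;
  rtrig_test : rtrig setT (test st);
  rtrig_cutdens : rtrig (deg_le (degr st)) (cutdens st);
  cutdensP : forall x, `|cutdens st x - dens st x * cutoff (test st x)| <= tol R k * dens st x;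
  low_sumP : forall r', low_sum R B k.+1 (dens_deg st) (horizon st) r' <= tol R k }.

(** The sign of the exponent is opposite to that in [trig_sum], so that [trig_sum (coef f)] is the
    Fourier series of f. *)
Definition coef (R : realType) (f : R -> R) (xi : int) : R[i] :=
  mean (fun x => (f x)%:C * ex xi x).

(** The bound [coef_low] is summable and makes the coefficients converge; [coef_all] is charged once
    for each frequency, at the stage where it first comes within the degree. *)
Record transition (R : realType) (B B' : set nat) (s k : nat) (st st' : state R) : Prop :=
  Transition {
  degr_lt : (degr st < degr st')%N;
  horizon_lt : (horizon st < horizon st')%N;
  coef_low : forall xi, (`|xi| <= degr st)%N ->
    cabs (coef (cutdens st') xi - coef (cutdens st) xi) <= 5 * tol R k;
  coef_all : forall xi,
    cabs (coef (cutdens st') xi - coef (cutdens st) xi) <= 4 / k.+1%:R + 5 * tol R k;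
  test_mono : forall x,
    test st x + wsum B k.+1 (horizon st) (horizon st') x <= test st' x;
  test_bias : B' s -> forall x, test st' x <= 1 -> exists n, [/\ (k < n)%N,
    disc s n 0 x <= 64^-1 & disc s n 1 x <= 64^-1] }.

Lemma deg_leS D D' : (D <= D')%N -> deg_le D `<=` deg_le D'.
Proof. by move=> DD' k /= kD; exact: leq_trans DD'. Qed.

Lemma rtrig_deg (R : realType) (S : set int) (F : R -> R) : rtrig S F ->
  exists D0, forall D, (D0 <= D)%N -> rtrig (deg_le D) F.
Proof.
by move=> /trig_deg[D0 H]; exists D0 => D D0D; apply: trigS H; exact: deg_leS.
Qed.

Lemma cutdens_le (R : realType) B k (st : state R) x : admissible B k st ->
  `|cutdens st x| <= 2 * dens st x.
Proof.
move=> I; have H := cutdensP I x; have F0 := dens_ge0 I x.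
have c0 := cutoff_ge0 (test st x); have c1 := cutoff_le1 (test_ge0 I x).
have t0 := tol_gt0 R k; have t1 := tol_le R k.
have := ler_normD (cutdens st x - dens st x * cutoff (test st x))
  (dens st x * cutoff (test st x)).
rewrite subrK (ger0_norm (mulr_ge0 F0 c0)); nra.
Qed.

Lemma trig_mul_ex (R : realType) (S : set int) (g : R -> R[i]) xi : trig S g ->
  trig setT (fun x => g x * ex xi x).
Proof. by move=> Hg; apply: (@trigM _ S setT) Hg (@trig_exp R setT xi I). Qed.

(** One stage with an abstract multiplier G, which covers both the Riesz products and the stages
    without bias. The new test adds to the old one the next Weyl terms and [Phi]. *)
Lemma transition_of_density (R : realType) (B B' : set nat) (s k : nat) (st : state R)
    (G Phi : R -> R) :
  (forall b, B b -> (2 <= b)%N) -> admissible B k st ->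
  (forall x, 0 <= G x) -> rtrig setT G -> (forall x, 0 <= Phi x) -> rtrig setT Phi ->
  mean (fun x => dens st x * G x) = 1 ->
  (forall xi, (`|xi| <= degr st)%N ->
    mean (fun x => (cutdens st x * (G x - 1))%:C * ex xi x) = 0) ->
  (forall xi, cabs (mean (fun x => (cutdens st x * (G x - 1))%:C * ex xi x)) <= 4 / k.+1%:R) ->
  (forall r', mean (fun x => dens st x * G x * wsum B k.+1 (horizon st) r' x) <= 2 * tol R k) ->
  mean (fun x => dens st x * G x * Phi x) <= tol R k ->
  (B' s -> forall x, Phi x <= 1 -> exists n, [/\ (k < n)%N,
    disc s n 0 x <= 64^-1 & disc s n 1 x <= 64^-1]) ->
  exists2 st', admissible B k.+1 st' & transition B B' s k st st'.
Proof.
move=> B2 I G0 tG P0 tP mFG Hlow Hall Hw HPhi Hbias.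
pose F' x := dens st x * G x.
have tF : rtrig setT (dens st) := rtrigT (rtrig_dens I).
have tf : rtrig setT (cutdens st) := rtrigT (rtrig_cutdens I).
have tF' : rtrig setT F' := rtrigT_mul tF tG.
have F'0 x : 0 <= F' x by rewrite mulr_ge0// (dens_ge0 I).
have tW r' := rtrig_wsum R B k.+1 (horizon st) r'.
pose T' r' x := test st x + (wsum B k.+1 (horizon st) r' x + Phi x).
have tT' r' : rtrig setT (T' r').
  by apply: rtrigD (rtrig_test I) _; apply: rtrigD.
have e1 := tol_gt0 R k.+1.
have [D1 HD1] := rtrig_deg tF'; have HF' := HD1 D1 (leqnn _).
(* The density is fixed before the horizon: its degree D1 decides how far the horizon must go for
   the low pairs of the next stage to be negligible. *)
have [r0 Hr0] := low_sum_tail k.+2 D1 B2 e1.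
pose r' := maxn (horizon st).+1 r0.
have [p tp Hp] := rtrig_cutoff_approx (tT' r') e1.
have [D2 HD2] := rtrig_deg (rtrigT_mul tF' tp).
pose D' := maxn (degr st).+1 D2.
pose st' := State F' (T' r') (fun x => F' x * p x) D1 D' r'.
have T0 x : test st x <= T' r' x.
  by rewrite /T' lerDl addr_ge0// wsum_ge0.
exists st'; first split => //=.
- by move=> x; apply: le_trans (test_ge0 I x) (T0 x).
- by apply: HD2; rewrite leq_maxr.
- move=> x; rewrite -mulrBr normrM (ger0_norm (F'0 x)) mulrC.
  by rewrite ler_wpM2r.
- by move=> r''; apply: Hr0; rewrite leq_maxr.
(* The errors are the new approximation of the cutoff, its change by at most the added tests, and
   the old approximation error. Their means add up to at most 1/2 + 2 + 1 + 1 times [tol R k]. *)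
pose E x := tol R k.+1 * F' x + (F' x * wsum B k.+1 (horizon st) r' x +
  (F' x * Phi x + tol R k * F' x)).
have tE2 : rtrig setT (fun x => F' x * Phi x + tol R k * F' x).
  by apply: rtrigD; [exact: rtrigT_mul tF' tP|exact: rtrigZ].
have tE1 : rtrig setT (fun x => F' x * wsum B k.+1 (horizon st) r' x +
    (F' x * Phi x + tol R k * F' x)).
  by apply: rtrigD tE2; exact: rtrigT_mul tF' (tW r').
have tE : rtrig setT E by apply: rtrigD tE1; exact: rtrigZ.
have mE : mean E <= 5 * tol R k.
  rewrite (rmeanD (rtrigZ _ tF') tE1) (rmeanD (rtrigT_mul tF' (tW r')) tE2).
  rewrite (rmeanD (rtrigT_mul tF' tP) (rtrigZ _ tF')) !(rmeanZ _ tF') mFG tolS.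
  by have := Hw r'; have := tol_gt0 R k; move: HPhi; rewrite /F'; lra.
pose d x := F' x * p x - cutdens st x * G x.
have td : rtrig setT d by exact: rtrigB (rtrigT_mul tF' tp) (rtrigT_mul tf tG).
have dE x : `|d x| <= E x.
  have H1 := cutdensP I x; have H2 := Hp x.
  have H3 := cutoff_lip (T' r' x) (test st x).
  have -> : d x = F' x * (p x - cutoff (T' r' x)) +
     (F' x * (cutoff (T' r' x) - cutoff (test st x)) -
      G x * (cutdens st x - dens st x * cutoff (test st x))).
    by rewrite /d /F'; ring.
  have HT : `|T' r' x - test st x| = wsum B k.+1 (horizon st) r' x + Phi x.
    by rewrite ger0_norm ?subr_ge0// /T'; ring.
  rewrite HT in H3.
  have N1 : `|F' x * (p x - cutoff (T' r' x))| <= F' x * tol R k.+1.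
    by rewrite normrM (ger0_norm (F'0 x)) ler_wpM2l.
  have N2 : `|F' x * (cutoff (T' r' x) - cutoff (test st x))| <=
      F' x * (wsum B k.+1 (horizon st) r' x + Phi x).
    by rewrite normrM (ger0_norm (F'0 x)) ler_wpM2l.
  have N3 : `|G x * (cutdens st x - dens st x * cutoff (test st x))| <= tol R k * F' x.
    rewrite normrM (ger0_norm (G0 x)) (le_trans (ler_wpM2l (G0 x) H1))//.
    by rewrite /F' mulrC -mulrA.
  apply: le_trans (ler_normD _ _) _; rewrite /E [tol R k.+1 * _]mulrC; apply: lerD => //.
  apply: le_trans (ler_normB _ _) _; move: N2 N3; lra.
have Hdiff xi : coef (fun x => F' x * p x) xi - coef (cutdens st) xi =
    mean (fun x => (cutdens st x * (G x - 1))%:C * ex xi x) +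
    mean (fun x => (d x)%:C * ex xi x).
  have tfG : rtrig setT (fun x => cutdens st x * (G x - 1)).
    have tG1 : rtrig setT (fun x => G x - 1) by apply: rtrigB tG _; exact: rtrig_cst.
    exact: rtrigT_mul tf tG1.
  rewrite -(meanD (trig_mul_ex xi tfG) (trig_mul_ex xi td)).
  rewrite -(meanB (trig_mul_ex xi (rtrigT_mul tF' tp)) (trig_mul_ex xi tf)).
  congr mean; apply/funext => x; rewrite /d !(rmorphB, rmorphM)/=; ring.
have Hd xi : cabs (mean (fun x => (d x)%:C * ex xi x)) <= 5 * tol R k.
  apply: le_trans mE; apply: cabs_mean (trig_mul_ex xi td) tE _ => x.
  by rewrite cabsM cabs_ex mulr1 cabsR.
split => //=.
- by rewrite leq_maxl.
- by rewrite leq_maxl.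
- by move=> xi xiD; rewrite Hdiff Hlow// add0r.
- move=> xi; rewrite Hdiff; apply: le_trans (cabsD _ _) _; exact: lerD.
- by move=> x; rewrite /T' addrA lerDl.
- move=> Bs x; rewrite /T' => Tx; apply: Hbias => //; apply: le_trans Tx.
  by rewrite addrA lerDr addr_ge0 ?wsum_ge0// (test_ge0 I).
Qed.

Lemma mean_wsum_le (R : realType) (B : set nat) k r r' (Phi : R -> R) : rtrig setT Phi ->
  mean (fun x => Phi x * wsum B k r r' x) <=
  \sum_(0 <= q < k | tested B q) \sum_(r <= N < r') N.+1%:R ^- 3 *
    \sum_(p : 'I_N.+1 * 'I_N.+1)
      cabs (coef Phi (diff_pow (pair_of q).1 (pair_of q).2 p.1 p.2)).
Proof.
move=> tP; have tw h b N := rtrigT_mul tP (rtrig_wterm R h b N).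
pose S q (x : R) := \sum_(r <= N < r')
  Phi x * wterm (pair_of q).1 (pair_of q).2 N.+1 x.
rewrite (_ : (fun=> _) = fun x => \sum_(q <- [seq q <- index_iota 0 k | tested B q]) S q x).
  rewrite (@rmean_sum _ setT); last by move=> q _; apply: rtrig_bigsum => N _ _; exact: tw.
  rewrite big_filter; apply: ler_sum => q _.
  rewrite (@rmean_sum _ setT); last by move=> N _; exact: tw.
  apply: ler_sum => N _; exact: mean_wterm_le.
apply/funext => x; rewrite /wsum mulr_sumr big_filter; apply: eq_bigr => q _.
by rewrite mulr_sumr.
Qed.

Lemma coef_le (R : realType) (f F : R -> R) xi : rtrig setT f -> rtrig setT F ->
  (forall x, `|f x| <= F x) -> cabs (coef f xi) <= mean F.
Proof.
move=> tf tF fF; apply: cabs_mean (trig_mul_ex xi tf) tF _ => x.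
by rewrite cabsM cabs_ex mulr1 cabsR.
Qed.

Lemma coef_deg0 (R : realType) (f : R -> R) D xi : rtrig (deg_le D) f -> (D < `|xi|)%N ->
  coef f xi = 0.
Proof.
move=> tf Dxi; apply: (@mean_trig0 _ [set z | `|z - xi| <= D]%N).
  apply: (trigM _ tf (@trig_exp R [set xi] xi erefl)) => a b Ha ->.
  by rewrite /= addrK.
by rewrite /= sub0r abszN leqNgt Dxi.
Qed.

Lemma coef_dens_le (R : realType) (F : R -> R) D xi : rtrig (deg_le D) F ->
  (forall x, 0 <= F x) -> mean F = 1 -> cabs (coef F xi) <= (`|xi| <= D)%N%:R.
Proof.
move=> tF F0 F1; have [xiD|xiD] := leqP `|xi|%N D; last by rewrite (coef_deg0 tF xiD) cabs0.
rewrite -F1; apply: coef_le (rtrigT tF) (rtrigT tF) _ => x.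
by rewrite ger0_norm.
Qed.

(** Off the near block the coefficient vanishes. On it the bound is the mean of C F (block + 1),
    which is 2 C because the block does not change the mean of F. *)
Lemma coef_block_le (R : realType) (f F : R -> R) (s n D DF : nat) (C : R) xi : (2 <= s)%N ->
  (DF < (s ^ 2) ^ n)%N -> rtrig (deg_le D) f -> rtrig (deg_le DF) F ->
  (forall x, `|f x| <= C * F x) -> (forall x, 0 <= F x) -> mean F = 1 -> 0 <= C ->
  cabs (coef (fun x => f x * (block s n x - 1)) xi) <=
    2 * C * (`[< near_block (s ^ 2) n D xi >])%:R.
Proof.
move=> s2 Dn tf tF fF F0 F1 C0.
rewrite /coef (_ : (fun=> _) = fun x => (f x)%:C * (block s n x - 1)%:C * ex xi x); last first.
  by apply/funext => x; rewrite rmorphM.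
have [nb|nb] := asboolP (near_block (s ^ 2) n D xi); last first.
  by rewrite (mean_blockB1 tf nb) cabs0 mulr0.
have tb := rtrig_block R s n.
have tFT := rtrigT tF.
have tFb := rtrigT_mul tFT tb.
have tE : rtrig setT (fun x => C * (F x * block s n x + F x)).
  by apply: rtrigZ; apply: rtrigD.
rewrite mulr1; have -> : 2 * C = mean (fun x => C * (F x * block s n x + F x)).
  rewrite (@rmeanZ _ setT); last exact: rtrigD.
  by rewrite (rmeanD tFb tFT) (mean_mul_block s2 Dn tF) F1; ring.
have tb1 : rtrig setT (fun x : R => block s n x - 1) by apply: rtrigB tb _; exact: rtrig_cst.
have tfb := rtrigT_mul (rtrigT tf) tb1.
have := coef_le xi tfb tE; rewrite /coef; under [X in mean X]funext do rewrite rmorphM.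
apply => x; rewrite normrM (_ : C * _ = (C * F x) * (block s n x + 1)); last by ring.
apply: ler_pM => //; rewrite (le_trans (ler_normB _ _))// normr1.
by rewrite ger0_norm ?block_ge0.
Qed.

Lemma near_tail_tested (R : realType) (B : set nat) (s D k : nat) (e : R) : (2 <= s)%N ->
  (forall b, B b -> (2 <= b)%N) ->
  (forall b, B b -> forall m n, (0 < m)%N -> (0 < n)%N -> (b ^ m)%N <> (s ^ n)%N) ->
  0 < e -> exists n0 : nat, forall n, (n0 <= n)%N -> forall q r r', (q < k)%N -> tested B q ->
    \sum_(r <= N < r') (N.+1%:R ^- 3 *
      #|near_pairs s n D (pair_of q).1 (pair_of q).2 N.+1|%:R) <= e.
Proof.
move=> s2 B2 indep e0; elim: k => [|k [n1 Hn1]]; first by exists 0%N.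
have [tk|tk] := boolP (tested B k); last first.
  exists n1 => n nn1 q r r'; rewrite ltnS leq_eqVlt => /orP[/eqP ->|]; first by rewrite (negbTE tk).
  exact: Hn1.
have /andP[h0 /asboolP Bb] := tk.
have [n2 Hn2] := near_tail D h0 (B2 _ Bb) s2 (indep _ Bb) e0.
exists (maxn n1 n2) => n; rewrite geq_max => /andP[nn1 nn2] q r r'.
rewrite ltnS leq_eqVlt => /orP[/eqP -> _|]; first exact: Hn2.
exact: Hn1.
Qed.

Lemma sum_pairs_bool (R : realType) (N : nat) (P : pred ('I_N * 'I_N)) :
  \sum_(p : 'I_N * 'I_N) (P p)%:R = #|[set p | P p]%SET|%:R :> R.
Proof.
rewrite -sum1_card natr_sum [RHS]big_mkcond/=; apply: eq_bigr => p _.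
by rewrite inE; case: (P p).
Qed.

Lemma exists_le1_of_prod (R : realType) (J : nat) (a : nat -> R) :
  \prod_(0 <= i < J.+1) a i <= 1 -> exists2 i, (i < J.+1)%N & a i <= 1.
Proof.
move=> H; apply/not_exists2P => Hn; have {}Hn i : (i < J.+1)%N -> 1 < a i.
  by move=> iJ; have [//|/negP] := Hn i; rewrite -ltNge.
have : 1 < \prod_(0 <= i < J.+1) a i; last by rewrite ltNge H.
elim: J Hn {H} => [|J IH] Hn; first by rewrite big_nat1 Hn.
rewrite big_nat_recr//= -[ltLHS]mulr1 ltr_pM// ?Hn//.
by apply: IH => i iJ; apply: Hn; rewrite ltnW.
Qed.

Lemma prod_le_factor (R : realType) (J i : nat) (a : nat -> R) (M : R) : 1 <= M ->
  (i < J)%N -> (forall j, 0 <= a j <= M) -> \prod_(0 <= j < J) a j <= M ^+ J * a i.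
Proof.
move=> M1 iJ Ha; rewrite (bigD1_seq i) ?iota_uniq ?mem_index_iota//= mulrC.
have /andP[ai0 _] := Ha i; rewrite ler_wpM2r//.
rewrite big_mkcond/= -[X in M ^+ X](subn0 J) -prodr_const_nat.
apply: ler_prod => j _; case: ifP => _; first exact: Ha.
by rewrite ler01.
Qed.

Lemma sum_bool_le1 (R : realType) (J : nat) (b : nat -> bool) :
  (forall i j, (i < j)%N -> b i -> b j -> False) ->
  \sum_(0 <= i < J) (b i)%:R <= 1 :> R.
Proof.
move=> Hb; elim: J => [|J IH]; first by rewrite big_geq.
rewrite big_nat_recr//=; case bJ: (b J); last by rewrite addr0.
rewrite big_nat big1 ?add0r// => i /andP[_ iJ].
by case bi: (b i) => //; case: (Hb i J iJ bi bJ).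
Qed.

(** Elements near the block at scale n have absolute value between w^n - D and w^(2n) + D; tripling
    n passes beyond this range. *)
Lemma near_block_disjoint (w D n n' : nat) xi : (2 <= w)%N -> (0 < n)%N ->
  (2 * D < w ^ n)%N -> (3 * n <= n')%N ->
  near_block w n D xi -> near_block w n' D xi -> False.
Proof.
move=> w2 n0 Dn nn' /(near_block_le w2) H1 /(near_block_ge w2) H2.
have H3 : (w ^ (3 * n) <= w ^ n')%N by rewrite leq_exp2l.
have X2 : (2 <= w ^ n)%N by apply: (leq_trans w2); rewrite -[X in (X <= _)%N]expn1 leq_exp2l.
have E2 : (w ^ n.*2 = w ^ n * w ^ n)%N by rewrite -expnD addnn.
have E3 : (w ^ (3 * n) = w ^ n * (w ^ n * w ^ n))%N by rewrite -!expnD; congr (_ ^ _)%N; lia.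
move: H1 H2 H3; rewrite E2 E3; move: X2 Dn; clear.
move: (w ^ n)%N (w ^ n')%N `|xi|%N => X Y z ? ? ? ? ?.
have : (2 * (X * X) <= X * (X * X))%N by rewrite leq_mul2r; apply/orP; right.
have : (2 * X <= X * X)%N by rewrite leq_mul2r; apply/orP; right.
lia.
Qed.

Lemma exists_transition (R : realType) (B B' : set nat) (s k : nat) (st : state R) :
  (forall b, B b -> (2 <= b)%N) -> (forall s, B' s -> (2 <= s)%N) ->
  (forall b s, B b -> B' s ->
     forall m n, (0 < m)%N -> (0 < n)%N -> (b ^ m)%N <> (s ^ n)%N) ->
  admissible B k st ->
  exists2 st', admissible B k.+1 st' & transition B B' s k st st'.
Proof.
move=> B2 B'2 indep I.
have tF := rtrig_dens I; have tFT := rtrigT tF; have F0 := dens_ge0 I; have F1 := mean_dens I.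
have tf := rtrig_cutdens I; have tfT := rtrigT tf.
set D := maxn (degr st) (dens_deg st).
have tk := tol_gt0 R k.
have JR : 0 < k.+1%:R :> R by rewrite ltr0n.
have Ek (z : R) : k.+1%:R * z = \sum_(0 <= i < k.+1) z.
  by rewrite sumr_const_nat subn0 mulr_natl.
have [B's|nB's] := pselect (B' s); last first.
  (* A base outside B' calls for no bias: the density stays and only the Weyl tests are extended. *)
  apply: (@transition_of_density R B B' s k st (fun=> 1) (fun=> 0)) => //.
  - exact: rtrig_cst.
  - exact: rtrig_cst.
  - by rewrite -[RHS]F1; congr mean; apply/funext => x; rewrite mulr1.
  - move=> xi _; rewrite (_ : (fun=> _) = fun=> 0).
      by apply: hasmeanE; exact: hasmean0.
    by apply/funext => x; rewrite subrr mulr0 mul0r.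
  - move=> xi; rewrite (_ : (fun=> _) = fun=> 0).
      by rewrite (hasmeanE (hasmean0 R _)) cabs0.
    by apply/funext => x; rewrite subrr mulr0 mul0r.
  - move=> r'; rewrite (_ : (fun=> _) =
      fun x => dens st x * wsum B k.+1 (horizon st) r' x); last first.
      by apply/funext => x; rewrite mulr1.
    apply: le_trans (mean_wsum_le _ _ _ _ tFT) _.
    apply: le_trans (_ : low_sum R B k.+1 (dens_deg st) (horizon st) r' <= _); last first.
      by have := low_sumP I r'; lra.
    apply: ler_sum => q _; apply: ler_sum => N _.
    rewrite ler_wpM2l ?invr_ge0 ?exprn_ge0// -sum_pairs_bool; apply: ler_sum => p _.
    exact: coef_dens_le tF F0 F1.
  - rewrite (_ : (fun=> _) = fun=> 0) ?rmean_cst ?ltW//.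
    by apply/funext => x; rewrite mulr0.
have s2 := B'2 _ B's.
have w2 : (2 <= s ^ 2)%N by rewrite (@leq_trans (2 ^ 2))// leq_exp2r.
pose e := tol R k / (2 * k.+1%:R).
have e0 : 0 < e by rewrite divr_gt0// mulr_gt0.
have [n0 Hn0] := @near_tail_tested R B s (dens_deg st) k.+1 e s2 B2
  (fun b Bb => indep b s Bb B's) e0.
have [C C1 Hdisc] : exists2 C : R, 1 <= C & forall n x,
    0 <= 64 * (disc s n 0 x + disc s n 1 x) <= C.
  (* 512 = 64 (4 + 4), by [disc_le]. *)
  exists 512 => [|n x]; first by rewrite ler1n.
  have := disc_ge0 s n 0 x; have := disc_ge0 s n 1 x.
  by have := disc_le s n 0 x; have := disc_le s n 1 x => *; apply/andP; split; lra.
have C0 : 0 <= C by apply: le_trans C1.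
(* The constant with which [Phi] is dominated by the two discrepancies at any single scale. Their
   means are at most 3/m each, so m >= [Z] brings the mean of [Phi] down to [tol R k]. *)
pose c : R := C ^+ k.+1 * 64.
have c0 : 0 <= c by rewrite mulr_ge0// exprn_ge0.
pose Z := c * 6 / tol R k.
have Z0 : 0 <= Z by apply: divr_ge0; [exact: mulr_ge0|exact: ltW].
pose m := maxn (maxn n0 k.+1) (maxn (2 * D).+1 (Num.bound Z)).
have mn0 : (n0 <= m)%N by rewrite /m !leq_max leqnn.
have mk : (k.+1 <= m)%N by rewrite /m !leq_max leqnn orbT.
have mD : (2 * D < m)%N by rewrite /m !leq_max leqnn orbT.
have mZ : Z <= m%:R.
  apply: ltW; apply: lt_le_trans (archi_boundP Z0) _.
  by rewrite ler_nat /m !leq_max leqnn !orbT.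
(* The ratio 3 between the scales separates their frequency windows, see [near_block_disjoint]. *)
pose n i := (3 ^ i * m)%N.
have nm i : (m <= n i)%N by rewrite leq_pmull// expn_gt0.
have nD i : (2 * D < (s ^ 2) ^ n i)%N.
  apply: leq_trans mD _; apply: leq_trans (nm i) _.
  by apply: ltnW; exact: ltn_expl.
have nD1 i : (dens_deg st < (s ^ 2) ^ n i)%N.
  apply: leq_ltn_trans (nD i); rewrite /D; move: (degr st) (dens_deg st); clear; lia.
have nD2 i : (2 * degr st < (s ^ 2) ^ n i)%N.
  apply: leq_ltn_trans (nD i); rewrite leq_mul2l leq_maxl; lia.
pose g i (x : R) := block s (n i) x.
have tg i : rtrig setT (g i) by exact: rtrig_block.
have tFg i := rtrigT_mul tFT (tg i).
have mFg i : mean (fun x => dens st x * g i x) = 1.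
  by rewrite (mean_mul_block s2 (nD1 i) tF).
pose G (x : R) := k.+1%:R^-1 * \sum_(0 <= i < k.+1) g i x.
have tG : rtrig setT G by apply: rtrigZ; apply: rtrig_bigsum => i _ _.
(* The factor 64 turns a i x <= 1 into the bound 1/64 for both discrepancies. *)
pose a i (x : R) := 64 * (disc s (n i) 0 x + disc s (n i) 1 x).
have ta i : rtrig setT (a i).
  by apply: rtrigZ; apply: rtrigD; exact: rtrigT_disc.
have a0 i x : 0 <= a i x <= C by exact: Hdisc.
(* Under the i-th summand of [G] only [a i] is known to be small in mean. The product is then small
   as well, the other factors being at most C. *)
pose Phi (x : R) := \prod_(0 <= i < k.+1) a i x.
have tPhi : rtrig setT Phi.
  rewrite /Phi; elim: (k.+1) => [|J IH].
    rewrite (_ : (fun=> _) = fun=> 1); first exact: rtrig_cst.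
    by apply/funext => x; rewrite big_geq.
  rewrite (_ : (fun=> _) = fun x => (\prod_(0 <= i < J) a i x) * a J x).
    exact: rtrigT_mul IH (ta J).
  by apply/funext => x; rewrite big_nat_recr.
have Esum (f : R -> R) x : f x * (G x - 1) =
    k.+1%:R^-1 * \sum_(0 <= i < k.+1) f x * (g i x - 1).
  rewrite -mulr_sumr sumrB sumr_const_nat subn0 /G mulrCA; congr (_ * _).
  by rewrite mulrBr mulVf ?gt_eqF.
have Ecoef (f : R -> R) xi : rtrig setT f ->
    coef (fun x => f x * (G x - 1)) xi =
    (k.+1%:R^-1)%:C * \sum_(0 <= i < k.+1) coef (fun x => f x * (g i x - 1)) xi.
  move=> tf'; have th i : trig setT (fun x => (f x * (g i x - 1))%:C * ex xi x).
    have tg1 : rtrig setT (fun x => g i x - 1) by apply: rtrigB (tg i) _; exact: rtrig_cst.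
    exact: trig_mul_ex (rtrigT_mul tf' tg1).
  rewrite /coef -(@mean_sum _ setT); last by move=> i _; exact: th.
  rewrite -(@meanZ _ setT); last by apply: trig_bigsum => i _ _; exact: th.
  congr mean; apply/funext => x; rewrite Esum rmorphM -mulrA.
  by rewrite (rmorph_sum (real_complex R)) mulr_suml.
pose nb D' i xi := `[< near_block (s ^ 2) (n i) D' xi >].
have coefF xi : cabs (coef (fun x => dens st x * (G x - 1)) xi) <=
    k.+1%:R^-1 * \sum_(0 <= i < k.+1) 2 * (nb (dens_deg st) i xi)%:R.
  rewrite (Ecoef _ _ tFT) cabsM cabsR ger0_norm ?invr_ge0// ler_wpM2l ?invr_ge0//.
  apply: le_trans (cabs_sum _ _ _) _; apply: ler_sum => i _.
  rewrite -[2 in leRHS]mulr1; apply: (coef_block_le _ s2 (nD1 i) tF tF _ F0 F1 _) => // x.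
  by rewrite mul1r ger0_norm.
(* The constant is 4 = 2 * 2 because |[cutdens]| is at most 2 [dens]. *)
have coeff xi : cabs (coef (fun x => cutdens st x * (G x - 1)) xi) <=
    k.+1%:R^-1 * \sum_(0 <= i < k.+1) 4 * (nb (degr st) i xi)%:R.
  rewrite (Ecoef _ _ tfT) cabsM cabsR ger0_norm ?invr_ge0// ler_wpM2l ?invr_ge0//.
  apply: le_trans (cabs_sum _ _ _) _; apply: ler_sum => i _.
  rewrite (_ : 4 = 2 * 2); last by ring.
  by apply: (coef_block_le _ s2 (nD1 i) tf tF _ F0 F1 _) => // x; exact: cutdens_le I.
apply: (@transition_of_density R B B' s k st G Phi) => //.
- by move=> x; rewrite mulr_ge0 ?invr_ge0// sumr_ge0// => i _; exact: block_ge0.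
- by move=> x; apply: prodr_ge0 => i _; have /andP[] := a0 i x.
- rewrite (_ : (fun=> _) = fun x => k.+1%:R^-1 * \sum_(0 <= i < k.+1) dens st x * g i x).
    rewrite (@rmeanZ _ setT); last by apply: rtrig_bigsum => i _ _.
    rewrite (@rmean_sum _ setT); last by move=> i _.
    by rewrite (eq_bigr (fun=> 1))// sumr_const_nat subn0 mulVf ?gt_eqF.
  by apply/funext => x; rewrite /G mulrCA mulr_sumr.
- move=> xi xiD; apply/eqP; rewrite -cabs_eq0 eq_le cabs_ge0 andbT.
  apply: le_trans (coeff xi) _; rewrite big1 ?mulr0// => i _.
  rewrite (_ : nb _ _ _ = false) ?mulr0//; apply/asboolP => /(near_block_ge w2).
  by apply/negP; rewrite -ltnNge; apply: leq_ltn_trans (nD2 i); rewrite mul2n -addnn leq_add2r.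
- move=> xi; apply: le_trans (coeff xi) _; rewrite [leRHS]mulrC ler_wpM2l ?invr_ge0//.
  rewrite -mulr_sumr -[leRHS]mulr1 ler_wpM2l//; apply: sum_bool_le1 => i j ij.
  move=> /asboolP H1 /asboolP H2; apply: near_block_disjoint w2 _ (nD2 i) _ H1 H2.
    by apply: leq_trans (nm i); apply: leq_trans mk.
  by rewrite /n mulnA leq_mul2r -expnS leq_exp2l// ij orbT.
(* Half of the bound 2 [tol R k] pays for the low pairs, where the old density has coefficients, the
   other half for the pairs near one of the blocks. *)
- move=> r'; have tFG := rtrigT_mul tFT tG.
  have HC xi : cabs (coef (fun x => dens st x * G x) xi) <=
     (`|xi| <= dens_deg st)%N%:R +
     k.+1%:R^-1 * \sum_(0 <= i < k.+1) 2 * (nb (dens_deg st) i xi)%:R.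
    have -> : coef (fun x => dens st x * G x) xi = coef (dens st) xi +
        coef (fun x => dens st x * (G x - 1)) xi.
      have tG1 : rtrig setT (fun x => G x - 1) by apply: rtrigB tG _; exact: rtrig_cst.
      rewrite /coef -(meanD (trig_mul_ex xi tFT) (trig_mul_ex xi (rtrigT_mul tFT tG1))).
      by congr mean; apply/funext => x; rewrite !(rmorphM, rmorphB)/=; ring.
    apply: le_trans (cabsD _ _) _; apply: lerD => //; exact: coef_dens_le tF F0 F1.
  apply: le_trans (mean_wsum_le _ _ _ _ tFG) _.
  pose low q N := N.+1%:R ^- 3 *
    #|low_pairs (dens_deg st) (pair_of q).1 (pair_of q).2 N.+1|%:R : R.
  pose near q i N := N.+1%:R ^- 3 *
    #|near_pairs s (n i) (dens_deg st) (pair_of q).1 (pair_of q).2 N.+1|%:R : R.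
  have HN q N : N.+1%:R ^- 3 * \sum_(p : 'I_N.+1 * 'I_N.+1)
      cabs (coef (fun x => dens st x * G x) (diff_pow (pair_of q).1 (pair_of q).2 p.1 p.2))
      <= low q N + k.+1%:R^-1 * \sum_(0 <= i < k.+1) 2 * near q i N.
    rewrite /low /near; set v := N.+1%:R ^- 3.
    have v0 : 0 <= v by rewrite invr_ge0 exprn_ge0.
    apply: le_trans (ler_wpM2l v0 (ler_sum _ (fun p _ => HC _))) _.
    rewrite big_split/= mulrDr; apply: lerD; first by rewrite sum_pairs_bool.
    rewrite -mulr_sumr mulrCA ler_wpM2l ?invr_ge0// exchange_big/= mulr_sumr.
    apply: ler_sum => i _; rewrite -mulr_sumr mulrCA sum_pairs_bool.
    by rewrite le_eqVlt; apply/orP; left.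
  apply: (@le_trans _ _ (low_sum R B k.+1 (dens_deg st) (horizon st) r' +
     \sum_(0 <= q < k.+1 | tested B q) k.+1%:R^-1 * \sum_(0 <= i < k.+1) 2 * e)).
    rewrite /low_sum -big_split/= big_nat_cond [leRHS]big_nat_cond.
    apply: ler_sum => q /andP[/andP[_ qk] tq].
    apply: le_trans (ler_sum _ (fun N _ => HN q N)) _; rewrite big_split/=; apply: lerD => //.
    rewrite -mulr_sumr ler_wpM2l ?invr_ge0// exchange_big/=; apply: ler_sum => i _.
    rewrite -mulr_sumr ler_wpM2l//; apply: Hn0 => //.
    exact: leq_trans mn0 (nm i).
  have -> : tol R k = k.+1%:R * (2 * e) by rewrite /e; field; rewrite gt_eqF.
  rewrite [leRHS]mulr_natl [leRHS]mulr2n; apply: lerD.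
    by apply: le_trans (low_sumP I r') _; rewrite /e; rewrite le_eqVlt; apply/orP; left; apply/eqP; field; rewrite gt_eqF.
  rewrite sumr_const_nat subn0 -[2 * e *+ k.+1]mulr_natl mulKf ?gt_eqF//.
  have e2 : 0 <= 2 * e by rewrite mulr_ge0// ltW.
  rewrite big_mkcond/= Ek; by apply: ler_sum => q _; case: ifP.
- have tFGP i : rtrig setT (fun x => dens st x * g i x * Phi x) by exact: rtrigT_mul (tFg i) tPhi.
  rewrite (_ : (fun=> _) = fun x => k.+1%:R^-1 *
      \sum_(0 <= i < k.+1) dens st x * g i x * Phi x); last first.
    by apply/funext => x; rewrite /G mulrCA -mulrA mulr_sumr mulr_suml.
  rewrite (@rmeanZ _ setT); last by apply: rtrig_bigsum => i _ _.
  rewrite (@rmean_sum _ setT); last by move=> i _.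
  rewrite ler_pdivrMl// Ek big_nat [leRHS]big_nat; apply: ler_sum => i /andP[_ ik].
  have tFgd j : rtrig setT (fun x => dens st x * g i x * disc s (n i) j x).
    exact: rtrigT_mul (tFg i) (rtrigT_disc R s (n i) j).
  have ni0 : (0 < n i)%N by apply: leq_trans (nm i); apply: leq_trans mk.
  have Hd j : (j <= 1)%N -> mean (fun x => dens st x * g i x * disc s (n i) j x) <= 3 / m%:R.
    move=> j1; apply: le_trans (mean_block_disc s2 j1 ni0 (nD1 i) tF F0) _.
    rewrite F1 mulr1 ler_wpM2l// lef_pV2 ?posrE ?ltr0n// ?ler_nat//.
    exact: leq_trans mk.
  pose Eb x := c * (dens st x * g i x * disc s (n i) 0 x + dens st x * g i x * disc s (n i) 1 x).
  have tEb : rtrig setT Eb by apply: rtrigZ; apply: rtrigD.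
  apply: le_trans (ler_mean (tFGP i) tEb _) _.
    move=> x; rewrite /Eb -mulrDr mulrCA ler_wpM2l ?mulr_ge0 ?block_ge0//.
    by rewrite /c -mulrA; apply: (@prod_le_factor R k.+1 i (a^~ x)) => // j; exact: a0.
  rewrite /Eb (@rmeanZ _ setT); last exact: rtrigD.
  rewrite (rmeanD (tFgd 0%N) (tFgd 1%N)).
  apply: (@le_trans _ _ (c * (3 / m%:R + 3 / m%:R))).
    by rewrite ler_wpM2l// lerD// Hd.
  have m0 : 0 < m%:R :> R by rewrite ltr0n; apply: leq_trans mk.
  rewrite (_ : c * _ = (c * 6) / m%:R); last by field; rewrite gt_eqF.
  by rewrite ler_pdivrMr// -ler_pdivrMl// mulrC.
- move=> _ x HPx; have [i ik ai] := exists_le1_of_prod HPx.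
  exists (n i); split; first exact: leq_trans mk (nm i).
    by have := disc_ge0 s (n i) 1 x; move: ai; rewrite /a; lra.
  by have := disc_ge0 s (n i) 0 x; move: ai; rewrite /a; lra.
Qed.

(** * Localization *)

Definition dirichlet (R : realType) (N : nat) (y : R) : R[i] :=
  \sum_(j < N.*2.+1) ex (j%:Z - N%:Z) y.

Lemma dirichlet_le (R : realType) (N : nat) (y : R) : cabs (dirichlet N y) <= N.*2.+1%:R.
Proof.
apply: le_trans (cabs_sum _ _ _) _; under eq_bigr do rewrite cabs_ex.
by rewrite sumr_const card_ord.
Qed.

Lemma dirichletE (R : realType) (N : nat) (y : R) :
  dirichlet N y * (ex 1 y - 1) = ex N.+1%:Z y - ex (- N%:Z) y.
Proof.
have -> : dirichlet N y = ex (- N%:Z) y * \sum_(j < N.*2.+1) ex 1 y ^+ j.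
  rewrite /dirichlet mulr_sumr; apply: eq_bigr => j _.
  by rewrite exXn mul1r -exD addrC.
rewrite -mulrA [X in _ * X]mulrC -subrX1 mulrBr mulr1 exXn -exD mul1r.
by congr (ex _ _ - _); rewrite -addnn; lia.
Qed.

(* 1/(e(y) - 1) is replaced, away from the integers, by a trigonometric
   polynomial: a partial sum of the geometric series of 1/|e(y) - 1|^2. *)
Definition resolvent (R : realType) (L : nat) (y : R) : R[i] :=
  (ex (- 1) y - 1) * (4^-1 * \sum_(j < L) ((1 - cabs (ex 1 y - 1) ^+ 2 / 4) ^+ j)%:C).

Lemma cabs2_ex1 (R : realType) (y : R) :
  (cabs (ex 1 y - 1) ^+ 2)%:C = (ex 1 y - 1) * (ex (- 1) y - 1).
Proof.
rewrite -mulcJ; congr (_ * _); rewrite rmorphB rmorph1; congr (_ - _).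
exact: conj_ex.
Qed.

Lemma resolventE (R : realType) (L : nat) (y : R) :
  ((1 - cabs (ex 1 y - 1) ^+ 2 / 4) ^+ L)%:C = 1 - (ex 1 y - 1) * resolvent L y.
Proof.
rewrite /resolvent; set s := 1 - _ / 4.
have H : (s ^+ L)%:C - 1 = (s - 1)%:C * \sum_(j < L) (s ^+ j)%:C.
  by rewrite -(rmorph_sum (real_complex R)) -rmorphM -subrX1 rmorphB rmorph1.
have Hs : (s - 1)%:C = - (4^-1 * ((ex 1 y - 1) * (ex (- 1) y - 1))).
  rewrite -cabs2_ex1 /s (_ : 1 - _ - 1 = - (4^-1 * cabs (ex 1 y - 1) ^+ 2)); last by field.
  by rewrite rmorphN rmorphM fmorphV rmorph_nat.
by rewrite -[LHS](subrK 1) H Hs; ring.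
Qed.

(** Away from the integers the first term is small for large L. The second no longer contains the
    kernel: for fixed L it consists of boundedly many exponentials with frequencies near N and
    -N. *)
Lemma dirichlet_split (R : realType) (N L : nat) (y : R) : dirichlet N y =
  dirichlet N y * ((1 - cabs (ex 1 y - 1) ^+ 2 / 4) ^+ L)%:C +
  (ex N.+1%:Z y - ex (- N%:Z) y) * resolvent L y.
Proof. by rewrite -dirichletE resolventE; ring. Qed.

Lemma trig_resolvent (R : realType) L : trig setT (@resolvent R L).
Proof.
have t1 k : trig setT (fun y : R => ex k y - 1).
  by apply: trigB; [exact: trig_exp|exact: trig_cst].
have Hv : rtrig setT (fun y : R => 1 - cabs (ex 1 y - 1) ^+ 2 / 4).
  apply: rtrigB; first exact: rtrig_cst.
  rewrite (_ : (fun=> _) = fun y : R => 4^-1 * cabs (ex 1 y - 1) ^+ 2).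
    by apply: rtrigZ; exact: rtrig_cabs2 (t1 1).
  by apply/funext => y; rewrite mulrC.
apply: (@trigM _ setT setT setT) => //; apply: trigZ; apply: trig_bigsum => j _ _.
elim: (nat_of_ord j) => [|m IH]; first exact: rtrig_cst.
rewrite (_ : (fun=> _) = fun y : R => ((1 - cabs (ex 1 y - 1) ^+ 2 / 4) *
  (1 - cabs (ex 1 y - 1) ^+ 2 / 4) ^+ m)%:C); first exact: rtrigT_mul Hv IH.
by apply/funext => y; rewrite exprS.
Qed.

Lemma trig_sumE (R : realType) (c : int -> R[i]) (x : R) N :
  trig_sum c x N = \sum_(j < N.*2.+1) c (j%:Z - N%:Z) * ex (- (j%:Z - N%:Z)) x.
Proof.
by apply: eq_bigr => j _; congr (_ * _); rewrite /ex; congr expi; rewrite mulrNz; ring.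
Qed.

Lemma trig_sum_coef (R : realType) (f : R -> R) (x : R) N : rtrig setT f ->
  trig_sum (coef f) x N = mean (fun y => (f y)%:C * dirichlet N (y - x)).
Proof.
move=> tf; rewrite trig_sumE.
rewrite (_ : (fun=> _) = fun y => \sum_(j <- index_enum 'I_(N.*2.+1))
    ex (- (j%:Z - N%:Z)) x * ((f y)%:C * ex (j%:Z - N%:Z) y)).
  rewrite (@mean_sum _ setT); last by move=> j _; apply: trigZ; exact: trig_mul_ex tf.
  apply: eq_bigr => j _; rewrite mulrC (@meanZ _ setT)//; exact: trig_mul_ex tf.
apply/funext => y; rewrite /dirichlet mulr_sumr; apply: eq_bigr => j _.
by rewrite exBx; ring.
Qed.

Lemma absz_far (M W N : nat) (q : int) : (M + W <= N)%N -> (`|q| <= W)%N ->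
  (M <= `|(N.+1%:Z + q)%R|)%N /\ (M <= `|(- N%:Z + q)%R|)%N.
Proof. by move=> ? ?; split; lia. Qed.

(** The limit series is compared with a stage k that depends on N, so the decay of the coefficients
    has to be uniform in k. Near x0, where |f k| is at most [tol R k] times F k, the trivial bound
    2N+1 of the Dirichlet kernel is affordable; away from x0 the power in [dirichlet_split] is
    small. *)
Lemma localization (R : realType) (f F T : nat -> R -> R) (c : int -> R[i]) (x0 : R) :
  (forall k, rtrig setT (f k)) -> (forall k, rtrig setT (F k)) ->
  (forall k, rtrig setT (T k)) ->
  (forall k x, 0 <= F k x) -> (forall k, mean (F k) = 1) ->
  (forall k x, T k x <= T k.+1 x) ->
  (forall k x, `|f k x| <= 2 * F k x) ->
  (forall k x, 1 <= T k x -> `|f k x| <= tol R k * F k x) ->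
  (forall e, 0 < e -> exists M : nat, forall k xi, (M <= `|xi|)%N -> cabs (coef (f k) xi) <= e) ->
  (forall xi e, 0 < e -> exists k0 : nat, forall k, (k0 <= k)%N ->
     cabs (c xi - coef (f k) xi) <= e) ->
  (exists k, 1 < T k x0) ->
  forall e, 0 < e -> exists N0 : nat, forall N, (N0 <= N)%N -> cabs (trig_sum c x0 N) <= e.
Proof.
move=> tf tF tT F0 F1 Tmono f2 fT unif lim [k1 Tk1] e e0.
have Tle k x : (k1 <= k)%N -> T k1 x <= T k x.
  elim: k => [|k IH]; first by rewrite leqn0 => /eqP ->.
  by rewrite leq_eqVlt => /orP[/eqP -> //|/IH H]; apply: le_trans H (Tmono _ _).
have [Lc Lc0 HLc] := trig_lip (tT k1).
(* A chord radius around x0 within which T k1 >= 1, from the Lipschitz constant of T k1. *)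
pose ka := Num.min 1 ((T k1 x0 - 1) / (Lc + 1)).
have ka0 : 0 < ka by rewrite lt_min ltr01 divr_gt0//; lra.
have ka1 : ka <= 1 by rewrite ge_min lexx.
have near_x0 x : cabs (ex 1 (x - x0) - 1) < ka -> 1 <= T k1 x.
  move=> xka; have := HLc x x0; rewrite -rmorphB cabsR ler_norml => /andP[H _].
  have : Lc * cabs (ex 1 (x - x0) - 1) <= T k1 x0 - 1; last by lra.
  have H2 : cabs (ex 1 (x - x0) - 1) <= (T k1 x0 - 1) / (Lc + 1).
    by apply: le_trans (ltW xka) _; rewrite ge_min lexx orbT.
  rewrite ler_pdivlMr in H2; last by lra.
  have := cabs_ge0 (ex 1 (x - x0) - 1); nra.
have ka2 : 0 < ka ^+ 2 / 4 <= 1.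
  by apply/andP; split; [rewrite divr_gt0// exprn_gt0|nra].
(* Away from x0 the first term is at most 2 F k times 2 / ka times this number, that is e / 4 times
   F k. *)
have e1 : 0 < e * ka / 16 by rewrite divr_gt0// mulr_gt0.
have [L HL] := exprn_small ka2 e1.
have [l [_ El]] := trig_resolvent R L.
pose A := \sum_(q <- l) cabs q.1.
have A0 : 0 <= A by apply: sumr_ge0 => q _; exact: cabs_ge0.
(* Each exponential of the resolvent meets two coefficients of f k, which accounts for e / 4 in
   total; A + 1 avoids a division by 0. *)
have e8 : 0 < e / (8 * (A + 1)) by rewrite divr_gt0// mulr_gt0//; lra.
have [M HM] := unif _ e8.
pose W := (\max_(q <- l) `|q.2|)%N.
exists (M + W)%N => N NMW.
(* The stage is chosen after N: the 2N+1 coefficients must be close to their limits, and [tol R k]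
   must beat the size of the kernel. *)
have [k [k1k Hk1 Hk2]] : exists k, [/\ (k1 <= k)%N,
    forall j : 'I_(N.*2.+1), cabs (c (j%:Z - N%:Z) - coef (f k) (j%:Z - N%:Z)) <=
       e / (4 * N.*2.+1%:R) & tol R k * N.*2.+1%:R <= e / 4].
  have eN : 0 < e / (4 * N.*2.+1%:R) by rewrite divr_gt0// mulr_gt0.
  pose k0 (j : 'I_(N.*2.+1)) := xget 0%N [set k0 | forall k, (k0 <= k)%N ->
    cabs (c (j%:Z - N%:Z) - coef (f k) (j%:Z - N%:Z)) <= e / (4 * N.*2.+1%:R)].
  have Hk0 (j : 'I_(N.*2.+1)) k : (k0 j <= k)%N ->
      cabs (c (j%:Z - N%:Z) - coef (f k) (j%:Z - N%:Z)) <= e / (4 * N.*2.+1%:R).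
    rewrite /k0; case: xgetP => [k' _ Hk'|]; first exact: Hk'.
    by have [k' Hk'] := lim (j%:Z - N%:Z) _ eN => /(_ k').
  have n0 : 0 <= N.*2.+1%:R / (10 * e) :> R by rewrite divr_ge0// mulr_ge0// ltW.
  pose k2 := Num.bound (N.*2.+1%:R / (10 * e)).
  pose k3 := maxn (maxn k1 k2) (\max_(j < N.*2.+1) k0 j)%N.
  exists k3; split.
  - by rewrite /k3 !leq_max leqnn.
  - by move=> j; apply: Hk0; rewrite /k3 leq_max (leq_bigmax j) orbT.
  - have H2 : N.*2.+1%:R / (10 * e) <= 2 ^+ k3.
      apply: le_trans (ltW (archi_boundP n0)) _; rewrite -natrX ler_nat.
      by apply: leq_trans (ltnW (ltn_expl _ (ltnSn 1))); rewrite /k3 !leq_max leqnn orbT.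
    rewrite /tol mulrC ler_pdivrMr ?mulr_gt0 ?exprn_gt0//.
    rewrite ler_pdivrMr in H2; last by rewrite mulr_gt0.
    by move: H2; set X := 2 ^+ k3; set Y := N.*2.+1%:R; lra.
have Hdist : cabs (trig_sum c x0 N - trig_sum (coef (f k)) x0 N) <= e / 4.
  rewrite !trig_sumE -sumrB; apply: le_trans (cabs_sum _ _ _) _.
  apply: (@le_trans _ _ (\sum_(j < N.*2.+1) e / (4 * N.*2.+1%:R))).
    by apply: ler_sum => j _; rewrite -mulrBl cabsM cabs_ex mulr1; exact: Hk1.
  rewrite sumr_const card_ord -[_ *+ N.*2.+1]mulr_natl le_eqVlt; apply/orP; left; apply/eqP.
  have Y0 : N.*2.+1%:R != 0 :> R by rewrite pnatr_eq0.
  by move: (N.*2.+1%:R : R) Y0 => Y Y0; field.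
have tfk : trig setT (fun y => (f k y)%:C) := tf k.
have tsh (g : R -> R[i]) : trig setT g -> trig setT (fun y => g (y - x0)).
  move=> [l' [_ ->]]; apply: trig_bigsum => q _ _; apply: trigZ.
  rewrite (_ : (fun=> _) = fun y => ex (- q.2) x0 * ex q.2 y).
    by apply: trigZ; exact: trig_exp.
  by apply/funext => y; rewrite exBx mulrC.
have mulT (g g' : R -> R[i]) : trig setT g -> trig setT g' -> trig setT (fun y => g y * g' y).
  by move=> Hg Hg'; apply: (@trigM _ setT setT setT).
pose t (y : R) := (1 - cabs (ex 1 y - 1) ^+ 2 / 4) ^+ L.
have tdir : trig setT (@dirichlet R N) by apply: trig_bigsum => j _ _; exact: trig_exp.
have tt : trig setT (fun y => (t y)%:C).
  rewrite (_ : (fun=> _) = fun y => 1 - (ex 1 y - 1) * resolvent L y).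
    apply: trigB; first exact: trig_cst.
    apply: (mulT _ _ _ (trig_resolvent R L)).
    by apply: trigB; [exact: trig_exp|exact: trig_cst].
  by apply/funext => y; rewrite -resolventE.
pose P1 y := (f k y)%:C * (dirichlet N (y - x0) * (t (y - x0))%:C).
pose P2 y := (f k y)%:C * ((ex N.+1%:Z (y - x0) - ex (- N%:Z) (y - x0)) * resolvent L (y - x0)).
have tP1 : trig setT P1.
  apply: (mulT _ _ tfk); apply: (tsh (fun y => dirichlet N y * (t y)%:C)).
  exact: (mulT _ _ tdir tt).
have tP2 : trig setT P2.
  apply: (mulT _ _ tfk).
  apply: (tsh (fun y => (ex N.+1%:Z y - ex (- N%:Z) y) * resolvent L y)).
  by apply: (mulT _ _ _ (trig_resolvent R L)); apply: trigB; exact: trig_exp.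
have Hsplit : trig_sum (coef (f k)) x0 N = mean P1 + mean P2.
  rewrite trig_sum_coef// -(meanD tP1 tP2); congr mean; apply/funext => y.
  by rewrite /P1 /P2 -mulrDr; congr (_ * _); exact: dirichlet_split.
have HP1 : cabs (mean P1) <= e / 2.
  have tE := rtrigZ (tol R k * N.*2.+1%:R + e / 4) (tF k).
  apply: (@le_trans _ _ (mean (fun y => (tol R k * N.*2.+1%:R + e / 4) * F k y))); last first.
    by rewrite (rmeanZ _ (tF k)) F1; move: Hk2; lra.
  apply: cabs_mean tP1 tE _ => y; rewrite !cabsM !cabsR.
  set v := cabs (ex 1 (y - x0) - 1).
  have v0 : 0 <= v by exact: cabs_ge0.
  have v2 : v <= 2.
    by apply: le_trans (cabsB _ _) _; rewrite cabs_ex cabs1; lra.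
  have s01 : 0 <= 1 - v ^+ 2 / 4 <= 1 by apply/andP; split; nra.
  have t01 : 0 <= t (y - x0) <= 1.
    by move/andP: s01 => [s0 s1]; rewrite exprn_ge0//= exprn_ile1.
  have Fy := F0 k y; have D0 := cabs_ge0 (dirichlet N (y - x0)).
  rewrite [`|t _|]ger0_norm; last by case/andP: t01.
  have [vka|kav] := ltP v ka.
    have fy := fT k y (le_trans (near_x0 y vka) (Tle k y k1k)).
    apply: (@le_trans _ _ ((tol R k * F k y) * (N.*2.+1%:R * 1))).
      apply: ler_pM => //; first by rewrite mulr_ge0//; case/andP: t01.
      by apply: ler_pM => //; [case/andP: t01|exact: dirichlet_le|case/andP: t01].
    rewrite mulr1 mulrDl mulrAC lerDl mulr_ge0//; lra.
  have HD : cabs (dirichlet N (y - x0)) <= 2 / ka.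
    rewrite ler_pdivlMr//; apply: le_trans (ler_wpM2l D0 kav) _.
    rewrite /v -cabsM dirichletE; apply: le_trans (cabsB _ _) _.
    by rewrite !cabs_ex; lra.
  have Ht : t (y - x0) <= e * ka / 16.
    apply: le_trans HL; rewrite lerXn2r ?nnegrE//; try by case/andP: s01.
      by case/andP: ka2; lra.
    by rewrite -/v; nra.
  apply: (@le_trans _ _ ((2 * F k y) * ((2 / ka) * (e * ka / 16)))).
    apply: ler_pM => //; first by rewrite mulr_ge0//; case/andP: t01.
    by apply: ler_pM => //; case/andP: t01.
  rewrite (_ : 2 * F k y * _ = (e / 4) * F k y); last by field; rewrite gt_eqF.
  by rewrite ler_wpM2r// lerDr mulr_ge0// ltW// tol_gt0.
have HP2 : cabs (mean P2) <= e / 4.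
  have tfe xi : trig setT (fun y => (f k y)%:C * ex xi y) := trig_mul_ex xi tfk.
  have -> : P2 = fun y => \sum_(q <- l)
      ((q.1 * ex (- (N.+1%:Z + q.2)) x0) * ((f k y)%:C * ex (N.+1%:Z + q.2) y) +
      - (q.1 * ex (- (- N%:Z + q.2)) x0) * ((f k y)%:C * ex (- N%:Z + q.2) y)).
    apply/funext => y; rewrite /P2 El !mulr_sumr; apply: eq_bigr => q _.
    by rewrite !exBx !opprD !exD; ring.
  rewrite (@mean_sum _ setT); last by move=> q _; apply: trigD; apply: trigZ.
  apply: le_trans (cabs_sum _ _ _) _.
  apply: (@le_trans _ _ (\sum_(q <- l) cabs q.1 * (e / (4 * (A + 1))))); last first.
    rewrite -mulr_suml -/A mulrA ler_pdivrMr; last by lra.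
    by rewrite mulrAC; nra.
  rewrite big_seq [leRHS]big_seq; apply: ler_sum => q ql.
  have qW : (`|q.2| <= W)%N by rewrite /W (big_rem q)//= leq_maxl.
  rewrite (meanD (trigZ _ (tfe _)) (trigZ _ (tfe _))) !(meanZ _ (tfe _)).
  apply: le_trans (cabsD _ _) _; rewrite !cabsM cabsN cabsM !cabs_ex !mulr1 -mulrDr.
  rewrite ler_wpM2l ?cabs_ge0//.
  have [M1 M2] := absz_far NMW qW.
  have H1 : cabs (coef (f k) (N.+1%:Z + q.2)) <= e / (8 * (A + 1)) by exact: HM.
  have H2 : cabs (coef (f k) (- N%:Z + q.2)) <= e / (8 * (A + 1)) by exact: HM.
  apply: le_trans (lerD H1 H2) _; rewrite le_eqVlt; apply/orP; left; apply/eqP.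
  by move: A0; clear => A0; field; lra.
rewrite -[trig_sum c x0 N](subrK (trig_sum (coef (f k)) x0 N)).
apply: le_trans (cabsD _ _) _; rewrite Hsplit in Hdist *.
move: Hdist HP1 HP2 (cabsD (mean P1) (mean P2)); clear; lra.
Qed.

Lemma tol_archi (R : realType) (e : R) : 0 < e -> exists k0, forall k, (k0 <= k)%N -> tol R k <= e.
Proof.
move=> e0; exists (Num.bound e^-1) => k bk.
have e1 : 0 <= e^-1 by rewrite invr_ge0 ltW.
have H : e^-1 <= 2 ^+ k.
  apply: le_trans (ltW (archi_boundP e1)) _; rewrite -natrX ler_nat.
  by apply: leq_trans bk (ltnW (ltn_expl _ (ltnSn 1))).
rewrite /tol -[e]invrK lef_pV2 ?posrE ?mulr_gt0 ?exprn_gt0 ?invr_gt0//.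
apply: le_trans H _; rewrite ler_peMl ?exprn_ge0//; lra.
Qed.

(** The steps after stage j sum to at most 10 [tol R j], so the intervals of this radius around v j
    share a point; the supremum of their left ends is one. *)
Lemma lim_tol (R : realType) (v : nat -> R) k0 :
  (forall k, (k0 <= k)%N -> `|v k.+1 - v k| <= 5 * tol R k) ->
  exists c, forall k, (k0 <= k)%N -> `|c - v k| <= 10 * tol R k.
Proof.
move=> Hv; have tolE k := tolS R k.
have step k j : (k0 <= k)%N -> `|v (k + j)%N - v k| <= 10 * tol R k - 10 * tol R (k + j).
  move=> kk; elim: j => [|j IH]; first by rewrite addn0 !subrr normr0.
  rewrite addnS -[v _.+1](subrK (v (k + j)%N)) -addrA.
  have := Hv (k + j)%N (leq_trans kk (leq_addr _ _)) => H.
  by apply: le_trans (ler_normD _ _) _; rewrite tolE; lra.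
have dist k j : (k0 <= k)%N -> (k0 <= j)%N -> v j - 10 * tol R j <= v k + 10 * tol R k.
  move=> kk kj; have [kj'|/ltnW jk] := leqP k j.
    have := step k (j - k)%N kk; rewrite subnKC// ler_norml => /andP[_].
    by have := tol_gt0 R j; lra.
  have := step j (k - j)%N kj; rewrite subnKC// ler_norml => /andP[].
  by have := tol_gt0 R k; lra.
pose S := [set y | exists2 j, (k0 <= j)%N & y = v j - 10 * tol R j].
have S0 : S !=set0 by exists (v k0 - 10 * tol R k0), k0.
have ubS k : (k0 <= k)%N -> ubound S (v k + 10 * tol R k).
  by move=> kk _ [j kj ->]; exact: dist.
exists (sup S) => k kk; rewrite ler_distl; apply/andP; split.
  apply: ub_le_sup; last by exists k.
  by exists (v k + 10 * tol R k); exact: ubS.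
by apply: ge_sup => //; exact: ubS.
Qed.

Lemma clim_tol (R : realType) (u : nat -> R[i]) k0 :
  (forall k, (k0 <= k)%N -> cabs (u k.+1 - u k) <= 5 * tol R k) ->
  exists c, forall k, (k0 <= k)%N -> cabs (c - u k) <= 20 * tol R k.
Proof.
move=> Hu.
have ReB (z w : R[i]) : complex.Re (z - w) = complex.Re z - complex.Re w by case: z; case: w.
have ImB (z w : R[i]) : complex.Im (z - w) = complex.Im z - complex.Im w by case: z; case: w.
have [|a Ha] := @lim_tol R (fun k => complex.Re (u k)) k0.
  by move=> k kk; rewrite -ReB; apply: le_trans (cabs_Re _) (Hu k kk).
have [|b Hb] := @lim_tol R (fun k => complex.Im (u k)) k0.
  by move=> k kk; rewrite -ImB; apply: le_trans (cabs_Im _) (Hu k kk).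
exists (a +i* b) => k kk; apply: le_trans (cabs_ReIm _) _; rewrite ReB ImB /=.
by have := Ha k kk; have := Hb k kk; lra.
Qed.

(** The second component of an enumeration of pairs, so that every base recurs at infinitely many
    stages. *)
Definition base_at (k : nat) : nat := (pair_of k).2.

Definition initial (R : realType) (r : nat) : state R :=
  State (fun=> 1) (fun=> 0) (fun=> 1) 0 0 r.

Lemma admissible_initial (R : realType) (B : set nat) :
  (forall b, B b -> (2 <= b)%N) -> exists r, admissible B 0 (@initial R r).
Proof.
move=> B2; have [r Hr] := low_sum_tail 1 0 B2 (tol_gt0 R 0).
exists r; split => //=.
- by apply: rtrig_cst.
- by rewrite rmean_cst.
- by apply: rtrig_cst.
- by apply: rtrig_cst.
- by move=> x; rewrite cutoff0 mulr1 subrr normr0 mulr1 ltW// tol_gt0.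
- by move=> r'; exact: Hr.
Qed.

Lemma exists_stages (R : realType) (B B' : set nat) :
  (forall b, B b -> (2 <= b)%N) -> (forall s, B' s -> (2 <= s)%N) ->
  (forall b s, B b -> B' s ->
     forall m n, (0 < m)%N -> (0 < n)%N -> (b ^ m)%N <> (s ^ n)%N) ->
  exists st : nat -> state R, [/\ exists r, st 0%N = initial R r,
    forall k, admissible B k (st k) &
    forall k, transition B B' (base_at k) k (st k) (st k.+1)].
Proof.
move=> B2 B'2 indep; have [r Hr] := admissible_initial R B2.
have next k (p : {st : state R | admissible B k st}) :
    {p' : {st : state R | admissible B k.+1 st} |
      transition B B' (base_at k) k (sval p) (sval p')}.
  case: p => st I /=; apply: cid.
  have [st' I' t] := exists_transition (base_at k) B2 B'2 indep I.
  by exists (exist _ st' I').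
pose seq := fix seq k : {st : state R | admissible B k st} :=
  if k is k'.+1 then sval (next k' (seq k')) else exist _ _ Hr.
exists (fun k => sval (seq k)); split; first by exists r.
  by move=> k; exact: svalP (seq k).
by move=> k; exact: svalP (next k (seq k)).
Qed.

Lemma not_uniqueness (R : realType) (B B' : set nat) (st : nat -> state R) (E : set R) :
  (exists r, st 0%N = initial R r) -> (forall k, admissible B k (st k)) ->
  (forall k, transition B B' (base_at k) k (st k) (st k.+1)) ->
  (forall x, x \in `[0, 1[ -> (forall k, test (st k) x <= 1) -> E x) ->
  ~ uniqueness_set E.
Proof.
move=> [r Est0] adm trans KE uniq.
pose u k xi := coef (cutdens (st k)) xi.
have degr_ge k : (k <= degr (st k))%N.
  by elim: k => // k IH; apply: leq_ltn_trans IH (degr_lt (trans k)).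
have degr_mono k j : (k <= j)%N -> (degr (st k) <= degr (st j))%N.
  move=> kj; rewrite -(subnKC kj); elim: (j - k)%N => [|d IH]; first by rewrite addn0.
  by rewrite addnS; apply: leq_trans IH (ltnW (degr_lt (trans _))).
have ulow k xi : (`|xi| <= degr (st k))%N -> cabs (u k.+1 xi - u k xi) <= 5 * tol R k.
  exact: coef_low (trans k) xi.
have [c Hc] : exists c : int -> R[i], forall xi k, (`|xi| <= degr (st k))%N ->
    cabs (c xi - u k xi) <= 20 * tol R k.
  have /choice[c Hc] : forall xi, exists c : R[i], forall k, (`|xi| <= degr (st k))%N ->
      cabs (c - u k xi) <= 20 * tol R k.
    move=> xi.
    have exk : exists k, (`|xi| <= degr (st k))%N by exists `|xi|%N; exact: degr_ge.
    have [k0 Hk0 Hmin] := ex_minnP exk.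
    have [|c Hc] := @clim_tol R (fun k => u k xi) k0.
      by move=> k kk; apply: ulow; apply: leq_trans Hk0 (degr_mono _ _ kk).
    by exists c => k /Hmin kk; exact: Hc.
  by exists c.
have u0 k xi : (degr (st k) < `|xi|)%N -> u k xi = 0.
  by move=> Hk; apply: coef_deg0 (rtrig_cutdens (adm k)) Hk.
have tolm i j : (i <= j)%N -> tol R j <= tol R i.
  move=> ij; rewrite -(subnKC ij); elim: (j - i)%N => [|d IH]; first by rewrite addn0.
  by rewrite addnS tolS; have := tol_gt0 R (i + d); lra.
(* Such a coefficient is 0 until the frequency comes within the degree. It then jumps once, at a
   stage k >= j, by at most 4/(k+1) + 5 [tol R k], and afterwards moves by summable steps. *)
have ufar j xi k : (degr (st j) < `|xi|)%N ->
    cabs (u k xi) <= 4 / j.+1%:R + 15 * tol R j.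
  move=> jxi; have tj := tol_gt0 R j.
  have a0 : 0 <= 4 / j.+1%:R :> R by rewrite divr_ge0.
  have aE i : (j <= i)%N -> 4 / i.+1%:R <= 4 / j.+1%:R :> R.
    by move=> ji; rewrite ler_wpM2l// lef_pV2 ?posrE// ler_nat ltnS.
  move: (4 / j.+1%:R : R) a0 aE => a a0 aE.
  (* The term - 10 [tol R k] reserves the sum of all later steps for the induction. *)
  suff H : (`|xi| <= degr (st k))%N -> cabs (u k xi) <= a + 15 * tol R j - 10 * tol R k.
    have tk := tol_gt0 R k.
    have [/H xk|/u0 ->] := leqP `|xi|%N (degr (st k)); first by lra.
    by rewrite cabs0; lra.
  elim: k => [|k IH] Hk.
    by have := leq_trans jxi Hk; rewrite ltnNge degr_mono.
  have tk := tol_gt0 R k; rewrite tolS.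
  have [xk|kx] := leqP `|xi|%N (degr (st k)).
    rewrite -[u _ _](subrK (u k xi)); apply: le_trans (cabsD _ _) _.
    by have := ulow k xi xk; have := IH xk; lra.
  have jk : (j <= k)%N.
    rewrite leqNgt; apply/negP => kj; have := leq_trans jxi Hk.
    by rewrite ltnNge degr_mono.
  have := coef_all (trans k) xi; rewrite -/(u k xi) u0// subr0 => H.
  apply: le_trans H _; have := aE k jk.
  by move: (4 / k.+1%:R : R) => b; have := tolm j k jk; lra.
have unif e : 0 < e -> exists M : nat, forall k xi, (M <= `|xi|)%N -> cabs (u k xi) <= e.
  move=> e0; have e2 : 0 < e / 30 by rewrite divr_gt0.
  have [k1 Hk1] := tol_archi e2.
  have e8 : 0 <= 8 / e by rewrite divr_ge0// ltW.
  pose j := maxn k1 (Num.bound (8 / e)).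
  exists (degr (st j)).+1 => k xi Hxi; have H := ufar j xi k Hxi.
  apply: le_trans H _; have := Hk1 j; rewrite /j leq_maxl => /(_ isT) H1.
  have H2 : 4 / j.+1%:R <= e / 2.
    have H3 : 8 / e <= j.+1%:R.
      apply: le_trans (ltW (archi_boundP e8)) _; rewrite ler_nat.
      by apply: leqW; rewrite /j leq_maxr.
    rewrite ler_pdivrMr ?ltr0n//; rewrite ler_pdivrMr// in H3.
    by move: H3; move: (j.+1%:R : R) => y; lra.
  by move: H1 H2; rewrite -/j; move: (4 / j.+1%:R : R) => y; lra.
have lim xi e : 0 < e -> exists k0 : nat, forall k, (k0 <= k)%N -> cabs (c xi - u k xi) <= e.
  move=> e0; have e2 : 0 < e / 20 by rewrite divr_gt0.
  have [k1 Hk1] := tol_archi e2.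
  exists (maxn k1 `|xi|%N) => k; rewrite geq_max => /andP[/Hk1 H1 H2].
  by apply: le_trans (Hc xi k (leq_trans H2 (degr_ge k))) _; lra.
have c0 : c 0 = 0.
  apply: uniq => x x01 nEx.
  have exT : exists k, 1 < test (st k) x.
    apply/not_existsP => H; apply: nEx; apply: KE => // k.
    by rewrite leNgt; apply/negP.
  have Hloc := @localization R (fun k => cutdens (st k)) (fun k => dens (st k))
    (fun k => test (st k)) c x.
  apply/cvgrPdist_le => eps eps0.
  have Eeps : eps = (complex.Re eps)%:C by rewrite RRe_real// gtr0_real.
  have e0 : 0 < complex.Re eps by rewrite -ltcR -Eeps.
  have [N0 HN0] : exists N0 : nat, forall N, (N0 <= N)%N ->
      cabs (trig_sum c x N) <= complex.Re eps; last first.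
    exists N0 => // N /= /HN0 H.
    by rewrite sub0r normrN Eeps cabsE lecR.
  apply: (Hloc _ _ _ _ _ _ _ _ unif lim exT _ e0).
  - by move=> k; exact: rtrigT (rtrig_cutdens (adm k)).
  - by move=> k; exact: rtrigT (rtrig_dens (adm k)).
  - by move=> k; exact: rtrig_test (adm k).
  - by move=> k y; exact: dens_ge0 (adm k) y.
  - by move=> k; exact: mean_dens (adm k).
  - move=> k y; apply: le_trans (test_mono (trans k) y).
    by rewrite lerDl wsum_ge0.
  - by move=> k y; exact: cutdens_le (adm k).
  - move=> k y Ty; have := cutdensP (adm k) y.
    by rewrite cutoff_eq0// mulr0 subr0.
(* Stage 0 is the constant 1, with coefficient 1 at frequency 0, and c 0 lies within 20 / 40 of
   it. *)
have := Hc 0 0%N; rewrite absz0 leq0n c0 => /(_ isT).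
rewrite /u Est0 /= sub0r cabsN /coef (_ : (fun=> _) = ex 0); last first.
  by apply/funext => x; rewrite rmorph1 mul1r.
by rewrite mean_ex eqxx cabs1 /tol expr0 mulr1; lra.
Qed.

(** * Normality *)

(** The Fejer kernel, normalized to mean 1. *)
Definition fejer (R : realType) (m : nat) (y : R) : R :=
  m%:R^-1 * cabs (\sum_(j < m) ex j%:Z y) ^+ 2.

Lemma fejer_ge0 (R : realType) (m : nat) (y : R) : 0 <= fejer m y.
Proof. by rewrite mulr_ge0 ?invr_ge0 ?sqr_ge0. Qed.

Lemma fejerE (R : realType) (m : nat) (y : R) :
  (fejer m y)%:C = m%:R^-1 * \sum_(p : 'I_m * 'I_m) ex (p.1%:Z - p.2%:Z) y.
Proof.
rewrite /fejer rmorphM fmorphV rmorph_nat /= -mulcJ conjc_sum; congr (_ * _).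
have -> : \sum_(j < m) ((ex j%:Z y)^*)%C = \sum_(j < m) ex (- j%:Z) y.
  by apply: eq_bigr => j _; rewrite conj_ex.
by rewrite big_distrlr/= pair_big/=; apply: eq_bigr => p _; rewrite -exD.
Qed.

Lemma fejer_decay (R : realType) (m : nat) (y : R) :
  fejer m y * cabs (ex 1 y - 1) ^+ 2 <= 4 / m%:R.
Proof.
rewrite /fejer -mulrA -exprMn -cabsM mulrC.
have -> : (\sum_(j < m) ex j%:Z y) * (ex 1 y - 1) = ex m%:Z y - 1.
  rewrite mulrC ex_nat subrX1; congr (_ * _); apply: eq_bigr => j _.
  exact: ex_nat.
rewrite ler_wpM2r ?invr_ge0// (_ : 4 = 2 ^+ 2); last by ring.
rewrite lerXn2r ?nnegrE ?cabs_ge0//; apply: le_trans (cabsB _ _) _.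
by rewrite cabs_ex cabs1; lra.
Qed.

(** Nonzero frequencies below m cancel over the m division points. Divided by m, the translates form
    a partition of unity. *)
Lemma sum_fejer (R : realType) (m : nat) (y : R) : (0 < m)%N ->
  \sum_(0 <= d < m) fejer m (y - d%:R / m%:R) = m%:R.
Proof.
move=> m0; have mR : m%:R != 0 :> R[i] by rewrite pnatr_eq0 -lt0n.
apply: (@complexI R); rewrite (rmorph_sum (real_complex R)) rmorph_nat /=.
rewrite big_mkord (eq_bigr (fun d : 'I_m => \sum_(p : 'I_m * 'I_m) m%:R^-1 *
   (ex (p.1%:Z - p.2%:Z) y * ex (- (p.1%:Z - p.2%:Z)) (d%:R / m%:R)))); last first.
  move=> d _; rewrite fejerE mulr_sumr; apply: eq_bigr => p _.
  by rewrite exBx.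
rewrite exchange_big/= (eq_bigr (fun p : 'I_m * 'I_m => (p.1 == p.2)%:R)).
  rewrite -(pair_big xpredT xpredT (fun i j : 'I_m => (i == j)%:R))/=.
  rewrite (eq_bigr (fun=> 1)); first by rewrite sumr_const card_ord.
  move=> i _; rewrite (bigD1 i)//= eqxx big1 ?addr0// => j /negbTE ji.
  by rewrite eq_sym ji.
move=> p _; rewrite -!mulr_sumr.
have Hlt : (`|(- (p.1%:Z - p.2%:Z))%R| < m)%N.
  by case: p => [[i im] [j jm]] /=; lia.
have := avgn_ex R Hlt; rewrite /avgn => H.
have -> : \sum_(d < m) ex (- (p.1%:Z - p.2%:Z)) (d%:R / m%:R : R) =
    (- (p.1%:Z - p.2%:Z) == 0)%:R * m%:R by rewrite -H mulfVK.
rewrite oppr_eq0 subr_eq0 eqz_nat -val_eqE /=; case: eqP => [->|_]; last by rewrite mul0r !mulr0.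
by rewrite subrr ex0 !mul1r mulVf.
Qed.

Lemma rtrig_fejer (R : realType) (m : nat) (z : R) : rtrig setT (fun y => fejer m (y - z)).
Proof.
rewrite /rtrig (_ : (fun=> _) = fun y => m%:R^-1 *
   \sum_(p : 'I_m * 'I_m) ex (- (p.1%:Z - p.2%:Z)) z * ex (p.1%:Z - p.2%:Z) y).
  by apply: trigZ; apply: trig_bigsum => p _ _; apply: trigZ; exact: trig_exp.
apply/funext => y; rewrite fejerE; congr (_ * _); apply: eq_bigr => p _.
by rewrite exBx mulrC.
Qed.

Lemma mean_fejer (R : realType) (m : nat) (z : R) : (0 < m)%N ->
  mean (fun y => fejer m (y - z)) = 1.
Proof.
move=> m0; apply: (@complexI R); rewrite -(rmeanE (rtrig_fejer m z)).
have mR : m%:R != 0 :> R[i] by rewrite pnatr_eq0 -lt0n.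
rewrite (_ : (fun=> _) = fun y => m%:R^-1 * \sum_(p <- index_enum ('I_m * 'I_m)%type)
    ex (- (p.1%:Z - p.2%:Z)) z * ex (p.1%:Z - p.2%:Z) y); last first.
  apply/funext => y; rewrite fejerE; congr (_ * _); apply: eq_bigr => p _.
  by rewrite exBx mulrC.
have te (p : 'I_m * 'I_m) :
    trig setT (fun y : R => ex (- (p.1%:Z - p.2%:Z)) z * ex (p.1%:Z - p.2%:Z) y).
  by apply: trigZ; exact: trig_exp.
rewrite (@meanZ _ setT); last by apply: trig_bigsum => p _ _; exact: te.
rewrite (@mean_sum _ setT); last by move=> p _; exact: te.
rewrite (eq_bigr (fun p : 'I_m * 'I_m => (p.1 == p.2)%:R)).
  rewrite -(pair_big xpredT xpredT (fun i j : 'I_m => (i == j)%:R))/=.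
  rewrite (eq_bigr (fun=> 1)); first by rewrite sumr_const card_ord mulVf.
  move=> i _; rewrite (bigD1 i)//= eqxx big1 ?addr0// => j /negbTE ji.
  by rewrite eq_sym ji.
move=> p _; rewrite (@meanZ _ setT); last exact: trig_exp.
rewrite mean_ex subr_eq0 eqz_nat -val_eqE /=; case: eqP => [->|_]; last by rewrite mulr0.
by rewrite subrr oppr0 ex0 mulr1.
Qed.

Lemma cabs_ex1B1_ge (R : realType) (eps u : R) : 0 < eps -> eps <= u <= 1 - eps ->
  2 - 2 * cos (2 * pi * eps) <= cabs (ex 1 u - 1) ^+ 2.
Proof.
move=> e0 /andP[eu ue]; rewrite cabs_ex1B1.
have pi0 := pi_gt0 R.
have H (v : R) : eps <= v -> v <= 2^-1 -> cos (2 * pi * v) <= cos (2 * pi * eps).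
  move=> ev v2; have b0 : 0 <= 2 * pi * eps by rewrite !mulr_ge0// ltW.
  have b1 : 2 * pi * eps <= 2 * pi * v by rewrite ler_wpM2l// mulr_ge0// ltW.
  have b2 : 2 * pi * v <= pi by nra.
  move: b1; rewrite le_eqVlt => /orP[/eqP -> //|b1]; apply: ltW.
  rewrite ltr_cos// in_itv/=.
    by rewrite b0 (le_trans (ltW b1) b2).
  by rewrite (le_trans b0 (ltW b1)) b2.
have [u2|u2] := leP u 2^-1; first by have := H u eu u2; lra.
have -> : cos (2 * pi * u) = cos (2 * pi * (1 - u)).
  rewrite -[LHS]cosN -[LHS]cosD2pi; congr cos.
  by rewrite -mulr_natl; ring.
have e1 : eps <= 1 - u by lra.
have u3 : 1 - u <= 2^-1 by lra.
by have := H _ e1 u3; lra.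
Qed.

(** P collects the translates of the Fejer kernel centred in the interval enlarged by d0 on both
    sides. All m translates add up to m, and at points of the interval the omitted ones, centred at
    distance at least d0, are at most eps; this gives the lower bound 1 - eps. The integer a
    accounts for periodicity. *)
Lemma interval_majorant (R : realType) (B D : nat) (eps : R) : (1 < B)%N -> (D < B)%N -> 0 < eps ->
  exists P : R -> R, [/\ rtrig setT P, forall y, 0 <= P y, mean P <= B%:R^-1 + eps &
    forall y (a : int), D%:R / B%:R <= y - a%:~R < D.+1%:R / B%:R -> 1 - eps <= P y].
Proof.
move=> B1 DB e0; have B0 : (0 < B)%N by exact: ltnW.
have BR : 1 <= B%:R :> R by rewrite ler1n.
have Hinv : 0 <= 2 / eps by rewrite divr_ge0// ltW.
pose ta := (Num.bound (2 / eps)).+2.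
have ta2 : 2 / eps <= ta%:R.
  apply: ltW; apply: lt_trans (archi_boundP Hinv) _; rewrite ltr_nat; exact: leqnSn.
have taR : 2 <= ta%:R :> R by rewrite ler_nat.
pose d0 := (B%:R * ta%:R)^-1 : R.
have d00 : 0 < d0 by rewrite invr_gt0 mulr_gt0//; lra.
have d01 : 2 * d0 <= 1.
  rewrite /d0 ler_pdivrMr ?mul1r; last by rewrite mulr_gt0//; lra.
  by nra.
pose ka := 2 - 2 * cos (2 * pi * d0).
have ka0 : 0 < ka.
  have d011 : 0 < d0 < 1 by apply/andP; split; lra.
  by have := cosMN_lt1 d011; rewrite /ka; lra.
have Hinv2 : 0 <= 4 / (ka * eps) by rewrite divr_ge0// mulr_ge0// ltW.
pose e := (Num.bound (4 / (ka * eps))).+1.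
have e_ge : 4 / (ka * eps) <= e%:R.
  apply: ltW; apply: lt_trans (archi_boundP Hinv2) _; rewrite ltr_nat.
  exact: ltnSn.
(* Of the m centres, w = m / B correspond to the interval, and e = d0 m enlarge it on either
   side. *)
pose w := (ta * e)%N; pose m := (B * w)%N.
have w0 : (0 < w)%N by rewrite muln_gt0.
have m0 : (0 < m)%N by rewrite muln_gt0 B0.
have mR : 0 < m%:R :> R by rewrite ltr0n.
have eR : 1 <= e%:R :> R by rewrite ler1n.
have em : e%:R / m%:R = d0.
  by rewrite /m /w /d0 !natrM; field; rewrite !gt_eqF//; lra.
have we : (w + e + e <= m)%N.
  apply: (@leq_trans (2 * w)); last by rewrite leq_mul2r B1 orbT.
  by rewrite mul2n -addnn -addnA leq_add2l addnn -mul2n leq_mul2r orbT.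
pose z (d : nat) : R := (D%:R * w%:R - e%:R) / m%:R + d%:R / m%:R.
pose P y := m%:R^-1 * \sum_(0 <= d < w + e + e) fejer m (y - z d).
exists P; split.
- by apply: rtrigZ; apply: rtrig_bigsum => d _ _; exact: rtrig_fejer.
- by move=> y; rewrite mulr_ge0 ?invr_ge0// sumr_ge0// => d _; exact: fejer_ge0.
- rewrite /P (@rmeanZ _ setT); last by apply: rtrig_bigsum => d _ _; exact: rtrig_fejer.
  rewrite (@rmean_sum _ setT); last by move=> d _; exact: rtrig_fejer.
  rewrite (eq_bigr (fun=> 1)); last by move=> d _; rewrite mean_fejer.
  rewrite sumr_const_nat subn0 !natrD.
  have -> : m%:R^-1 * (w%:R + e%:R + e%:R) = B%:R^-1 + 2 * d0 :> R.
    rewrite -em /m natrM; field.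
    by rewrite !gt_eqF ?ltr0n//; lra.
  rewrite lerD2l /d0 invfM mulrCA.
  have H1 : B%:R^-1 <= 1 :> R by rewrite invf_le1//; lra.
  have H2 : 2 * ta%:R^-1 <= eps.
    by rewrite ler_pdivrMr; [rewrite mulrC -ler_pdivrMr|lra].
  have : 0 <= 2 * ta%:R^-1 :> R by rewrite mulr_ge0// invr_ge0.
  move: (B%:R^-1 : R) (2 * ta%:R^-1 : R) H1 H2 => p q; nra.
- move=> y a /andP[y1 y2].
  have Hfull : \sum_(0 <= d < m) fejer m (y - z d) = m%:R.
    rewrite -[RHS](sum_fejer (y - (D%:R * w%:R - e%:R) / m%:R) m0).
    by apply: eq_bigr => d _; rewrite /z opprD addrA.
  have Htail d : (w + e + e <= d < m)%N -> fejer m (y - z d) <= eps.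
    move=> /andP[wd dm]; pose u := - (y - z d - a%:~R).
    have Eu : cabs (ex 1 u - 1) = cabs (ex 1 (y - z d) - 1).
      rewrite /u exN -conj_ex exBx ex_int mulr1.
      by rewrite -[in RHS]cabs_conj rmorphB rmorph1.
    have wdR : w%:R + e%:R + e%:R <= d%:R :> R by rewrite -!natrD ler_nat.
    have dmR : d%:R <= m%:R :> R by rewrite ler_nat ltnW.
    have Ey1 : D%:R * w%:R / m%:R <= y - a%:~R.
      apply: le_trans y1; rewrite le_eqVlt; apply/orP; left; apply/eqP.
      by rewrite /m natrM; field; rewrite !gt_eqF ?ltr0n//; lra.
    have Ey2 : y - a%:~R <= (D%:R + 1) * w%:R / m%:R.
      apply: le_trans (ltW y2) _; rewrite le_eqVlt; apply/orP; left; apply/eqP.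
      by rewrite -natr1 /m natrM; field; rewrite !gt_eqF ?ltr0n//; lra.
    have Hu : u = (D%:R * w%:R - e%:R + d%:R) / m%:R - (y - a%:~R).
      by rewrite /u /z; field; rewrite gt_eqF.
    rewrite ler_pdivrMr// in Ey1; rewrite ler_pdivlMr// in Ey2.
    have u01 : d0 <= u <= 1 - d0.
      rewrite -em Hu; move: (y - a%:~R) Ey1 Ey2 => Y Ey1 Ey2.
      rewrite -(ler_pM2r mR) -[X in _ && X](ler_pM2r mR) !mulrBl !mulfVK ?gt_eqF// mul1r.
      move: Ey1 Ey2 wdR dmR; clear.
      move: (D%:R : R) (w%:R : R) (e%:R : R) (d%:R : R) (m%:R : R) => rD rw re rd rm.
      by move=> *; apply/andP; split; lra.
    have := cabs_ex1B1_ge d00 u01; rewrite Eu -/ka => Hka.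
    have H4 := fejer_decay m (y - z d).
    have me : e%:R <= m%:R :> R.
      by rewrite ler_nat; apply: leq_trans we; rewrite leq_addl.
    have K0 := fejer_ge0 m (y - z d).
    have H5 : fejer m (y - z d) * ka <= 4 / m%:R.
      by apply: le_trans H4; rewrite ler_wpM2l.
    rewrite ler_pdivlMr// in H5; rewrite ler_pdivrMr in e_ge; last by rewrite mulr_gt0.
    have H6 : 4 <= m%:R * (ka * eps).
      by apply: le_trans e_ge _; rewrite ler_wpM2r// mulr_ge0// ltW.
    rewrite -(ler_pM2r (mulr_gt0 ka0 mR)).
    rewrite mulrA; apply: le_trans H5 _; apply: le_trans H6 _.
    by rewrite le_eqVlt; apply/orP; left; apply/eqP; ring.
  have Hs : \sum_(w + e + e <= d < m) fejer m (y - z d) <= m%:R * eps.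
    rewrite big_nat; apply: le_trans (ler_sum _ Htail) _; rewrite -big_nat sumr_const_nat.
    rewrite -[leLHS]mulr_natl ler_wpM2r ?(ltW e0)// ler_nat; exact: leq_subr.
  move: Hfull; rewrite (big_cat_nat (leq0n _) we)/= => Hfull.
  rewrite /P ler_pdivlMl//; move: Hs Hfull.
  by move: (\sum_(0 <= d < _) _) (\sum_(_ <= d < m) _) => p q; lra.
Qed.

Definition orbit_avg (R : realType) (K : numFieldType) (b N : nat) (g : R -> K) (y : R) : K :=
  N%:R^-1 * \sum_(n < N) g (b%:R ^+ n * y).

Lemma orbit_avg_ex (R : realType) (h b N : nat) (y : R) :
  orbit_avg b N (@ex R h%:Z) y = N%:R^-1 * \sum_(n < N) ex (h%:Z * b%:Z ^+ n) y.
Proof.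
congr (_ * _); apply: eq_bigr => n _; rewrite exM; congr (ex _ (_ * _)).
by rewrite rmorphXn.
Qed.

Lemma orbit_avg_trig (R : realType) (b : nat) (y : R) (S : set int) (g : R -> R[i]) :
  trig S g ->
  (forall h : nat, (0 < h)%N -> forall e : R, 0 < e -> exists N0 : nat, forall N, (N0 <= N)%N ->
     cabs (orbit_avg b N (ex h%:Z) y) <= e) ->
  forall e : R, 0 < e -> exists N0 : nat, forall N, (N0 <= N)%N ->
     cabs (orbit_avg b N g y - mean g) <= e.
Proof.
move=> [l [_ ->]] Hy.
have Hex (k : int) e : 0 < e -> exists N0 : nat, forall N, (N0 <= N)%N ->
    cabs (orbit_avg b N (ex k) y - (k == 0)%:R) <= e.
  move=> e0; have [->|k0] := eqVneq k 0.
    exists 1%N => N N1; rewrite /orbit_avg (eq_bigr (fun=> 1)); last by move=> n _; rewrite ex0.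
    by rewrite sumr_const card_ord mulVf ?subrr ?cabs0 ?ltW// pnatr_eq0 -lt0n.
  have hk : (0 < `|k|)%N by rewrite absz_gt0.
  have [N0 HN0] := Hy _ hk _ e0; exists N0 => N /HN0; rewrite subr0.
  case: (k) => h //; rewrite NegzE abszN absz_nat => H; apply: le_trans H.
  rewrite -[leRHS]cabs_conj le_eqVlt; apply/orP; left; apply/eqP; congr cabs.
  rewrite /orbit_avg (rmorphM (@conjc R)); congr (_ * _).
    by rewrite /= conjc_inv conjc_nat.
  apply: (etrans _ (esym (conjc_sum _ _ _))).
  by apply: eq_bigr => n _; rewrite conj_ex.
elim: l => [|q l IH] e e0.
  exists 0%N => N _; rewrite (_ : (fun=> _) = fun=> 0); last by apply/funext => x; rewrite big_nil.
  by rewrite /orbit_avg big1// mulr0 (hasmeanE (hasmean0 R _)) subrr cabs0 ltW.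
have c0 : 0 < 2 * (cabs q.1 + 1) by have := cabs_ge0 q.1; lra.
have [N1 HN1] := Hex q.2 _ (divr_gt0 e0 c0).
have e2 : 0 < e / 2 by rewrite divr_gt0.
have [N2 HN2] := IH _ e2.
exists (maxn N1 N2) => N; rewrite geq_max => /andP[/HN1 H1 /HN2 H2].
have tl : trig setT (fun x : R => \sum_(q0 <- l) q0.1 * ex q0.2 x).
  by apply: trig_bigsum => p _ _; apply: trigZ; exact: trig_exp.
have tq : trig setT (fun x : R => q.1 * ex q.2 x) by apply: trigZ; exact: trig_exp.
have -> : (fun x : R => \sum_(q0 <- q :: l) q0.1 * ex q0.2 x) =
   fun x => q.1 * ex q.2 x + \sum_(q0 <- l) q0.1 * ex q0.2 x.
  by apply/funext => x; rewrite big_cons.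
rewrite (meanD tq tl) (@meanZ _ setT); last exact: trig_exp.
rewrite mean_ex.
have -> : orbit_avg b N (fun x : R => q.1 * ex q.2 x + \sum_(q0 <- l) q0.1 * ex q0.2 x) y =
   q.1 * orbit_avg b N (ex q.2) y +
   orbit_avg b N (fun x : R => \sum_(q0 <- l) q0.1 * ex q0.2 x) y.
  by rewrite /orbit_avg big_split/= mulrDr -mulr_sumr mulrCA.
rewrite opprD addrACA -mulrBr; apply: le_trans (cabsD _ _) _; rewrite cabsM.
rewrite ler_pdivlMr// in H1.
have := cabs_ge0 q.1; have := cabs_ge0 (orbit_avg b N (ex q.2) y - (q.2 == 0)%:R).
move: H1 H2; move: (cabs _) => A; move: (cabs _) => C; move: (cabs q.1) => E.
nra.
Qed.

(** * Digit blocks as residues modulo b^k *)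

Definition radix (b t i : nat) : nat := ((t %/ b ^ i) %% b)%N.

Lemma radix_inj (b k t t' : nat) : (1 < b)%N ->
  (forall i, (i < k)%N -> radix b t i = radix b t' i) -> (t %% b ^ k = t' %% b ^ k)%N.
Proof.
move=> b1; elim: k => [|k IH] H; first by rewrite expn0 !modn1.
have E u : (u %% b ^ k.+1 = radix b u k * b ^ k + u %% b ^ k)%N.
  rewrite {1}(divn_eq u (b ^ k)) {1}(divn_eq (u %/ b ^ k) b) -/(radix b u k).
  rewrite mulnDl -mulnA -expnS -addnA modnMDl modn_small//.
  have bk : (0 < b ^ k)%N by rewrite expn_gt0 ltnW.
  have r1 : (radix b u k < b)%N by rewrite ltn_mod ltnW.
  have := ltn_pmod u bk; move=> H2.
  apply: (@leq_trans (radix b u k * b ^ k + b ^ k)%N); first by rewrite ltn_add2l.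
  by rewrite -mulSnr expnS leq_mul2r r1 orbT.
rewrite !E IH; first by rewrite H.
by move=> i ik; apply: H; rewrite ltnW.
Qed.

Definition trunc_at (R : realType) (b : nat) (y : R) (j : nat) : nat :=
  Num.truncn (b%:R ^+ j * y).

Lemma trunc_at_itv (R : realType) (b : nat) (y : R) j : 0 <= y ->
  (trunc_at b y j)%:R <= b%:R ^+ j * y < (trunc_at b y j).+1%:R.
Proof. by move=> y0; apply: truncn_itv; rewrite mulr_ge0// exprn_ge0. Qed.

Lemma trunc_at_div (R : realType) (b : nat) (y : R) n m : (1 < b)%N -> 0 <= y ->
  trunc_at b y n = (trunc_at b y (n + m) %/ b ^ m)%N.
Proof.
move=> b1 y0; have /andP[t1 t2] := trunc_at_itv b (n + m) y0.
set t := trunc_at b y (n + m) in t1 t2 *.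
have bm : (0 < b ^ m)%N by rewrite expn_gt0 ltnW.
have bR : 0 < (b ^ m)%:R :> R by rewrite ltr0n.
rewrite exprD mulrAC -[b%:R ^+ m]natrX in t1 t2; apply: truncn_def; apply/andP; split.
  rewrite -(ler_pM2r bR); apply: le_trans t1; rewrite -natrM ler_nat.
  exact: leq_divM.
rewrite -(ltr_pM2r bR); apply: lt_le_trans t2 _; rewrite -natrM ler_nat.
exact: ltn_ceil.
Qed.

(** The digits n+1, ..., n+k read as one integer; normality becomes a statement on counts of
    integers below b^k. *)
Definition residue (R : realType) (b k : nat) (y : R) (n : nat) : nat :=
  (trunc_at b y (n + k) %% b ^ k)%N.

Definition res_count (R : realType) (b k : nat) (y : R) (D N : nat) : nat :=
  #|[set n : 'I_N | residue b k y n == D]%SET|.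

(** The tuple lists the leading digit first, hence the reversed index. *)
Definition digits_of (b k : nat) (b1 : (0 < b)%N) (t : nat) : k.-tuple 'I_b :=
  [tuple Ordinal (ltn_pmod (t %/ b ^ (k.-1 - i)) b1) | i < k].

Lemma digits_ofE (b k : nat) (b1 : (0 < b)%N) (t : nat) (i : 'I_k) :
  val (tnth (digits_of k b1 t) i) = radix b t (k.-1 - i).
Proof. by rewrite tnth_mktuple. Qed.

Lemma digits_of_inj (b k t t' : nat) (b0 : (0 < b)%N) : (1 < b)%N ->
  digits_of k b0 t = digits_of k b0 t' -> (t %% b ^ k = t' %% b ^ k)%N.
Proof.
move=> b1 E; apply: radix_inj => // i ik.
have ik' : (k.-1 - i < k)%N by lia.
have := congr1 (fun d : k.-tuple 'I_b => val (tnth d (Ordinal ik'))) E.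
by rewrite !digits_ofE /=; have -> : (k.-1 - (k.-1 - i) = i)%N by lia.
Qed.

Lemma digits_of_bij (b k : nat) (b0 : (0 < b)%N) : (1 < b)%N ->
  forall d : k.-tuple 'I_b, exists2 D, (D < b ^ k)%N & digits_of k b0 D = d.
Proof.
move=> b1 d; pose f (D : 'I_(b ^ k)) := digits_of k b0 D.
have f_inj : injective f.
  move=> D D' /(digits_of_inj b1); rewrite !modn_small ?ltn_ord// => H.
  exact: val_inj.
have f_bij : bijective f.
  by apply: inj_card_bij f_inj _; rewrite card_tuple !card_ord.
by case: f_bij => g _ fg; exists (g d); rewrite ?ltn_ord//; exact: fg.
Qed.

Lemma digits_of_residue (b k t D : nat) (b0 : (0 < b)%N) : (1 < b)%N -> (D < b ^ k)%N ->
  (digits_of k b0 t == digits_of k b0 D) = (t %% b ^ k == D)%N.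
Proof.
move=> b1 Dk; apply/eqP/eqP => [/(digits_of_inj b1)|tD].
  by rewrite (modn_small Dk).
have [D' D'k E] := digits_of_bij b0 b1 (digits_of k b0 t).
by rewrite -E; congr digits_of; move/(digits_of_inj b1): E; rewrite modn_small// tD.
Qed.

Lemma block_countE (R : realType) (b k D N : nat) (b0 : (0 < b)%N) (y : R) : (1 < b)%N ->
  0 <= y -> (D < b ^ k)%N ->
  block_count y (digits_of k b0 D) N = res_count b k y D N.
Proof.
move=> b1 y0 Dk; rewrite /block_count /res_count; congr #|pred_of_set _|.
apply/setP => n; rewrite !inE /residue -(digits_of_residue _ b0 b1 Dk).
have idx (i : 'I_k) : (n.+1 + i + (k.-1 - i) = n + k)%N by have := ltn_ord i; lia.
apply/forallP/eqP => [H|E i].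
  apply: eq_from_tnth => i; apply: val_inj.
  apply: (etrans _ (eqP (H i))); rewrite digits_ofE /digit.
  by rewrite -[Num.truncn _]/(trunc_at b y _) (@trunc_at_div R b y (n.+1 + i) (k.-1 - i) b1 y0) idx.
rewrite -E digits_ofE /digit -[Num.truncn _]/(trunc_at b y _).
by rewrite (@trunc_at_div R b y (n.+1 + i) (k.-1 - i) b1 y0) idx.
Qed.

Lemma normalE (R : realType) (b : nat) (x : R) : (1 < b)%N ->
  normal b x <-> forall k D, (0 < k)%N -> (D < b ^ k)%N ->
    (res_count b k (Defs.frac x) D N)%:R / N%:R @[N --> \oo] --> (b%:R ^- k : R).
Proof.
move=> b1; have b0 := ltnW b1.
have y0 : 0 <= Defs.frac x by rewrite subr_ge0; exact: floor_le.
have E k D : (D < b ^ k)%N ->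
    (fun N => (block_count (Defs.frac x) (digits_of k b0 D) N)%:R / N%:R : R) =
    (fun N => (res_count b k (Defs.frac x) D N)%:R / N%:R).
  by move=> Dk; apply/funext => N; rewrite block_countE.
split=> [nx k D k0 Dk|H k d k0]; first by rewrite -E//; exact: nx.
by have [D Dk <-] := digits_of_bij b0 b1 d; rewrite E//; exact: H.
Qed.

Lemma residue_itv (R : realType) (b k n : nat) (y : R) : (1 < b)%N -> 0 <= y ->
  (residue b k y n)%:R / (b ^ k)%:R <= b%:R ^+ n * y - (trunc_at b y n)%:Z%:~R <
    (residue b k y n).+1%:R / (b ^ k)%:R.
Proof.
move=> b1 y0; have bR : 0 < (b ^ k)%:R :> R by rewrite ltr0n expn_gt0 ltnW.
have /andP[t1 t2] := trunc_at_itv b (n + k) y0.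
rewrite (@trunc_at_div _ b y n k b1 y0) /residue.
set t := trunc_at b y (n + k) in t1 t2 *.
have Et : t%:R = (t %/ b ^ k)%N%:R * (b ^ k)%:R + (t %% b ^ k)%N%:R :> R.
  by rewrite -natrM -natrD -divn_eq.
rewrite exprD mulrAC -[b%:R ^+ k]natrX -natr1 in t1 t2; rewrite -[_%:Z%:~R]/(_%:R).
rewrite ler_pdivrMr// ltr_pdivlMr// mulrBl -natr1; rewrite Et in t1 t2.
by move: t1 t2; set A := _ * y * _; set B := _ * (b ^ k)%:R; move=> *; apply/andP; split; lra.
Qed.

Lemma sum_res_count (R : realType) (b k : nat) (y : R) N : (1 < b)%N ->
  \sum_(D < b ^ k) (res_count b k y D N)%:R = N%:R :> R.
Proof.
move=> b1; have bk : (0 < b ^ k)%N by rewrite expn_gt0 ltnW.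
rewrite -natr_sum; congr _%:R; rewrite -[RHS]card_ord -sum1_card.
rewrite (partition_big (fun n : 'I_N => Ordinal (ltn_pmod (trunc_at b y (n + k)) bk)) xpredT)//=.
apply: eq_bigr => D _; rewrite /res_count -sum1_card; apply: eq_bigl => n.
by rewrite inE -val_eqE.
Qed.

Lemma sum_residue (R : realType) (K : numFieldType) (b k N : nat) (y : R) (g : nat -> K) :
  (1 < b)%N ->
  \sum_(n < N) g (residue b k y n) = \sum_(D < b ^ k) (res_count b k y D N)%:R * g D.
Proof.
move=> b1; have bk : (0 < b ^ k)%N by rewrite expn_gt0 ltnW.
rewrite (partition_big (fun n : 'I_N => Ordinal (ltn_pmod (trunc_at b y (n + k)) bk)) xpredT)//=.
apply: eq_bigr => D _.
rewrite (eq_bigr (fun=> g D)); last by move=> n /eqP <-.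
rewrite mulr_natl -sumr_const; apply: eq_bigl => n.
by rewrite inE -val_eqE.
Qed.

(** * Weyl's criterion *)

Lemma wavg_frac (R : realType) (h b N : nat) (x : R) :
  orbit_avg b N (ex h%:Z) (Defs.frac x) = wavg h b N x.
Proof.
by rewrite orbit_avg_ex /wavg; congr (_ * _); apply: eq_bigr => n _; rewrite ex_frac.
Qed.

Lemma frac_ge0 (R : realType) (x : R) : 0 <= Defs.frac x.
Proof. by rewrite subr_ge0; exact: floor_le. Qed.

(** The majorant gives an upper bound only; [weyl_normal] obtains the lower one from the total
    count. *)
Lemma weyl_res_le (R : realType) (b k D : nat) (x : R) : (1 < b)%N -> (0 < k)%N ->
  (D < b ^ k)%N ->
  (forall h : nat, (0 < h)%N -> forall e : R, 0 < e -> exists N0 : nat, forall N, (N0 <= N)%N ->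
     cabs (wavg h b N x) <= e) ->
  forall e : R, 0 < e -> exists N0 : nat, forall N, (N0 <= N)%N ->
    (res_count b k (Defs.frac x) D N)%:R / N%:R <= b%:R ^- k + e.
Proof.
move=> b1 k0 Dk Hx e e0; set y := Defs.frac x.
have y0 : 0 <= y := frac_ge0 x.
have B1 : (1 < b ^ k)%N by rewrite -(expn0 b) ltn_exp2l.
have e4 : 0 < e / 4 by rewrite divr_gt0.
have [P [tP P0 mP HP]] := interval_majorant B1 Dk e4.
have Hy : forall h : nat, (0 < h)%N -> forall e : R, 0 < e -> exists N0 : nat,
    forall N, (N0 <= N)%N -> cabs (orbit_avg b N (ex h%:Z) y) <= e.
  move=> h h0 e' e'0; have [N0 H] := Hx h h0 e' e'0.
  by exists N0 => N /H; rewrite wavg_frac.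
have [N0 HN0] := orbit_avg_trig tP Hy e4.
exists (maxn N0 1) => N; rewrite geq_max => /andP[/HN0 H N1].
have NR : 0 < N%:R :> R by rewrite ltr0n.
have avgP : orbit_avg b N P y <= b%:R ^- k + e / 2.
  have E : orbit_avg b N (fun x => (P x)%:C) y = (orbit_avg b N P y)%:C.
    rewrite /orbit_avg rmorphM fmorphV rmorph_nat /=; congr (_ * _).
    by rewrite (rmorph_sum (real_complex R)).
  move: H; rewrite E (rmeanE tP) -rmorphB cabsR ler_norml natrX in mP * => /andP[_ H].
  by move: mP H; set c := b%:R ^- k; lra.
have Hc : (res_count b k y D N)%:R * (1 - e / 4) <= N%:R * orbit_avg b N P y.
  rewrite /orbit_avg mulrA mulfV ?gt_eqF// mul1r /res_count -sum1_card natr_sum mulr_suml.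
  rewrite [leRHS](bigID (fun n : 'I_N => residue b k y n == D))/=.
  rewrite -[leLHS]addr0 lerD//; last by apply: sumr_ge0.
  rewrite (eq_bigl (fun n : 'I_N => residue b k y n == D)); last by move=> n; rewrite inE.
  apply: ler_sum => n /eqP nD; rewrite mul1r; apply: (HP _ (trunc_at b y n)%:Z).
  by rewrite -nD; exact: residue_itv.
have cN : (res_count b k y D N)%:R <= N%:R :> R.
  by rewrite ler_nat -[leqRHS]card_ord max_card.
rewrite ler_pdivrMr//.
have H2 : N%:R * orbit_avg b N P y <= N%:R * (b%:R ^- k + e / 2) by rewrite ler_wpM2l// ltW.
move: Hc H2 cN; move: (res_count _ _ _ _ _)%:R (N%:R * orbit_avg _ _ _ _) (b%:R ^- k).
move=> rc o p; nra.
Qed.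

(** The frequencies of all residues sum to 1, so upper bounds for the others give a lower bound for
    one. Errors of e / b^k keep the total below e. *)
Lemma weyl_normal (R : realType) (b : nat) (x : R) : (1 < b)%N ->
  (forall h : nat, (0 < h)%N -> forall e : R, 0 < e -> exists N0 : nat, forall N, (N0 <= N)%N ->
     cabs (wavg h b N x) <= e) ->
  normal b x.
Proof.
move=> b1 Hx; apply/(normalE x b1) => k D k0 Dk; set y := Defs.frac x.
have bk : (0 < b ^ k)%N by rewrite expn_gt0 ltnW.
have bR : 0 < (b ^ k)%:R :> R by rewrite ltr0n.
apply/cvgrPdist_le => e e0.
have eb : 0 < e / (b ^ k)%:R by rewrite divr_gt0.
have /choice[N0 HN0] : forall D : 'I_(b ^ k), exists N0 : nat, forall N, (N0 <= N)%N ->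
    (res_count b k y D N)%:R / N%:R <= b%:R ^- k + e / (b ^ k)%:R.
  by move=> D'; exact: (weyl_res_le b1 k0 (ltn_ord D') Hx eb).
exists (maxn (\max_(D' < b ^ k) N0 D') 1)%N => // N /=; rewrite geq_max => /andP[HN N1].
have NR : 0 < N%:R :> R by rewrite ltr0n.
have up (D' : 'I_(b ^ k)) : (res_count b k y D' N)%:R / N%:R <= b%:R ^- k + e / (b ^ k)%:R.
  by apply: HN0; apply: leq_trans HN; exact: (leq_bigmax D').
have S1 : \sum_(D' < b ^ k) (res_count b k y D' N)%:R / N%:R = 1 :> R.
  by rewrite -mulr_suml sum_res_count// mulfV ?gt_eqF.
rewrite ler_distlC; apply/andP; split; last first.
  apply: le_trans (up (Ordinal Dk)) _; rewrite lerD2l ler_pdivrMr//.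
  by apply: ler_peMr; [exact: ltW|rewrite ler1n].
rewrite (bigD1 (Ordinal Dk))//= in S1.
have S2 : \sum_(D' < b ^ k | D' != Ordinal Dk) (res_count b k y D' N)%:R / N%:R <=
    ((b ^ k)%:R - 1) * (b%:R ^- k + e / (b ^ k)%:R).
  apply: le_trans (ler_sum _ (fun D' _ => up D')) _.
  rewrite sumr_const cardC1 card_ord -[leLHS]mulr_natl.
  by rewrite -subn1 natrB.
rewrite lerBlDr -[leLHS]addr0.
have E : ((b ^ k)%:R - 1) * (b%:R ^- k + e / (b ^ k)%:R) =
    1 - b%:R ^- k + e - e / (b ^ k)%:R.
  by rewrite -natrX; field; rewrite gt_eqF.
rewrite E in S2; move: S1 S2 eb; move: (\sum_(_ < _ | _) _) (_ / N%:R) (e / _) (b%:R ^- k).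
move=> A p q c; lra.
Qed.

Lemma ex_near0 (R : realType) (e : R) : 0 < e ->
  exists2 d : R, 0 < d & forall u, `|u| < d -> cabs (ex 1 u - 1) <= e.
Proof.
move=> e0; have c0 : {for 0, continuous (fun u : R => cos (2 * pi * u))}.
  by apply: continuous_comp; [exact: mulrl_continuous|exact: continuous_cos].
have e2 : 0 < e ^+ 2 / 2 by rewrite divr_gt0// exprn_gt0.
move/cvgrPdist_lt : c0 => /(_ _ e2); rewrite mulr0 cos0 => -[d d0 Hd].
exists d => // u ud.
have : `|1 - cos (2 * pi * u)| < e ^+ 2 / 2 by apply: Hd; rewrite /= sub0r normrN.
rewrite ltr_norml => /andP[_ H].
have := cabs_ex1B1 u; have := cabs_ge0 (ex 1 u - 1); move: (cabs _) => z z0 Hz.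
move: (cos _) H Hz => c H Hz; rewrite leNgt; apply/negP => ez.
have ze : 0 < (z - e) * (z + e) by apply: mulr_gt0; lra.
have : (z - e) * (z + e) = z ^+ 2 - e ^+ 2 by ring.
by move: ze H; rewrite Hz; move: (_ * _) (e ^+ 2) => p q; lra.
Qed.

(** Truncating b^n y to its k leading digits after the point turns the average into a sum over
    b^k-th roots of unity, which cancels when all residues are nearly equally frequent. The
    frequency h = 1 is where the constructed bias sits. *)
Lemma normal_weyl (R : realType) (b : nat) (x : R) : (1 < b)%N -> normal b x ->
  forall e : R, 0 < e -> exists N0 : nat, forall N, (N0 <= N)%N -> cabs (wavg 1 b N x) <= e.
Proof.
move=> b1 /(normalE x b1) nx e e0; set y := Defs.frac x in nx *.
have y0 : 0 <= y := frac_ge0 x.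
have e2 : 0 < e / 2 by rewrite divr_gt0.
have [d d0 Hd] := ex_near0 e2.
have [k k0 Hk] : exists2 k, (0 < k)%N & (b ^ k)%:R^-1 < d.
  have di : 0 <= d^-1 by rewrite invr_ge0 ltW.
  exists (Num.bound d^-1).+1 => //; rewrite invf_plt ?posrE// ?ltr0n ?expn_gt0 ?(ltnW b1)//.
  apply: lt_trans (archi_boundP di) _; rewrite ltr_nat.
  by apply: ltn_trans (ltnSn _) (ltn_expl _ b1).
have bk1 : (1 < b ^ k)%N by rewrite -(expn0 b) ltn_exp2l.
have bk : (0 < b ^ k)%N by exact: ltnW.
have bR : 0 < (b ^ k)%:R :> R by rewrite ltr0n.
have eb : 0 < e / 2 / (b ^ k)%:R by rewrite divr_gt0.
have /choice[N0 HN0] : forall D : 'I_(b ^ k), exists N0 : nat, forall N, (N0 <= N)%N ->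
    `|(res_count b k y D N)%:R / N%:R - b%:R ^- k| <= e / 2 / (b ^ k)%:R.
  move=> D; have /cvgrPdist_le /(_ _ eb) [N0 _ H] := nx k D k0 (ltn_ord D).
  by exists N0 => N /H; rewrite distrC.
exists (maxn (\max_(D' < b ^ k) N0 D') 1)%N => N; rewrite geq_max => /andP[HN N1].
have NR : 0 < N%:R :> R by rewrite ltr0n.
have NC : N%:R != 0 :> R[i] by rewrite pnatr_eq0 -lt0n.
rewrite -wavg_frac -/y.
pose c (D : nat) : R[i] := ex 1 (D%:R / (b ^ k)%:R : R).
have S0 : \sum_(D < b ^ k) c D = 0.
  have := @avgn_ex R 1 (b ^ k) bk1; rewrite /avgn => /eqP.
  rewrite mulf_eq0 invr_eq0 pnatr_eq0 -[(_ ^ _ == 0)%N]negbK -lt0n bk orbF => /eqP H.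
  by rewrite -[RHS]H; apply: eq_bigr.
pose A := N%:R^-1 * \sum_(n < N) c (residue b k y n).
have HA : cabs A <= e / 2.
  have -> : A = \sum_(D < b ^ k)
      ((res_count b k y D N)%:R / N%:R - b%:R ^- k)%:C * c D.
    rewrite /A sum_residue// mulr_sumr.
    transitivity (\sum_(D < b ^ k) ((res_count b k y D N)%:R / N%:R : R)%:C * c D -
        (b%:R ^- k : R)%:C * \sum_(D < b ^ k) c D).
      rewrite S0 mulr0 subr0; apply: eq_bigr => D _.
      by rewrite rmorphM fmorphV !rmorph_nat; ring.
    by rewrite mulr_sumr -sumrB; apply: eq_bigr => D _; rewrite rmorphB mulrBl.
  apply: le_trans (cabs_sum _ _ _) _.
  apply: (@le_trans _ _ (\sum_(D < b ^ k) e / 2 / (b ^ k)%:R)).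
    apply: ler_sum => D _; rewrite cabsM cabs_ex mulr1 cabsR; apply: HN0.
    by apply: leq_trans HN; exact: (leq_bigmax D).
  rewrite sumr_const card_ord -[leLHS]mulr_natr -mulrA mulVf ?mulr1 ?gt_eqF//.
have HB : cabs (orbit_avg b N (ex 1) y - A) <= e / 2.
  rewrite /orbit_avg /A -mulrBr -sumrB cabsM cabsV cabs_nat ler_pdivrMl//.
  apply: le_trans (cabs_sum _ _ _) _.
  apply: (@le_trans _ _ (\sum_(n < N) e / 2)).
    apply: ler_sum => n _; set z := b%:R ^+ n * y.
    have /andP[z1 z2] := residue_itv k n b1 y0.
    rewrite -/z in z1 z2; set t := trunc_at b y n in z1 z2; set D := residue b k y n in z1 z2 *.
    have -> : cabs (ex 1 z - c D) = cabs (ex 1 (z - t%:Z%:~R - D%:R / (b ^ k)%:R) - 1).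
      have E1 : ex 1 (z - t%:Z%:~R - D%:R / (b ^ k)%:R) * c D = ex 1 z.
        by rewrite /c -exDx subrK exBx -conj_ex ex_int conjc1 mulr1.
      rewrite -E1 -[X in _ - X]mul1r -mulrBl cabsM.
      by rewrite [X in _ * X]cabs_ex mulr1.
    apply: Hd; rewrite ger0_norm ?subr_ge0//; apply: lt_trans Hk.
    move: z2; rewrite -natr1 mulrDl mul1r; lra.
  by rewrite sumr_const card_ord -[leLHS]mulr_natl.
rewrite -[orbit_avg _ _ _ _](subrK A); apply: le_trans (cabsD _ _) _.
by rewrite (splitr e) lerD.
Qed.

(** * From a finite series of weighted squares to vanishing averages *)

Definition wsum_exp (R : realType) (h b N : nat) (x : R) : R[i] :=
  \sum_(0 <= i < N) ex (h%:Z * b%:Z ^+ i) x.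

Lemma cabs_wavg (R : realType) (h b N : nat) (x : R) :
  cabs (wavg h b N x) = N%:R^-1 * cabs (wsum_exp h b N x).
Proof. by rewrite /wavg /wsum_exp big_mkord cabsM cabsV cabs_nat. Qed.

Lemma wsum_exp_dist (R : realType) (h b N M : nat) (x : R) : (N <= M)%N ->
  cabs (wsum_exp h b N x) - (M - N)%:R <= cabs (wsum_exp h b M x).
Proof.
move=> NM; rewrite lerBlDr.
have -> : wsum_exp h b N x = wsum_exp h b M x - \sum_(N <= i < M) ex (h%:Z * b%:Z ^+ i) x.
  by rewrite /wsum_exp [X in X - _](big_cat_nat (leq0n N) NM)/= addrK.
apply: le_trans (cabsB _ _) _; rewrite lerD2l; apply: le_trans (cabs_sum _ _ _) _.
by under eq_bigr do rewrite cabs_ex; rewrite sumr_const_nat.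
Qed.

(** Each further index changes the exponential sum by at most 1, so a large average at N persists up
    to N + N / d. At least N / (2d) terms of size at least 1 / (8 d^2 N) contribute an amount
    independent of N. *)
Lemma wterm_window (R : realType) (h b d N : nat) (x : R) : (0 < d)%N -> (d <= N)%N ->
  2 / d%:R <= cabs (wavg h b N x) ->
  (16 * d%:R ^+ 3)^-1 <= \sum_(N <= i < N + N %/ d) wterm h b i.+1 x.
Proof.
move=> d0 dN; have N0 : (0 < N)%N by exact: leq_trans dN.
have NR : 0 < N%:R :> R by rewrite ltr0n.
have dR : 0 < d%:R :> R by rewrite ltr0n.
rewrite cabs_wavg => HN.
have HS : 2 * N%:R / d%:R <= cabs (wsum_exp h b N x).
  by rewrite ler_pdivlMl// in HN; apply: le_trans HN; rewrite le_eqVlt; apply/orP; left; apply/eqP; ring.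
have Ndle : (N %/ d)%:R <= N%:R / d%:R :> R.
  by rewrite ler_pdivlMr// -natrM ler_nat leq_divM.
have Hi i : (N <= i < N + N %/ d)%N ->
    (8 * d%:R ^+ 2 * N%:R)^-1 <= wterm h b i.+1 x.
  move=> /andP[Ni iN]; have i0 : 0 < i.+1%:R :> R by rewrite ltr0n.
  have i2 : i.+1%:R <= 2 * N%:R :> R.
    by rewrite -natrM ler_nat; have := leq_div N d; lia.
  have Hd : (i.+1 - N)%N%:R <= N%:R / d%:R :> R.
    by apply: le_trans Ndle; rewrite ler_nat; lia.
  have HSi : N%:R / d%:R <= cabs (wsum_exp h b i.+1 x).
    have := wsum_exp_dist h b x (leqW Ni).
    have E : 2 * N%:R / d%:R = N%:R / d%:R + N%:R / d%:R :> R by ring.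
    by rewrite E in HS; lra.
  have Nd0 : 0 <= N%:R / d%:R :> R by rewrite divr_ge0.
  rewrite /wterm cabs_wavg exprMn.
  have -> : (8 * d%:R ^+ 2 * N%:R)^-1 = (2 * N%:R) ^- 3 * (N%:R / d%:R) ^+ 2 :> R.
    by field; rewrite !gt_eqF.
  rewrite (_ : i.+1%:R^-1 * _ = i.+1%:R ^- 3 * cabs (wsum_exp h b i.+1 x) ^+ 2); last first.
    by field; rewrite gt_eqF.
  have N20 : 0 < 2 * N%:R :> R by rewrite mulr_gt0.
  apply: ler_pM.
  - by rewrite invr_ge0 exprn_ge0// ltW.
  - by rewrite exprn_ge0.
  - rewrite lef_pV2 ?posrE ?exprn_gt0//.
    by apply: lerXn2r i2; rewrite nnegrE ltW.
  - by apply: lerXn2r HSi; rewrite nnegrE ?cabs_ge0.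
apply: (@le_trans _ _ (\sum_(N <= i < N + N %/ d) (8 * d%:R ^+ 2 * N%:R)^-1)); last first.
  by rewrite big_nat [leRHS]big_nat; exact: ler_sum.
rewrite sumr_const_nat addKn -[leRHS]mulr_natl.
have H2 : N%:R / (2 * d%:R) <= (N %/ d)%:R :> R.
  rewrite ler_pdivrMr ?mulr_gt0// -!natrM ler_nat.
  have := ltn_ceil N d0; have : (0 < N %/ d)%N by rewrite divn_gt0.
  by move: (N %/ d)%N => q; nia.
apply: le_trans (ler_wpM2r _ H2); last by rewrite invr_ge0 !mulr_ge0 ?exprn_ge0// ltW.
by rewrite le_eqVlt; apply/orP; left; apply/eqP; field; rewrite !gt_eqF.
Qed.

(* The criterion of Davenport, Erdos and LeVeque. *)
Lemma wavg_lim0 (R : realType) (h b r : nat) (x : R) :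
  (forall r', \sum_(r <= N < r') wterm h b N.+1 x <= 1) ->
  forall e : R, 0 < e -> exists N0 : nat, forall N, (N0 <= N)%N -> cabs (wavg h b N x) <= e.
Proof.
move=> Hsum e e0; apply: contrapT => /forallNP Hno.
have e2 : 0 <= 2 / e by rewrite divr_ge0// ltW.
pose d := (Num.bound (2 / e)).+1.
have d2 : 2 / d%:R <= e.
  rewrite ler_pdivrMr ?ltr0n// mulrC -ler_pdivrMr//.
  by apply: ltW; apply: lt_le_trans (archi_boundP e2) _; rewrite ler_nat; exact: leqnSn.
have bad N0 : exists2 N, (N0 <= N)%N & 2 / d%:R <= cabs (wavg h b N x).
  have /existsNP[N /not_implyP[N0N /negP]] := Hno N0.
  by rewrite -ltNge => H; exists N => //; apply: le_trans d2 (ltW H).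
pose eta : R := (16 * d%:R ^+ 3)^-1.
have grow J : exists2 M, (r <= M)%N & J%:R * eta <= \sum_(r <= N < M) wterm h b N.+1 x.
  elim: J => [|J [M rM HM]]; first by exists r; rewrite // big_geq// mul0r.
  have [N] := bad (maxn M d); rewrite geq_max => /andP[MN dN] HN.
  have rN := leq_trans rM MN; have NN := leq_addr (N %/ d) N.
  exists (N + N %/ d)%N; first exact: leq_trans NN.
  rewrite (big_cat_nat rN NN)/= (big_cat_nat rM MN)/= -natr1 mulrDl mul1r -addrA.
  apply: lerD => //; rewrite -[leLHS]add0r; apply: lerD.
    by apply: sumr_ge0 => i _; exact: wterm_ge0.
  exact: (wterm_window _ dN HN).
have [M _ HM] := grow (16 * d ^ 3).+1.
have := le_trans HM (Hsum M).
have eta0 : 0 < eta by rewrite invr_gt0 mulr_gt0 ?exprn_gt0 ?ltr0n.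
rewrite -natr1 mulrDl mul1r natrM natrX /eta mulfV; first by rewrite -/eta; lra.
by rewrite mulf_neq0 ?expf_neq0 ?pnatr_eq0.
Qed.

(** * Points at which all tests are at most 1 *)

Lemma pair_of_pickle (p : nat * nat) : pair_of (pickle p) = p.
Proof. by rewrite /pair_of pickleK. Qed.

(** Pigeonhole: the codes of the K+1 pairs (j, s) with j <= K are distinct, so they do not all lie
    below K. *)
Lemma base_at_often (s K : nat) : exists2 k, (K <= k)%N & base_at k = s.
Proof.
apply: contrapT => /forall2NP H.
have lt_pickle (j : 'I_K.+1) : (pickle (val j, s) < K)%N.
  have [/negP|] := H (pickle (val j, s)); first by rewrite -ltnNge.
  by rewrite /base_at pair_of_pickle.
have f_inj : injective (fun j : 'I_K.+1 => Ordinal (lt_pickle j)).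
  move=> i j [/(pcan_inj pickleK)[E]]; exact: val_inj.
by have := leq_card _ f_inj; rewrite !card_ord ltnn.
Qed.

(** From stage q on, the pair (h, b) is tested at every transition, and consecutive horizons join
    up, so the tests bound the partial sums of its series. *)
Lemma normal_of_tests (R : realType) (B B' : set nat) (st : nat -> state R) (x : R) (b : nat) :
  (forall b, B b -> (2 <= b)%N) -> (forall k, admissible B k (st k)) ->
  (forall k, transition B B' (base_at k) k (st k) (st k.+1)) ->
  (forall k, test (st k) x <= 1) -> B b -> normal b x.
Proof.
move=> B2 adm trans Hx Bb; apply: weyl_normal; first exact: B2.
move=> h h0; pose q := pickle (h, b).
have qE : pair_of q = (h, b) by exact: pair_of_pickle.
have tq : tested B q by rewrite /tested qE h0 /=; exact/asboolP.
have hor j k : (j <= k)%N -> (horizon (st j) <= horizon (st k))%N.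
  move=> jk; rewrite -(subnKC jk); elim: (k - j)%N => [|i IH]; first by rewrite addn0.
  by rewrite addnS; apply: leq_trans IH (ltnW (horizon_lt (trans _))).
have hor_ge k : (k <= horizon (st k))%N.
  by elim: k => // k IH; apply: leq_ltn_trans IH (horizon_lt (trans k)).
have Hj j : \sum_(horizon (st q) <= N < horizon (st (q + j)%N)) wterm h b N.+1 x <=
    test (st (q + j)%N) x.
  elim: j => [|j IH]; first by rewrite addn0 big_geq// (test_ge0 (adm q)).
  rewrite addnS (big_cat_nat (hor q (q + j)%N (leq_addr _ _)) (ltnW (horizon_lt (trans _))))/=.
  apply: le_trans (lerD IH _) (test_mono (trans (q + j)%N) x).
  rewrite /wsum [leRHS]big_mkcond.
  rewrite [leRHS](bigD1_seq q) ?iota_uniq ?mem_index_iota ?ltnS ?leq_addr//=.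
  rewrite tq qE /= lerDl; apply: sumr_ge0 => p _; case: ifP => // _.
  by apply: sumr_ge0 => N _; exact: wterm_ge0.
apply: (@wavg_lim0 R h b (horizon (st q))) => r'.
have r'le : (r' <= horizon (st (q + r')%N))%N.
  by apply: leq_trans (hor_ge _); exact: leq_addl.
apply: le_trans (Hx (q + r')%N); apply: le_trans (Hj r').
have [qr|rq] := leqP (horizon (st q)) r'.
  rewrite (big_cat_nat qr r'le)/= lerDl.
  by apply: sumr_ge0 => N _; exact: wterm_ge0.
by rewrite big_geq 1?ltnW//; apply: sumr_ge0 => N _; exact: wterm_ge0.
Qed.

Lemma sum_parity (R : realType) (f : nat -> R) (n m : nat) : (n <= m)%N ->
  \sum_(n.*2 <= i < m.*2) f i = \sum_(n <= t < m) (f t.*2 + f t.*2.+1).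
Proof.
elim: m => [|m IH]; first by rewrite leqn0 => /eqP ->; rewrite !big_geq.
rewrite leq_eqVlt => /orP[/eqP <-|nm]; first by rewrite !big_geq.
have nm2 : (n.*2 <= m.*2)%N by rewrite leq_double.
by rewrite doubleS !big_nat_recr//= ?(leqW nm2)// IH// -addrA.
Qed.

(** The mean 1/2 of the even exponents gives n / 2. Each of the two discrepancies, of root at most
    1/8, can take away n / 8. *)
Lemma disc_bias (R : realType) (s n : nat) (x : R) : (0 < n)%N ->
  disc s n 0 x <= 64^-1 -> disc s n 1 x <= 64^-1 ->
  n%:R / 4 <= \sum_(n.*2 <= i < n.*2.*2) cosk (s%:Z ^+ i) x.
Proof.
move=> n0; have nR : 0 < n%:R :> R by rewrite ltr0n.
have lower a : disc s n a x <= 64^-1 -> - (n%:R / 8) <= \sum_(n <= t < n.*2) fluct s a t x.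
  rewrite /disc => H; set S := \sum_(n <= t < _) _ in H *.
  have : - (8^-1) <= n%:R^-1 * S.
    rewrite leNgt; apply/negP; move: (n%:R^-1 * S) H => z H zlt; nra.
  by rewrite ler_pdivlMl// mulrN.
move=> /lower H0 /lower H1.
rewrite sum_parity; last by rewrite -addnn leq_addr.
have E t : cosk (s%:Z ^+ t.*2) x + cosk (s%:Z ^+ t.*2.+1) x =
    fluct s 0 t x + fluct s 1 t x + 1 / 2.
  have E2 : s%:Z ^+ t.*2 = (s ^ 2)%N%:Z ^+ t by rewrite -muln2 mulnC exprM Posz_exp.
  rewrite exprS !E2 /fluct /= expn0 expn1 mul1r mul0r subr0.
  have -> : 1%N%:Z * (s ^ 2)%N%:Z ^+ t = (s ^ 2)%N%:Z ^+ t by exact: mul1r.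
  by move: (cosk _ _) (cosk _ _) => p q; lra.
rewrite (eq_bigr _ (fun t _ => E t)).
have gen (f g : nat -> R) : \sum_(n <= t < n.*2) (f t + g t + 1 / 2) =
    \sum_(n <= t < n.*2) f t + \sum_(n <= t < n.*2) g t + n%:R / 2.
  rewrite !big_split/= sumr_const_nat -[X in (X - _)%N]addnn addnK.
  by rewrite -[X in _ + X = _]mulr_natl mul1r.
rewrite (gen (fun t => fluct s 0 t x) (fun t => fluct s 1 t x)).
by move: H0 H1; lra.
Qed.

Lemma nonnormal_of_tests (R : realType) (B B' : set nat) (st : nat -> state R) (x : R) (s : nat) :
  (forall s, B' s -> (2 <= s)%N) ->
  (forall k, transition B B' (base_at k) k (st k) (st k.+1)) ->
  (forall k, test (st k) x <= 1) -> B' s -> ~ normal s x.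
Proof.
move=> B'2 trans Hx B's nx.
(* Normality will bound the sum over [2n, 4n) by (4n + 2n) / 100, which is less than n / 4. *)
have e100 : 0 < 100^-1 :> R by rewrite invr_gt0.
have [N0 HN0] := normal_weyl (B'2 s B's) nx e100.
have [k Nk ks] := base_at_often s N0.
have tr := trans k; rewrite ks in tr.
have [n [kn d0 d1]] := test_bias tr B's (Hx k.+1).
have n0 : (0 < n)%N by exact: leq_ltn_trans kn.
have nR : 0 < n%:R :> R by rewrite ltr0n.
have Nn : (N0 <= n)%N by apply: leq_trans Nk (ltnW kn).
have Hbias := disc_bias n0 d0 d1.
have Hsum M : (N0 <= M)%N -> (0 < M)%N ->
    `|\sum_(0 <= i < M) cosk (s%:Z ^+ i) x| <= M%:R / 100.
  move=> /HN0 H M0; have MR : 0 < M%:R :> R by rewrite ltr0n.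
  rewrite cabs_wavg ler_pdivrMl// in H; apply: le_trans H.
  have -> : \sum_(0 <= i < M) cosk (s%:Z ^+ i) x = complex.Re (wsum_exp 1 s M x).
    rewrite /wsum_exp (big_morph (@complex.Re R) (id1 := 0) (op1 := +%R)) //; last by case=> ? ? [].
    by apply: eq_bigr => i _; rewrite mul1r.
  exact: cabs_Re.
have n2 : (n.*2 <= n.*2.*2)%N by rewrite -[X in (_ <= X)%N]addnn leq_addr.
have H1 := Hsum n.*2.*2; have H2 := Hsum n.*2.
have n2n : (n <= n.*2)%N by rewrite -addnn leq_addr.
have {}H2 := H2 (leq_trans Nn n2n) (leq_trans n0 n2n).
have {}H1 := H1 (leq_trans Nn (leq_trans n2n n2)) (leq_trans n0 (leq_trans n2n n2)).
move: H1; rewrite (big_cat_nat (leq0n _) n2)/=.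
have Ed j : j.*2%:R = 2 * j%:R :> R by rewrite -muln2 natrM mulrC.
move: H2 Hbias; rewrite !Ed.
set p := \sum_(0 <= i < n.*2) _; set q := \sum_(n.*2 <= i < _) _.
by rewrite !ler_norml => /andP[? ?] ? /andP[? ?]; lra.
Qed.

(** The bases of normality are taken to be all those independent of B', so that this one statement
    also covers the conventions for empty collections. *)
Lemma not_uniqueness_of_bases (R : realType) (B' : set nat) (E : set R) :
  B' `<=` bases ->
  (forall x, x \in `[0, 1[ ->
     (forall b, bases b -> (forall s, B' s -> ~ mult_dependent b s) -> normal b x) ->
     (forall s, B' s -> ~ normal s x) -> E x) ->
  ~ uniqueness_set E.
Proof.
move=> B'2 HE; pose B : set nat := [set b | bases b /\ forall s, B' s -> ~ mult_dependent b s].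
have B2 b : B b -> (2 <= b)%N by case.
have indep b s : B b -> B' s -> forall m n, (0 < m)%N -> (0 < n)%N -> (b ^ m)%N <> (s ^ n)%N.
  by move=> [_ H] /H bs m n m0 n0 e; apply: bs; exists m, n; split.
have [st [st0 adm trans]] := exists_stages R B2 B'2 indep.
apply: (not_uniqueness st0 adm trans) => x x01 Hx; apply: HE => //.
  by move=> b bb bs; apply: (normal_of_tests B2 adm trans Hx).
by move=> s B's; exact: (nonnormal_of_tests B'2 trans Hx B's).
Qed.

Lemma bases_neq0 : bases != set0.
Proof. by apply/set0P; exists 2%N. Qed.

Theorem corollary1p3 (R : realType) :
  (forall B B' : set nat,
     B `<=` bases -> B' `<=` bases -> B `|` B' !=set0 -> compatible B B' ->
     multiplicity_set (partly_normal R B B' `&` `[0, 1[)) /\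
  partly_normal R set0 bases = [set x | forall b, bases b -> ~ normal b x] /\
  multiplicity_set (partly_normal R set0 bases `&` `[0, 1[).
Proof.
have main (B B' : set nat) : B `<=` bases -> B' `<=` bases -> B `|` B' !=set0 ->
    compatible B B' -> multiplicity_set (partly_normal R B B' `&` `[0, 1[).
  move=> sB sB' BB' BcB'; split; first by move=> x [].
  have [B0|B0] := eqVneq B set0.
    (* An empty B asks for non-normality in every base, so the construction runs with all bases in
       place of B'. *)
    apply: (@not_uniqueness_of_bases R bases) => // x x01 _ Hx; split; last exact: x01.
    rewrite /partly_normal /normal_part /nonnormal_part B0 eqxx; split=> //.
    case: eqP => [B'0|_]; last by move=> s /sB'; exact: Hx.
    by case: BB' => b; rewrite B0 B'0 setU0.
  have [B'0|B'0] := eqVneq B' set0.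
    (* Every base is independent of the empty collection, so the points obtained are normal in all
       bases. *)
    apply: (@not_uniqueness_of_bases R set0) => // x x01 Hx _; split; last exact: x01.
    rewrite /partly_normal /normal_part /nonnormal_part B'0 eqxx (negbTE B0); split.
      by move=> b Bb; apply: Hx => //; exact: sB.
    by move=> b bb; apply: Hx.
  apply: (@not_uniqueness_of_bases R B' _ sB') => x x01 Hn Hx; split; last exact: x01.
  rewrite /partly_normal /normal_part /nonnormal_part (negbTE B0) (negbTE B'0); split=> //.
  by move=> b Bb; apply: Hn; [exact: sB|move=> s; exact: BcB'].
split=> //; split.
  rewrite /partly_normal /normal_part /nonnormal_part eqxx (negbTE bases_neq0).
  exact: setIid.
apply: main => //; first by exists 2%N; right.
Qed.
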